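(* Let $d_1,d_2,\ldots,d_n$ be distinct squarefree integers not equal to one, with $n\geq 2$. Let $p$ and $q$ be distinct odd prime integers such that $p$ does not divide $d_i$ and $q$ does not divide $d_i$ ($i=1,\ldots,n$). Let $K=\mathbb{Q}(\sqrt{d_1},\sqrt{d_2},\ldots,\sqrt{d_n})$ and $K_i=\mathbb{Q}(\sqrt{d_i})$ ($i=1,\ldots,n$), with discriminant $\Delta_{K_i}$. Then the quaternion algebra $H_K(p,q)$ is a division algebra if and only if one of the following conditions holds: (1) $p$ and $q$ are odd and distinct, and $\left(\frac{p}{q}\right)=-1$, and ($p\equiv 1 \pmod 4$ or $q\equiv 1\pmod 4$), and ($\left(\frac{\Delta_{K_1}}{p}\right)=\left(\frac{\Delta_{K_2}}{p}\right)=\cdots=\left(\frac{\Delta_{K_n}}{p}\right)=1$ or $\left(\frac{\Delta_{K_1}}{q}\right)=\left(\frac{\Delta_{K_2}}{q}\right)=\cdots=\left(\frac{\Delta_{K_n}}{q}\right)=1$); (2) $q=2$, and ($p\equiv 3\pmod 8$ or $p\equiv 5\pmod 8$), and (either $\left(\frac{\Delta_{K_1}}{p}\right)=\left(\frac{\Delta_{K_2}}{p}\right)=\cdots=\left(\frac{\Delta_{K_n}}{p}\right)=1$ or $d_1,d_2,\ldots,d_n\equiv 1\pmod 8$); (3) $p$ and $q$ are odd, with $p\equiv q\equiv 3\pmod 4$, and (a) or (b) holds: (a) $\left(\frac{q}{p}\right)\neq 1$, and (either $\left(\frac{\Delta_{K_1}}{p}\right)=\left(\frac{\Delta_{K_2}}{p}\right)=\cdots=\left(\frac{\Delta_{K_n}}{p}\right)=1$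 or $d_1,d_2,\ldots,d_n\equiv 1\pmod 8$); (b) $\left(\frac{p}{q}\right)\neq 1$, and (either $\left(\frac{\Delta_{K_1}}{q}\right)=\left(\frac{\Delta_{K_2}}{q}\right)=\cdots=\left(\frac{\Delta_{K_n}}{q}\right)=1$ or $d_1,d_2,\ldots,d_n\equiv 1\pmod 8$).
   Context: For a field $F$ of characteristic $\neq 2$ and $a,b\in F\setminus\{0\}$, $H_F(a,b)$ denotes the generalized quaternion algebra over $F$ with basis $1,i,j,k$ and relations $i^2=a$, $j^2=b$, $ij=-ji=k$. Squarefree integers are nonzero and may be negative. $\left(\frac{m}{\ell}\right)$ is the Legendre symbol for an odd prime $\ell$, equal to $0$ if $\ell\mid m$. The discriminant of $\mathbb{Q}(\sqrt d)$, for $d$ squarefree and not equal to one, is $d$ if $d\equiv 1\pmod 4$ and $4d$ otherwise. *)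

(* Defs.v *)
From HB Require Import structures.
From mathcomp Require Import all_boot all_order all_algebra all_field.
From mathcomp Require Import ring.

Set Implicit Arguments.
Unset Strict Implicit.
Unset Printing Implicit Defensive.

Import GRing.Theory Num.Theory.
Local Open Scope ring_scope.

(* The generalized quaternion algebra H_F(a, b).  [Quaternion x y z t] stands  *)
(* for x + y i + z j + t k.  The multiplication is the bilinear extension of   *)
(* i^2 = a, j^2 = b, ij = -ji = k, from which k^2 = -ab, ik = -ki = aj and     *)
(* kj = -jk = bi.  The ring axioms hold for all a and b, so a, b != 0 and      *)
(* char F != 2 are not required here.                                          *)
Record quaternion (F : fieldType) (a b : F) := Quaternion
  { qre : F; qi : F; qj : F; qk : F }.

Section QuaternionAlgebra.

Variables (F : fieldType) (a b : F).
Local Notation H := (quaternion a b).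
Local Notation Q := (@Quaternion F a b).
Implicit Types u v w : H.

Definition quat_to_prod u := (qre u, qi u, qj u, qk u).
Definition quat_of_prod (p : F * F * F * F) := Q p.1.1.1 p.1.1.2 p.1.2 p.2.

Lemma quat_to_prodK : cancel quat_to_prod quat_of_prod.
Proof. by case. Qed.

HB.instance Definition _ := Choice.copy H (can_type quat_to_prodK).

Definition quat_add u v :=
  Q (qre u + qre v) (qi u + qi v) (qj u + qj v) (qk u + qk v).
Definition quat_opp u := Q (- qre u) (- qi u) (- qj u) (- qk u).
Definition quat_scale (c : F) u := Q (c * qre u) (c * qi u) (c * qj u) (c * qk u).
Definition quat_mul u v :=
  Q (qre u * qre v + a * (qi u * qi v) + b * (qj u * qj v)
       - a * b * (qk u * qk v))
    (qre u * qi v + qi u * qre v + b * (qk u * qj v - qj u * qk v))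
    (qre u * qj v + qj u * qre v + a * (qi u * qk v - qk u * qi v))
    (qre u * qk v + qk u * qre v + qi u * qj v - qj u * qi v).

Fact quat_addA : associative quat_add.
Proof. by move=> [????] [????] [????]; congr Quaternion => /=; ring. Qed.
Fact quat_addC : commutative quat_add.
Proof. by move=> [????] [????]; congr Quaternion => /=; ring. Qed.
Fact quat_add0 : left_id (Q 0 0 0 0) quat_add.
Proof. by move=> [????]; congr Quaternion => /=; ring. Qed.
Fact quat_addN : left_inverse (Q 0 0 0 0) quat_opp quat_add.
Proof. by move=> [????]; congr Quaternion => /=; ring. Qed.

HB.instance Definition _ :=
  GRing.isZmodule.Build H quat_addA quat_addC quat_add0 quat_addN.

Fact quat_mulA : associative quat_mul.
Proof. by move=> [????] [????] [????]; congr Quaternion => /=; ring. Qed.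
Fact quat_mul1l : left_id (Q 1 0 0 0) quat_mul.
Proof. by move=> [????]; congr Quaternion => /=; ring. Qed.
Fact quat_mul1r : right_id (Q 1 0 0 0) quat_mul.
Proof. by move=> [????]; congr Quaternion => /=; ring. Qed.
Fact quat_mulDl : left_distributive quat_mul quat_add.
Proof. by move=> [????] [????] [????]; congr Quaternion => /=; ring. Qed.
Fact quat_mulDr : right_distributive quat_mul quat_add.
Proof. by move=> [????] [????] [????]; congr Quaternion => /=; ring. Qed.
Fact quat_oner_neq0 : Q 1 0 0 0 != 0.
Proof. by apply/eqP => -[] /eqP; rewrite oner_eq0. Qed.

HB.instance Definition _ := GRing.Zmodule_isNzRing.Build H
  quat_mulA quat_mul1l quat_mul1r quat_mulDl quat_mulDr quat_oner_neq0.

Fact quat_scaleA c e u : quat_scale c (quat_scale e u) = quat_scale (c * e) u.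
Proof. by case: u => ????; congr Quaternion => /=; ring. Qed.
Fact quat_scale1 : left_id 1 quat_scale.
Proof. by move=> [????]; congr Quaternion => /=; ring. Qed.
Fact quat_scaleDr : right_distributive quat_scale quat_add.
Proof. by move=> c [????] [????]; congr Quaternion => /=; ring. Qed.
Fact quat_scaleDl u : {morph quat_scale^~ u : c e / c + e >-> quat_add c e}.
Proof. by case: u => ???? c e; congr Quaternion => /=; ring. Qed.

HB.instance Definition _ := GRing.Zmodule_isLmodule.Build F H
  quat_scaleA quat_scale1 quat_scaleDr quat_scaleDl.

Fact quat_scaleAl c u v : c *: (u * v) = (c *: u) * v.
Proof. by case: u v => [????] [????]; congr Quaternion => /=; ring. Qed.

HB.instance Definition _ := GRing.Lmodule_isLalgebra.Build F H quat_scaleAl.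

Fact quat_scaleAr c u v : c *: (u * v) = u * (c *: v).
Proof. by case: u v => [????] [????]; congr Quaternion => /=; ring. Qed.

HB.instance Definition _ := GRing.Lalgebra_isAlgebra.Build F H quat_scaleAr.

Let I : H := Q 0 1 0 0.
Let J : H := Q 0 0 1 0.
Let K : H := Q 0 0 0 1.

Lemma quat_relations : [/\ I * I = a%:A, J * J = b%:A, I * J = K & J * I = - K].
Proof. by split; congr Quaternion => /=; ring. Qed.

Lemma quat_basis (x y z t : F) :
  x%:A + y *: I + z *: J + t *: K = Quaternion a b x y z t.
Proof. by congr Quaternion => /=; ring. Qed.

End QuaternionAlgebra.

Definition is_division_algebra (F : fieldType) (A : algType F) : Prop :=
  forall x : A, x != 0 -> exists y : A, x * y = 1 /\ y * x = 1.

(* 0 is excluded, being divisible by 2 ^ 2. *)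
Definition squarefree (d : int) : Prop :=
  forall m : int, (m ^+ 2 %| d)%Z -> m \is a GRing.unit.

Definition legendre (m : int) (l : nat) : int :=
  if (l %| m)%Z then 0
  else if [exists x : 'I_l, (x%:Z ^+ 2 == m %[mod l])%Z] then 1 else - 1.

(* The discriminant of Q(sqrt d), for d squarefree and not equal to 1. *)
Definition quad_disc (d : int) : int :=
  if (d == 1 %[mod 4])%Z then d else 4 * d.

(* L is Q(sqrt d_1, ..., sqrt d_n), given up to isomorphism: L is generated    *)
(* over Q by a family of square roots of the d_i.                              *)
Definition is_multiquadratic (n : nat) (d : 'I_n -> int) (L : fieldExtType rat)
    : Prop :=
  exists2 s : 'I_n -> L, forall i, s i ^+ 2 = (d i)%:~R
                       & <<1 & [seq s i | i : 'I_n]>>%VS = fullv.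

Lemma multiquadratic_exists (n : nat) (d : 'I_n -> int) :
  exists L : fieldExtType rat, is_multiquadratic d L.
Proof.
have [L [f [s1 fs genL]]] :=
  num_field_exists [seq 2.-root ((d i)%:~R : algC) | i : 'I_n].
have szs : size s1 = n by rewrite -(size_map f) fs size_map -cardE card_ord.
exists L, (fun i => s1`_i); last first.
  rewrite -genL; congr <<_ & _>>%VS; apply: (@eq_from_nth _ 0) => [|i].
    by rewrite size_map -cardE card_ord.
  rewrite size_map -cardE card_ord => lt_in.
  by rewrite (nth_map (Ordinal lt_in)) ?size_enum_ord // nth_enum_ord.
move=> i; apply: (fmorph_inj f); rewrite rmorphXn rmorph_int /=.
rewrite -(nth_map 0 0 f) ?szs // fs (nth_map i) ?size_enum_ord //.
by rewrite nth_ord_enum rootCK.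
Qed.

(* Main.v *)
(** The algebra H_K(p, q) is a division algebra iff its norm form
    <1, -p, -q, pq> is anisotropic over K.  If all the d_i are squares in Q_l
    for a prime l among p, q and 2 at which H_Q(p, q) ramifies, then K embeds
    into Q_l and a solution of N = 0 is excluded by congruences modulo p^2, q^2
    or 8.  Otherwise, by quadratic reciprocity, H_Q(p, q) is split or ramifies
    at exactly two primes, and the squarefree part m of some d_i or d_i d_j is
    a nonsquare at both.  The Hasse principle for the quaternary form
    <p, q, -pq, -m> is replaced by an explicit choice: if w is such that the
    two ternary equations x^2 - p y^2 = q w z^2 and m X^2 - w Y^2 = p Z^2
    satisfy the conditions of Legendre's theorem, then over K, where m is a
    square, w and q w are norms from K(sqrt p), hence so is q.  Up to sign and
    factors 2 and q, w is a prime with prescribed quadratic characters.  It is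
    provided by Dirichlet's theorem for real characters, proved a la Mertens:
    sum chi(n) Lambda(n) / n is bounded because L(1, chi) > 0, and the latter
    follows from the fact that r = 1 * chi is nonnegative and at least 1 at
    squares. *)
Require Import Defs.
From HB Require Import structures.
From mathcomp Require Import all_boot all_order all_algebra all_field.
From mathcomp Require Import zify ring lra.
From mathcomp Require Import reals exp Rstruct.
From mathcomp Require boolp.

Set Implicit Arguments.
Unset Strict Implicit.
Unset Printing Implicit Defensive.

Import GRing.Theory Num.Theory Order.TTheory.
Local Open Scope ring_scope.

(** Legendre's theorem asks for a square modulo every prime of the coefficients, so the auxiliary
    prime l has to see p and m as squares. These two conditions cannot be imposed: reciprocity
    expresses them through the symbols of l at p and at the odd primes of m and through l modulo 8.
    Those symbols are fixed by the other local conditions, so the class of l modulo 8 and a factor 2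
    are the only freedom left. A finite check shows that it suffices; that m is a nonsquare at both
    ramified primes enters there. All requirements on l are quadratic, which is why real characters
    are enough and no complex L-value has to be bounded away from 0.

    The field Q_l is never built. To refute a zero of the norm form, one congruence modulo a large
    power of l is enough, and for this it suffices to map K additively to Q so that products are
    respected modulo that power. *)

Local Notation expR := sequences.expR.

(** * Quadratic residues *)

Section PrimeField.
Variables (p : nat) (pr_p : prime p) (odd_p : odd p).
Local Notation h := (p.-1./2).

Let p_gt2 : (2 < p)%N. Proof. by rewrite odd_prime_gt2. Qed.
Let hE : p = (h.*2).+1. Proof. by have := odd_double_half p.-1; lia. Qed.

Lemma natr_Fp_eq0 n : (n%:R == 0 :> 'F_p) = (p %| n)%N.
Proof. by rewrite -(dvdn_pcharf (pchar_Fp pr_p)). Qed.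

Lemma intr_Fp_eq0 (a : int) : (a%:~R == 0 :> 'F_p) = (p %| a)%Z.
Proof.
rewrite dvdzE /= -natr_Fp_eq0; case: a => n //.
by rewrite NegzE rmorphN /= oppr_eq0.
Qed.

Lemma intr_Fp_eq (a b : int) :
  (a%:~R == b%:~R :> 'F_p) = (a == b %[mod p])%Z.
Proof. by rewrite eqz_mod_dvd -intr_Fp_eq0 rmorphB /= subr_eq0. Qed.

Lemma Fp_intr (x : 'F_p) : exists2 i : 'I_p, x = (i : nat)%:Z%:~R & (i : nat) = x.
Proof.
have lt_xp : ((x : nat) < p)%N by have := ltn_ord x; rewrite {2}Fp_cast.
by exists (Ordinal lt_xp); rewrite //= -[LHS]natr_Zp.
Qed.

Lemma Fp_fermat (x : 'F_p) : x != 0 -> x ^+ h.*2 = 1.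
Proof.
have -> : h.*2 = p.-1 by lia.
move=> x0; apply: (mulIf x0); rewrite mul1r -exprSr prednK ?prime_gt0 //.
by have := expf_card x; rewrite card_Fp.
Qed.

Lemma Fp_pow_half (x : 'F_p) : x != 0 -> x ^+ h = 1 \/ x ^+ h = -1.
Proof.
move=> x0; suff: (x ^+ h) ^+ 2 == 1.
  by rewrite sqrf_eq1 => /orP[] /eqP ->; [left | right].
by rewrite -exprM muln2 Fp_fermat.
Qed.

Lemma Fp_square_inj i j : (0 < i <= h)%N -> (0 < j <= h)%N ->
  i%:R ^+ 2 = j%:R ^+ 2 :> 'F_p -> i = j.
Proof.
wlog le_ij : i j / (i <= j)%N.
  by move=> W; case: (leqP i j) => [/W//|/ltnW /W W' *]; apply/esym/W'.
move=> ih jh /eqP; rewrite eq_sym -subr_eq0 subr_sqr mulf_eq0 -natrB // -natrD.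
rewrite !natr_Fp_eq0 => /orP[] dv.
  case: (posnP (j - i)) => [|gt0]; first by lia.
  by have := dvdn_leq gt0 dv; lia.
by have := @dvdn_leq _ (j + i) _ dv; lia.
Qed.

(** The squares of 1, ..., h are already h distinct roots of X^h - 1, so one more root would exceed
    the degree. *)
Lemma Fp_euler (x : 'F_p) : x != 0 -> x ^+ h = 1 -> exists y, y ^+ 2 = x.
Proof.
move=> x0 xh; pose rs := [seq i%:R ^+ 2 : 'F_p | i <- iota 1 h].
have [/mapP[i _ ->]|xNrs] := boolP (x \in rs); first by exists i%:R.
have h_gt0 : (0 < h)%N by lia.
have szP : size ('X^h - 1%:P : {poly 'F_p}) = h.+1 by rewrite size_XnsubC.
have P0 : 'X^h - 1%:P != 0 :> {poly 'F_p} by rewrite -size_poly_gt0 szP.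
suff: (size (x :: rs) < h.+1)%N by rewrite /= size_map size_iota ltnn.
rewrite -szP; apply: max_poly_roots => //=.
  rewrite rootE !hornerE xh subrr eqxx /=; apply/allP => _ /mapP[i + ->].
  rewrite mem_iota => ih; rewrite rootE !hornerE -exprM mul2n.
  rewrite Fp_fermat; first by rewrite subrr.
  by rewrite natr_Fp_eq0 gtnNdvd //; lia.
rewrite xNrs map_inj_in_uniq ?iota_uniq // => i j.
by rewrite !mem_iota => ih jh; apply: Fp_square_inj; lia.
Qed.

Lemma legendre_euler (a : int) : (legendre a p)%:~R = a%:~R ^+ h :> 'F_p.
Proof.
rewrite /legendre; case: ifP => [|/negbT].
  by rewrite -intr_Fp_eq0 => /eqP ->; rewrite expr0n; case: (h) hE p_gt2 => //; lia.
rewrite -intr_Fp_eq0 => a0; case: ifP => [/existsP[x]|/existsP nsq].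
  rewrite -intr_Fp_eq rmorphXn /= => /eqP ax; rewrite -ax -exprM mul2n.
  rewrite Fp_fermat //.
  by apply: contraNneq a0 => x0; rewrite -ax x0 expr0n.
case: (Fp_pow_half a0) => [/(Fp_euler a0)[y ya]|->]; last by [].
case: nsq; have [i yi _] := Fp_intr y; exists i.
by rewrite -intr_Fp_eq rmorphXn /= -yi ya.
Qed.

Lemma legendre_val (a : int) : ~~ (p %| a)%Z -> legendre a p = 1 \/ legendre a p = -1.
Proof. by rewrite /legendre => /negbTE ->; case: ifP; [left | right]. Qed.

Lemma legendre0 (a : int) : (legendre a p == 0) = (p %| a)%Z.
Proof. by rewrite /legendre; case: ifP => // _; case: ifP. Qed.

(** Since p > 2, the values 0, 1 and -1 stay distinct in F_p. Identities between symbols are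
    therefore proved in F_p, where Euler's criterion turns them into identities of powers. *)
Lemma legendre_inj (u v : int) : u \in [:: 0; 1; -1] -> v \in [:: 0; 1; -1] ->
  u%:~R = v%:~R :> 'F_p -> u = v.
Proof.
move=> + + /eqP; rewrite intr_Fp_eq eqz_mod_dvd !inE.
move=> /or3P[] /eqP -> /or3P[] /eqP -> //; rewrite dvdzE /=;
  by rewrite ?subrr //; move/(dvdn_leq (ltn0Sn _)); lia.
Qed.

Lemma legendre_mem (a : int) : legendre a p \in [:: 0; 1; -1].
Proof. by rewrite /legendre; do 2?case: ifP. Qed.

Lemma legendreM (a b : int) : legendre (a * b) p = legendre a p * legendre b p.
Proof.
apply: legendre_inj; first exact: legendre_mem.
  by have := legendre_mem a; have := legendre_mem b;
     rewrite !inE => /or3P[] /eqP -> /or3P[] /eqP ->.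
by rewrite rmorphM /= !legendre_euler rmorphM exprMn.
Qed.

Lemma legendre_mod (a b : int) : (a == b %[mod p])%Z -> legendre a p = legendre b p.
Proof.
rewrite -intr_Fp_eq => /eqP ab.
by apply: legendre_inj; rewrite ?legendre_mem // !legendre_euler ab.
Qed.

Lemma legendre_sqr (a b : int) : (a == b ^+ 2 %[mod p])%Z -> ~~ (p %| a)%Z -> legendre a p = 1.
Proof.
rewrite -legendre0 => /legendre_mod ->; rewrite expr2 legendreM.
by have := legendre_mem b; rewrite !inE => /or3P[] /eqP ->.
Qed.

Lemma legendre_one : legendre 1 p = 1.
Proof.
by apply: (@legendre_sqr _ 1); rewrite ?expr1n // dvdzE /= dvdn1 neq_ltn prime_gt1 ?orbT.
Qed.

Lemma legendre1P (a : int) : legendre a p = 1 -> exists t : int, (p %| t ^+ 2 - a)%Z.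
Proof.
rewrite /legendre; case: ifP => // _; case: ifP => // /existsP[x xa] _.
by exists (Posz x); rewrite -eqz_mod_dvd.
Qed.

Lemma legendreN1 : legendre (-1) p = (-1) ^+ h.
Proof.
apply: legendre_inj; first exact: legendre_mem.
  by rewrite -signr_odd; case: odd.
by rewrite legendre_euler rmorphXn /=.
Qed.

(** X^h - 1 has too few roots to vanish at all p - 1 nonzero classes. *)
Lemma legendre_nonresidue : exists2 a : int, ~~ (p %| a)%Z & legendre a p = -1.
Proof.
have P0 : 'X^h - 1%:P != 0 :> {poly 'F_p}.
  by rewrite -size_poly_gt0 size_XnsubC //; lia.
pose rs := [seq i%:R : 'F_p | i <- iota 1 p.-1].
have [allr|/allPn[_ /mapP[i + ->]]] := boolP (all (root ('X^h - 1%:P)) rs).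
  have := max_poly_roots P0 allr; rewrite size_XnsubC ?size_map ?size_iota; last by lia.
  suff: uniq rs by move=> -> /(_ isT); lia.
  rewrite map_inj_in_uniq ?iota_uniq // => i j; rewrite !mem_iota => ih jh /eqP.
  rewrite !pmulrn intr_Fp_eq => /eqP /(congr1 absz); rewrite !modz_nat /= !modn_small; lia.
rewrite mem_iota => ih; rewrite rootE !hornerE subr_eq0 => ne1; exists i%:Z.
  by rewrite dvdzE gtnNdvd //; lia.
case: (@legendre_val i%:Z) => //.
  by rewrite dvdzE gtnNdvd //; lia.
move=> l1; case/eqP: ne1; have := legendre_euler i%:Z; rewrite l1 -pmulrn => <-.
by [].
Qed.

Section GaussLemma.
Variables (a : nat) (pNa : ~~ (p %| a)%N).

Let r j := (a * j %% p)%N.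
(** The residue of a j of least absolute value is (-1)^(neg j) u j. *)
Let u j := if (r j <= h)%N then r j else (p - r j)%N.
Let neg j : nat := (h < r j)%N.

Let r_lt j : (r j < p)%N. Proof. by rewrite ltn_mod; lia. Qed.

Let r_gt0 j : (0 < j <= h)%N -> (0 < r j)%N.
Proof.
move=> jh; rewrite lt0n -/(p %| a * j)%N Euclid_dvdM // (negPf pNa) /=.
by rewrite gtnNdvd //; lia.
Qed.

Let u_range j : (0 < j <= h)%N -> (0 < u j <= h)%N.
Proof. by move=> /r_gt0; have := r_lt j; rewrite /u; case: ifP; lia. Qed.

Let r_natr j : (r j)%:R = (a * j)%:R :> 'F_p.
Proof. by apply/eqP; rewrite !pmulrn intr_Fp_eq !modz_nat modn_mod. Qed.

Let u_natr j : (a * j)%:R = (-1) ^+ neg j * (u j)%:R :> 'F_p.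
Proof.
rewrite -r_natr /u /neg ltnNge; case: ifP => _ /=; first by rewrite mul1r.
rewrite natrB; last exact/ltnW/r_lt.
have p0 : p%:R = 0 :> 'F_p by apply/eqP; rewrite natr_Fp_eq0.
by rewrite p0; ring.
Qed.

(** From u i = u j follows (a i)^2 = (a j)^2, and a square determines its root within 1, ..., h. *)
Let u_perm : perm_eq [seq u j | j <- iota 1 h] (iota 1 h).
Proof.
have u_uniq : uniq [seq u j | j <- iota 1 h].
  rewrite map_inj_in_uniq ?iota_uniq // => i j; rewrite !mem_iota => ih jh uij.
  have a0 : (a%:R : 'F_p) ^+ 2 != 0 by rewrite expf_neq0 // natr_Fp_eq0.
  apply: Fp_square_inj; [lia..|apply: (mulfI a0)].
  rewrite -!exprMn -!natrM !u_natr uij !exprMn -!exprM.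
  by rewrite !(mulnC _ 2%N) !exprM sqrrN expr1n !expr1n.
apply: uniq_perm; rewrite ?iota_uniq //.
apply: (uniq_min_size u_uniq _ _).2; last by rewrite size_map.
by move=> _ /mapP[j + ->]; rewrite !mem_iota; have := @u_range j; lia.
Qed.

(** The product of the a j over 1 <= j <= h is a^h h!. As [u] permutes 1, ..., h, it is also h! with
    one sign for each j such that a j mod p > h; then h! cancels. *)
Lemma gauss_lemma : legendre a p = (-1) ^+ (\sum_(j <- iota 1 h) (h < a * j %% p)%N)%N.
Proof.
apply: legendre_inj; first exact: legendre_mem.
  by rewrite -signr_odd; case: odd.
have f0 : \prod_(j <- iota 1 h) (j%:R : 'F_p) != 0.
  rewrite prodf_seq_neq0; apply/allP => j; rewrite mem_iota => jh.
  by rewrite natr_Fp_eq0 gtnNdvd //=; lia.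
apply: (mulIf f0); rewrite legendre_euler -pmulrn.
have -> : (a%:R : 'F_p) ^+ h = \prod_(j <- iota 1 h) a%:R.
  by rewrite big_const_seq count_predT size_iota iter_mulr_1.
rewrite -big_split /=.
under eq_bigr do rewrite -natrM u_natr.
rewrite big_split /= rmorphXn rmorphN1 -(big_morph _ (exprD _) (expr0 _)).
by congr (_ * _); rewrite -[RHS](perm_big _ u_perm) big_map.
Qed.

(** Modulo 2 the division of a j by p reads j = r j + floor(a j / p), and r j is u j or 1 + u j
    according to [neg j]. Summed over j, the terms j and u j cancel because [u] is a permutation. *)
Lemma gauss_eisenstein : odd a ->
  legendre a p = (-1) ^+ (\sum_(j <- iota 1 h) (a * j %/ p))%N.
Proof.
move=> odd_a; rewrite gauss_lemma -signr_odd -[RHS]signr_odd; congr (_ ^+ _).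
have E j : odd j = odd (neg j) (+) odd (u j) (+) odd (a * j %/ p).
  have := congr1 odd (divn_eq (a * j) p); rewrite -/(r j) oddM oddD oddM odd_a odd_p /=.
  rewrite andbT /u /neg ltnNge; case: ifP => _ /=.
    by move=> ->; rewrite addbC.
  rewrite oddB; last exact/ltnW/r_lt.
  by rewrite odd_p => ->; case: odd; case: odd.
have odd_sum (F : nat -> nat) s : odd (\sum_(j <- s) F j)%N = \big[addb/false]_(j <- s) odd (F j).
  exact: (big_morph _ oddD).
have Eu : \big[addb/false]_(j <- iota 1 h) odd j =
          \big[addb/false]_(j <- iota 1 h) odd (u j).
  by rewrite -(perm_big _ u_perm) big_map.
move: Eu; rewrite (eq_bigr _ (fun j _ => E j)) !big_split /= !odd_sum.
by do 3!case: (\big[_/_]_(_ <- _) _).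
Qed.
End GaussLemma.

End PrimeField.

Lemma sum_leq_iota n N : (n <= N)%N -> (\sum_(i <- iota 1 N) (i <= n)%N)%N = n.
Proof.
elim: N n => [|N IH] n nN; first by rewrite big_nil; lia.
rewrite -[N.+1]addn1 iotaD big_cat /= big_seq1 add1n.
case: (ltnP N n) => [Nn|/IH ->]; last by rewrite addn0.
have -> : n = N.+1 by lia.
rewrite (eq_big_seq (fun=> 1%N)) => [|i]; last by rewrite mem_iota; lia.
by rewrite big_const_seq count_predT size_iota iter_addn_0; lia.
Qed.

(** The two sums count the lattice points of a (p-1)/2 by (q-1)/2 rectangle on either side of the
    diagonal, which contains none of them because p and q are distinct primes. *)
Lemma eisenstein_lattice p q : prime p -> prime q -> odd p -> odd q -> p != q ->
  (\sum_(j <- iota 1 p.-1./2) (q * j %/ p) +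
   \sum_(i <- iota 1 q.-1./2) (p * i %/ q) = p.-1./2 * q.-1./2)%N.
Proof.
move=> pr_p pr_q odd_p odd_q neq_pq.
have Ep := odd_double_half p.-1; have Eq := odd_double_half q.-1.
have p0 := prime_gt0 pr_p; have q0 := prime_gt0 pr_q.
have floorE a b : (0 < a)%N -> (0 < b)%N -> odd a -> odd b ->
    (\sum_(j <- iota 1 a.-1./2) (b * j %/ a))%N =
    (\sum_(j <- iota 1 a.-1./2) \sum_(i <- iota 1 b.-1./2) (i * a <= b * j)%N)%N.
  move=> a0 b0 odd_a odd_b; apply: eq_big_seq => j; rewrite mem_iota => jh.
  rewrite -[LHS](@sum_leq_iota _ b.-1./2); first by apply: eq_bigr => i _; rewrite leq_divRL.
  rewrite -ltnS ltn_divLR //.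
  have := odd_double_half a.-1; have := odd_double_half b.-1; nia.
rewrite !floorE // exchange_big -big_split /=.
rewrite (eq_big_seq (fun=> p.-1./2)) => [|i].
  by rewrite big_const_seq count_predT size_iota iter_addn_0 mulnC.
rewrite mem_iota => ih; rewrite -big_split /= (eq_big_seq (fun=> 1%N)) => [|j].
  by rewrite big_const_seq count_predT size_iota iter_addn_0; lia.
rewrite mem_iota => jh; suff: (i * p != q * j)%N by lia.
apply/eqP => E; have: (p %| q * j)%N by rewrite -E dvdn_mull.
rewrite Euclid_dvdM // dvdn_prime2 // (negPf neq_pq) /= gtnNdvd //; lia.
Qed.

(* For odd n, the values of (-1/n) and (2/n) are (-1) ^+ is3mod4 n and         *)
(* (-1) ^+ is35mod8 n.                                                        *)
Definition is3mod4 (n : nat) : bool := (n %% 4 == 3)%N.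
Definition is35mod8 (n : nat) : bool := (n %% 8 == 3)%N || (n %% 8 == 5)%N.

Lemma is3mod4_odd_half n : odd n -> is3mod4 n = odd n.-1./2.
Proof.
rewrite /is3mod4 => odd_n; have nE : n = (n %/ 4 * 4 + n %% 4)%N := divn_eq n 4.
move: (n %/ 4)%N nE => k nE.
have: (n %% 4 == 1)%N || (n %% 4 == 3)%N by lia.
case/orP => /eqP nr; rewrite nr /= in nE *.
  have -> : n.-1 = k.*2.*2 by lia.
  by rewrite doubleK odd_double.
have -> : n.-1 = k.*2.+1.*2 by lia.
by rewrite doubleK /= odd_double.
Qed.

Lemma quadratic_reciprocity p q : prime p -> prime q -> odd p -> odd q -> p != q ->
  legendre p q = (-1) ^+ (is3mod4 p && is3mod4 q) * legendre q p.
Proof.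
move=> pr_p pr_q odd_p odd_q neq_pq.
have pNq : ~~ (p %| q)%N by rewrite dvdn_prime2.
have qNp : ~~ (q %| p)%N by rewrite dvdn_prime2 // eq_sym.
rewrite (gauss_eisenstein pr_p) // (gauss_eisenstein pr_q) //.
have := eisenstein_lattice pr_p pr_q odd_p odd_q neq_pq.
move: (\sum_(_ <- _) _)%N (\sum_(_ <- _) _)%N => x y /(congr1 odd).
rewrite oddD oddM => E; rewrite -signr_odd -[(-1) ^+ y]signr_odd.
rewrite !is3mod4_odd_half //.
by rewrite -E; case: (odd x); case: (odd y).
Qed.

Lemma legendreN1E p : prime p -> odd p -> legendre (-1) p = (-1) ^+ is3mod4 p.
Proof.
by move=> pr_p odd_p; rewrite legendreN1 // -signr_odd is3mod4_odd_half.
Qed.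

Lemma legendre2E p : prime p -> odd p -> legendre 2 p = (-1) ^+ is35mod8 p.
Proof.
move=> pr_p odd_p; have p2 := odd_prime_gt2 odd_p pr_p.
rewrite (gauss_lemma pr_p odd_p (a := 2)); last by rewrite gtnNdvd.
have E := odd_double_half p.-1; have E' := odd_double_half p.-1./2.
(* For j <= h = (p - 1)/2 the product 2 j is its own residue; it exceeds h exactly when j > h/2,
   which leaves uphalf h values of j. *)
have -> : (\sum_(j <- iota 1 p.-1./2) (p.-1./2 < 2 * j %% p)%N = uphalf p.-1./2)%N.
  rewrite -[iota _ _](cat_take_drop p.-1./2./2) big_cat take_iota drop_iota /=.
  rewrite [X in (X + _)%N]big1_seq /= => [|j]; last first.
    by rewrite mem_iota => jh; rewrite modn_small; lia.
  rewrite (eq_big_seq (fun=> 1%N)) => [|j]; last first.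
    by rewrite mem_iota => jh; rewrite modn_small; lia.
  by rewrite big_const_seq count_predT size_iota iter_addn_0; lia.
have pE : p = (p %/ 8 * 8 + p %% 8)%N := divn_eq p 8.
rewrite -signr_odd /is35mod8; move: (p %/ 8)%N pE => k pE.
have: (p %% 8 \in [:: 1; 3; 5; 7])%N by rewrite !inE; lia.
rewrite !inE => /or4P[] /eqP pr; rewrite pr /= in pE *.
- have -> : uphalf p.-1./2 = k.*2 by lia.
  by rewrite odd_double.
- have -> : uphalf p.-1./2 = k.*2.+1 by lia.
  by rewrite /= odd_double.
- have -> : uphalf p.-1./2 = k.*2.+1 by lia.
  by rewrite /= odd_double.
have -> : uphalf p.-1./2 = k.+1.*2 by lia.
by rewrite odd_double.
Qed.

(** * Divisor sums *)

Section DivisorSums.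
Variable V : nmodType.

Lemma sum_multiples (H : nat -> V) d X : (0 < d)%N ->
  \sum_(1 <= n < X.+1 | (d %| n)%N) H (n %/ d)%N = \sum_(1 <= e < (X %/ d).+1) H e.
Proof.
move=> d0; elim: X => [|X IH]; first by rewrite div0n !big_geq.
rewrite big_mkcond big_nat_recr //= -big_mkcond IH.
rewrite !divnS //; case: (d %| X.+1)%N => /=; last by rewrite addr0 add0n.
by rewrite add1n [RHS]big_nat_recr.
Qed.

Lemma sum_divisors_iota (F : nat -> V) n X : (0 < n <= X)%N ->
  \sum_(d <- divisors n) F d = \sum_(1 <= d < X.+1 | (d %| n)%N) F d.
Proof.
move=> nX; rewrite -[RHS]big_filter; apply: perm_big; apply: uniq_perm.
- exact: divisors_uniq.
- by rewrite filter_uniq // iota_uniq.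
move=> d; rewrite mem_filter mem_index_iota -dvdn_divisors; last by lia.
case dn: (d %| n)%N => //=; have := dvdn_leq _ dn; have := dvdn_gt0 _ dn; lia.
Qed.

Lemma sum_divisors_swap (G : nat -> nat -> V) X :
  \sum_(1 <= n < X.+1) \sum_(d <- divisors n) G d (n %/ d)%N =
  \sum_(1 <= d < X.+1) \sum_(1 <= e < (X %/ d).+1) G d e.
Proof.
rewrite (eq_big_nat _ _ (F2 := fun n =>
  \sum_(1 <= d < X.+1) if (d %| n)%N then G d (n %/ d)%N else 0)) => [|n nX].
  rewrite exchange_big_nat; apply: eq_big_nat => d dX.
  by rewrite -big_mkcond sum_multiples //; lia.
by rewrite (sum_divisors_iota (fun d => G d (n %/ d)%N) nX) big_mkcond.
Qed.

Lemma sum_divisors_pfactor (F : nat -> V) p v n : prime p -> (0 < n)%N -> ~~ (p %| n)%N ->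
  \sum_(d <- divisors (p ^ v * n)) F d =
  \sum_(j <- iota 0 v.+1) \sum_(e <- divisors n) F (p ^ j * e)%N.
Proof.
move=> pr_p n0 pNn; have p0 := prime_gt0 pr_p.
have pv0 j : (0 < p ^ j)%N by rewrite expn_gt0 p0.
have lognE j e : (e %| n)%N -> logn p (p ^ j * e) = j.
  move=> en; have e0 := dvdn_gt0 n0 en.
  rewrite lognM // pfactorK // lognE; case: ifP => [/and3P[_ _ pe]|_]; last by rewrite addn0.
  by rewrite (dvdn_trans pe en) in pNn.
rewrite -(big_allpairs_dep (h := fun j e => p ^ j * e)%N); apply: perm_big; apply: uniq_perm.
- exact: divisors_uniq.
- apply: allpairs_uniq; rewrite ?iota_uniq ?divisors_uniq // => -[j e] [j' e'].
  move=> /allpairsP[[j1 e1] [_ + [-> ->]]] /allpairsP[[j2 e2] [_ + [-> ->]]].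
  rewrite /= => e1n e2n E.
  rewrite -!dvdn_divisors // in e1n e2n; have := congr1 (logn p) E.
  rewrite !lognE // => jj; rewrite {}jj in E *; congr (_, _).
  by move/eqP: E; rewrite eqn_pmul2l // => /eqP.
move=> d; rewrite -dvdn_divisors; last by rewrite muln_gt0 pv0.
apply/idP/allpairsP => [dpn|[[j e] [+ + ->]]]; last first.
  rewrite mem_iota -dvdn_divisors // => jv en; rewrite dvdn_mul // dvdn_exp2l //; lia.
have d0 : (0 < d)%N by apply: dvdn_gt0 dpn; rewrite muln_gt0 pv0.
have [e pNe dE] := pfactor_coprime pr_p d0.
rewrite mulnC in dE; exists (logn p d, e); split=> //.
  rewrite mem_iota leq0n add0n ltnS /=.
  have := dvdn_leq_log p _ dpn; rewrite muln_gt0 pv0 n0 => /(_ isT).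
  by rewrite lognE // pfactorK.
rewrite -dvdn_divisors //; have : (e %| p ^ v * n)%N by rewrite (dvdn_trans _ dpn) // dE dvdn_mull.
by rewrite Gauss_dvdr // coprime_sym coprimeXl.
Qed.

End DivisorSums.

(** * Real characters *)

Section RealCharacters.
Variable R : realType.
Implicit Types (chi psi : nat -> R) (N : nat).

(** A real Dirichlet character modulo N: [real_char_sqr] says at once that the values are 1 or -1 at
    n coprime to N and 0 elsewhere. *)
Record real_char N chi := RealChar {
  real_charM : {morph chi : m n / (m * n)%N >-> m * n};
  real_charD : forall n, chi (n + N)%N = chi n;
  real_char_sqr : forall n, chi n ^+ 2 = (coprime N n)%:R }.

Lemma real_char_coprime N : real_char N (fun n => (coprime N n)%:R).
Proof.
split=> [m n|n|n]; first by rewrite coprimeMr -natrM mulnb.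
  by rewrite /coprime gcdnDr.
by rewrite -natrX; case: coprime.
Qed.

Lemma real_char_mul N chi psi : real_char N chi -> real_char N psi ->
  real_char N (fun n => chi n * psi n).
Proof.
case=> cM cD cS [pM pD pS]; split=> [m n|n|n]; first by rewrite cM pM mulrACA.
  by rewrite cD pD.
by rewrite exprMn cS pS -natrM mulnb andbb.
Qed.

Section Char.
Variables (N : nat) (chi : nat -> R).
Hypotheses (N_gt0 : (0 < N)%N) (chiP : real_char N chi).

Lemma real_char_mod n : chi (n %% N)%N = chi n.
Proof.
rewrite [in RHS](divn_eq n N); elim: (n %/ N)%N => [|k IH]; first by rewrite add0n.
by rewrite mulSn -addnA [(N + _)%N]addnC (real_charD chiP).
Qed.

Lemma real_char1 : chi 1 = 1.
Proof.
have /eqP := real_charM chiP 1 1; have := real_char_sqr chiP 1; rewrite mul1n coprimen1.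
move=> c1; rewrite -expr2 c1 => /eqP; by [].
Qed.

Lemma real_char_val n : [\/ chi n = 0, chi n = 1 | chi n = -1].
Proof.
have := real_char_sqr chiP n; case: coprime => [/eqP|/eqP].
  by rewrite sqrf_eq1 => /orP[] /eqP ->; [apply: Or32 | apply: Or33].
by rewrite sqrf_eq0 => /eqP; apply: Or31.
Qed.

Lemma real_char_norm n : `|chi n| <= 1.
Proof. by case: (real_char_val n) => ->; rewrite ?normr0 ?normrN ?normr1. Qed.

Lemma real_charX n k : chi (n ^ k)%N = chi n ^+ k.
Proof. by elim: k => [|k IH]; rewrite ?expn0 ?real_char1 // expnS exprS (real_charM chiP) IH. Qed.

Lemma real_char_ncoprime n : ~~ coprime N n -> chi n = 0.
Proof. by move/negbTE=> nc; apply/eqP; rewrite -sqrf_eq0 (real_char_sqr chiP) nc. Qed.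

(** These are the values of 1 * chi at p^v: constantly 1, or v + 1, or alternately 1 and 0. At even
    v each of them is at least 1. *)
Lemma geometric_sum_sign c v : [\/ c = 0, c = 1 | c = -1] ->
  0 <= \sum_(j <- iota 0 v.+1) c ^+ j :> R /\
  (~~ odd v -> 1 <= \sum_(j <- iota 0 v.+1) c ^+ j :> R).
Proof.
have sumS (F : nat -> R) k : \sum_(j <- iota 0 k.+1) F j = \sum_(j <- iota 0 k) F j + F k.
  by rewrite -[k.+1]addn1 iotaD big_cat big_seq1 add0n.
case=> ->.
- suff -> : \sum_(j <- iota 0 v.+1) 0 ^+ j = 1 :> R by rewrite ler01 lexx.
  elim: v => [|v IH]; first by rewrite big_seq1 expr0.
  by rewrite sumS IH expr0n /= addr0.
- suff -> : \sum_(j <- iota 0 v.+1) 1 ^+ j = v.+1%:R :> R by rewrite ler0n ler1n.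
  elim: v => [|v IH]; first by rewrite big_seq1 expr0.
  by rewrite sumS IH expr1n natr1.
suff -> : \sum_(j <- iota 0 v.+1) (-1) ^+ j = (~~ odd v)%:R :> R.
  by rewrite ler0n; split=> // ev; rewrite ev.
elim: v => [|v IH]; first by rewrite big_seq1 expr0.
by rewrite sumS IH -signr_odd /=; case: odd; rewrite /= ?expr1 ?expr0 ?addrN ?add0r.
Qed.

Lemma divisor_sum_pfactor p v m : prime p -> (0 < m)%N -> ~~ (p %| m)%N ->
  \sum_(d <- divisors (p ^ v * m)) chi d =
  (\sum_(j <- iota 0 v.+1) chi p ^+ j) * \sum_(d <- divisors m) chi d.
Proof.
move=> pr_p m0 pNm; rewrite sum_divisors_pfactor // mulr_suml.
apply: eq_bigr => j _; rewrite mulr_sumr; apply: eq_bigr => d _.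
by rewrite (real_charM chiP) real_charX.
Qed.

Lemma pfactor_decomposition n : (1 < n)%N ->
  exists p v m, [/\ prime p, (0 < m < n)%N, ~~ (p %| m)%N & n = (p ^ v * m)%N].
Proof.
move=> n_gt1; have pr_p := pdiv_prime n_gt1; have n0 := ltnW n_gt1.
have [m pNm nE] := pfactor_coprime pr_p n0.
have v0 : (0 < logn (pdiv n) n)%N by rewrite logn_gt0 mem_primes pr_p n0 pdiv_dvd.
have m0 : (0 < m)%N by move: n0; rewrite {1}nE muln_gt0 => /andP[].
exists (pdiv n), (logn (pdiv n) n), m; split=> //; last 2 first.
- by rewrite -prime_coprime.
- by rewrite mulnC -nE.
by rewrite m0 /= [X in (_ < X)%N]nE ltn_Pmulr // -{1}(expn0 (pdiv n)) ltn_exp2l // prime_gt1.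
Qed.

Lemma divisor_sum_ge0 n : (0 < n)%N -> 0 <= \sum_(d <- divisors n) chi d.
Proof.
elim/ltn_ind: n => n IH n0; have [n1|n_gt1] := leqP n 1.
  have -> : n = 1%N by lia.
  by rewrite big_seq1 real_char1.
have [p [v [m [pr_p /andP[m0 mn] pNm ->]]]] := pfactor_decomposition n_gt1.
rewrite divisor_sum_pfactor // mulr_ge0 ?IH //.
by have [] := geometric_sum_sign v (real_char_val p).
Qed.

Lemma divisor_sum_sqr n : (0 < n)%N -> 1 <= \sum_(d <- divisors (n ^ 2)) chi d.
Proof.
elim/ltn_ind: n => n IH n0; have [n1|n_gt1] := leqP n 1.
  have -> : n = 1%N by lia.
  by rewrite big_seq1 real_char1.
have [p [v [m [pr_p /andP[m0 mn] pNm ->]]]] := pfactor_decomposition n_gt1.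
rewrite expnMn -expnM divisor_sum_pfactor ?expn_gt0 ?m0 //; last first.
  by rewrite Euclid_dvdX // (negPf pNm).
rewrite -[X in X <= _]mulr1 ler_pM ?ler01 ?IH //.
have [_] := geometric_sum_sign (v * 2) (real_char_val p); apply.
by rewrite oddM andbF.
Qed.

Section Nonprincipal.
Hypothesis chi_nonprincipal : exists b, chi b = -1.

(** Multiplication by some b with chi b = -1 permutes the residues modulo N and changes the sign of
    the sum. *)
Lemma real_char_sum_period : \sum_(0 <= i < N) chi i = 0.
Proof.
have [b chib] := chi_nonprincipal.
have cob : coprime N b.
  apply/negPn/negP => /real_char_ncoprime; rewrite chib => /eqP.
  by rewrite oppr_eq0 oner_eq0.
have lt_mod (i : 'I_N) : (b * i %% N < N)%N by rewrite ltn_mod.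
pose f i := Ordinal (lt_mod i).
have f_inj : injective f.
  move=> i j /(congr1 val) /= /eqP; wlog le_ij : i j / (j <= i)%N.
    by move=> W; case: (leqP j i) => [|/ltnW] /W; rewrite // 1?eq_sym => H /H ->.
  rewrite eqn_mod_dvd ?leq_mul2l ?le_ij ?orbT // -mulnBr Gauss_dvdr // => dv.
  apply: val_inj => /=; apply/eqP; rewrite eqn_leq le_ij andbT -subn_eq0.
  have := ltn_ord i; case: (posnP (i - j)) => // gt0.
  by have := dvdn_leq gt0 dv; lia.
suff: - \sum_(i < N) chi i = \sum_(i < N) chi i by rewrite big_mkord; lra.
rewrite [RHS](reindex_inj f_inj) /= -mulN1r -chib mulr_sumr.
by apply: eq_bigr => i _; rewrite real_char_mod (real_charM chiP).
Qed.

Lemma real_char_sum_norm m n : `|\sum_(m <= i < n) chi i| <= N.*2%:R.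
Proof.
have part k : `|\sum_(0 <= i < k) chi i| <= N%:R.
  have [j [r [lt_rN ->]]] : exists j r, (r < N)%N /\ k = (j * N + r)%N.
    by exists (k %/ N)%N, (k %% N)%N; rewrite ltn_mod -divn_eq.
  elim: j => [|j IH].
    rewrite (le_trans (ler_norm_sum _ _ _)) // (le_trans (ler_sum _ (fun i _ => real_char_norm i))) //.
    by rewrite big_const_nat subn0 iter_addr_0 ler_nat; lia.
  rewrite mulSn -addnA (@big_cat_nat _ _ _ N) ?leq_addr //= real_char_sum_period add0r.
  rewrite -{1}[N]add0n big_addn addKn.
  by under eq_bigr do rewrite (real_charD chiP).
case: (leqP m n) => [le_mn|/ltnW nm]; last by rewrite big_geq ?normr0 ?ler0n.
have -> : \sum_(m <= i < n) chi i = \sum_(0 <= i < n) chi i - \sum_(0 <= i < m) chi i.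
  by rewrite (@big_cat_nat _ _ _ m 0 n) //= addrAC subrr add0r.
rewrite (le_trans (ler_normB _ _)) // -addnn natrD lerD //.
Qed.

Lemma abel_bound (w : nat -> R) a b : (forall i, (a <= i)%N -> 0 <= w i.+1 <= w i) ->
  `|\sum_(a <= i < b) chi i * w i| <= N.*2%:R * w a.
Proof.
move=> w_dec; case: (leqP a b) => [le_ab|/ltnW ba]; last first.
  rewrite big_geq // normr0 mulr_ge0 ?ler0n //.
  by have /andP[/le_trans H /H] := w_dec a (leqnn a).
pose T k := \sum_(a <= i < k) chi i * w i; pose A k := \sum_(a <= i < k) chi i.
have A_le k : `|A k| <= N.*2%:R by exact: real_char_sum_norm.
(* Summation by parts: the difference is the sum of the A (i + 1) (w i - w (i + 1)), and the weights
   telescope once A is bounded by 2 N. *)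
suff: `|T b - A b * w b| <= N.*2%:R * (w a - w b).
  have wb0 : 0 <= w b.
    have /andP[/le_trans H /H] := w_dec b le_ab; exact.
  have : `|A b * w b| <= N.*2%:R * w b by rewrite normrM (ger0_norm wb0) ler_wpM2r.
  rewrite mulrBr; have := ler_normD (T b - A b * w b) (A b * w b); rewrite subrK.
  by rewrite -/(T b); lra.
elim: b le_ab => [|b IH]; rewrite ?leqn0 => le_ab.
  by rewrite /T /A (eqP le_ab) !big_geq // mul0r !subrr normr0 mulr0.
move: le_ab; rewrite leq_eqVlt => /orP[/eqP ab|].
  by rewrite /T /A -ab !big_geq // mul0r !subrr normr0 mulr0.
rewrite ltnS => le_ab; have {}IH := IH le_ab.
have -> : T b.+1 - A b.+1 * w b.+1 = (T b - A b * w b) + A b.+1 * (w b - w b.+1).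
  by rewrite /T /A !big_nat_recr //=; ring.
have /andP[_ w_le] := w_dec b le_ab.
have : `|A b.+1 * (w b - w b.+1)| <= N.*2%:R * (w b - w b.+1).
  by rewrite normrM (ger0_norm (_ : 0 <= w b - w b.+1)) ?subr_ge0 // ler_wpM2r ?subr_ge0.
have := ler_normD (T b - A b * w b) (A b.+1 * (w b - w b.+1)).
by move: IH; rewrite !mulrBr; lra.
Qed.

End Nonprincipal.
End Char.
End RealCharacters.

(** * A positive lower bound for the partial sums of L(1, chi) *)

Section Nonvanishing.
Variables (R : realType) (N : nat) (chi : nat -> R).
Hypotheses (N_gt0 : (0 < N)%N) (chiP : real_char N chi).
Hypothesis chi_nonprincipal : exists b, chi b = -1.

Definition Lsum X : R := \sum_(1 <= n < X.+1) chi n / n%:R.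

Lemma Lsum_tail X Y : (X <= Y)%N -> `|Lsum Y - Lsum X| <= N.*2%:R / X.+1%:R.
Proof.
move=> XY; have -> : Lsum Y - Lsum X = \sum_(X.+1 <= n < Y.+1) chi n / n%:R.
  by rewrite /Lsum (@big_cat_nat _ _ _ X.+1 1 Y.+1) //= addrAC subrr add0r.
apply: (abel_bound N_gt0 chiP chi_nonprincipal (w := fun n => n%:R^-1)) => i Xi.
by rewrite invr_ge0 ler0n lef_pV2 ?posrE ?ltr0n ?ler_nat //; lia.
Qed.

(* The weight X - n makes the divisor problem smooth: gsum X d below is       *)
(* X^2/(2d) - X/2 up to an error at most d/2.                                 *)
Definition gsum X d : R := \sum_(1 <= e < (X %/ d).+1) (X - d * e)%:R.

Lemma gsum_bounds X d : (0 < d)%N ->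
  0 <= gsum X d - (X%:R ^+ 2 / (d%:R * 2) - X%:R / 2) <= d%:R / 2.
Proof.
move=> d0; have d0R : 0 < d%:R :> R by rewrite ltr0n.
pose r := (X %% d)%N; have lt_rd : (r < d)%N by rewrite ltn_mod.
have XE : X%:R = (X %/ d)%:R * d%:R + r%:R :> R by rewrite -natrM -natrD -divn_eq.
have gE : gsum X d = X%:R * (X %/ d)%:R - d%:R * ((X %/ d)%:R * ((X %/ d)%:R + 1) / 2).
  rewrite /gsum; have : (X %/ d * d <= X)%N by rewrite leq_divM.
  elim: (X %/ d)%N => [|k IH] kX; first by rewrite big_geq //; ring.
  rewrite big_nat_recr //= IH; last by nia.
  by rewrite natrB ?natrM -?[k.+1]addn1 ?natrD; [lra | lia].
have -> : gsum X d - (X%:R ^+ 2 / (d%:R * 2) - X%:R / 2) = r%:R * (d%:R - r%:R) / (d%:R * 2).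
  by rewrite gE XE; field; rewrite gt_eqF.
have r0 : 0 <= r%:R :> R := ler0n _ _.
have rd : r%:R <= d%:R :> R by rewrite ler_nat ltnW.
rewrite divr_ge0 ?mulr_ge0 ?subr_ge0 ?ler0n //= ler_pdivrMr; last by rewrite mulr_gt0.
by rewrite (_ : d%:R / 2 * (d%:R * 2) = d%:R * d%:R); [nra | field].
Qed.

Lemma gsum_ge0 X d : 0 <= gsum X d.
Proof. by apply: sumr_ge0 => e _; rewrite ler0n. Qed.

(** Monotonicity in d makes [gsum X] an admissible weight in [abel_bound]. *)
Lemma gsum_le X d : (0 < d)%N -> gsum X d.+1 <= gsum X d.
Proof.
move=> d0; rewrite /gsum (@big_cat_nat _ _ _ (X %/ d.+1).+1 1 (X %/ d).+1) //=; last first.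
  by rewrite ltnS leq_div2l.
rewrite -[X in X <= _]addr0 lerD ?sumr_ge0 //; apply: ler_sum => e _.
by rewrite ler_nat leq_sub2l // leq_mul2r leqnSn orbT.
Qed.

Lemma gsum_main X d : (0 < d <= X)%N -> gsum X d <= X%:R ^+ 2 / (d%:R * 2).
Proof.
move=> /andP[d0 dX]; have /andP[_] := gsum_bounds X d0.
have : d%:R <= X%:R :> R by rewrite ler_nat.
lra.
Qed.

Lemma sum_squares_le (F : nat -> R) Z : (forall n, (0 < n)%N -> 0 <= F n) ->
  \sum_(1 <= k < Z.+1) F (k ^ 2)%N <= \sum_(1 <= n < (Z ^ 2).+1) F n.
Proof.
move=> F0; elim: Z => [|Z IH]; first by rewrite !big_geq.
have le_sq : (Z ^ 2 < Z.+1 ^ 2)%N by rewrite ltn_exp2r.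
rewrite big_nat_recr // [leRHS](@big_cat_nat _ _ _ (Z ^ 2).+1) //; last exact: leqW.
rewrite lerD // big_nat_recr //.
by rewrite lerDr big_nat_cond sumr_ge0 // => n; rewrite andbT => nZ; apply: F0; lia.
Qed.

(* With X = Z^2, the squares n <= X contribute at least about Z^3 to the sum   *)
(* of (X - n) r(n), which is X^2 L(1) / 2 up to an error that the cut at       *)
(* d = Y = 4 M Z keeps below a fraction of Z^3.                               *)
Lemma Lsum_lower : exists2 delta : R, 0 < delta &
  exists Y, forall X, (Y <= X)%N -> delta <= Lsum X.
Proof.
(* M bounds the character sums. With Y = 4 M Z the error terms M Z^2 / 2 + Y^2 / 2 are at most 9 M^2
   Z^2, which is below Z^3 / 8 once Z >= 72 M^2; the factor 100 is a round choice. *)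
pose M := N.*2; have [Z ZE] : exists Z, Z = (100 * M ^ 2)%N by eexists.
pose X := (Z ^ 2)%N; pose Y := (4 * M * Z)%N.
have M0 : (0 < M)%N by rewrite double_gt0.
have Z0 : (0 < Z)%N by rewrite ZE muln_gt0 expn_gt0 M0.
have ZR : 0 < Z%:R :> R by rewrite ltr0n.
have MR : 1 <= M%:R :> R by rewrite ler1n.
have ZM : Z%:R = 100 * M%:R ^+ 2 :> R by rewrite ZE natrM natrX.
have XR : X%:R = Z%:R ^+ 2 :> R by rewrite natrX.
have YR : Y%:R = 4 * M%:R * Z%:R :> R by rewrite !natrM.
pose S := \sum_(1 <= n < X.+1) (X - n)%:R * \sum_(d <- divisors n) chi d.
have S_lower : Z%:R ^+ 3 / 2 <= S.
  have H := @sum_squares_le (fun n => (X - n)%:R * \sum_(d <- divisors n) chi d) Z.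
  apply: le_trans (H _); last by move=> n n0; rewrite mulr_ge0 ?(divisor_sum_ge0 N_gt0 chiP) ?ler0n.
  (* Only the squares n = k^2 are kept; the sum of Z^2 - k^2 is 2 Z^3 / 3 up to O(Z^2), hence at
     least Z^3 / 2 for large Z. *)
  apply: (@le_trans _ _ (\sum_(1 <= k < Z.+1) (Z%:R ^+ 2 - k%:R ^+ 2))).
    have E k : \sum_(1 <= j < k.+1) (Z%:R ^+ 2 - j%:R ^+ 2) =
        k%:R * Z%:R ^+ 2 - k%:R * (k%:R + 1) * (2 * k%:R + 1) / 6 :> R.
      elim: k => [|k IH]; first by rewrite big_geq //; ring.
      by rewrite big_nat_recr //= IH -[k.+1]addn1 natrD; field.
    rewrite E; have : 100 <= Z%:R :> R by rewrite ZM; nra.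
    move: (Z%:R) => z hz; have : 0 <= z * (z - 100) by apply: mulr_ge0; lra.
    have z0 : 0 <= z by lra.
    move=> h2; have := mulr_ge0 z0 h2; nra.
  rewrite big_nat_cond [leRHS]big_nat_cond; apply: ler_sum => k; rewrite andbT => kZ.
  rewrite /X natrB ?leq_exp2r ?natrX; try lia.
  rewrite -[leLHS]mulr1 ler_wpM2l ?(divisor_sum_sqr N_gt0 chiP) //; last by lia.
  by rewrite subr_ge0 lerXn2r ?nnegrE ?ler0n // ler_nat; lia.
have S_gsum : S = \sum_(1 <= d < X.+1) chi d * gsum X d.
  transitivity (\sum_(1 <= n < X.+1) \sum_(d <- divisors n) chi d * (X - d * (n %/ d))%:R).
    apply: eq_big_nat => n nX; rewrite mulr_sumr; apply: eq_big_seq => d.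
    rewrite -dvdn_divisors; last by lia.
    by move=> dn; rewrite mulnC divnK // mulrC.
  rewrite (sum_divisors_swap (fun d e => chi d * (X - d * e)%:R)).
  by apply: eq_bigr => d _; rewrite mulr_sumr.
have YX : (Y < X)%N by rewrite /Y /X ZE; nia.
have S_upper : S <= Z%:R ^+ 4 / 2 * Lsum Y + M%:R * Z%:R ^+ 2 / 2 + Y%:R ^+ 2 / 2 + Z%:R ^+ 3 / 8.
  rewrite S_gsum (@big_cat_nat _ _ _ Y.+1 1) //=; last by rewrite ltnS ltnW.
  (* For d > Y, Abel summation gives the bound M X^2 / (2 Y) = Z^3 / 8; the factor 4 in Y is chosen
     for this. *)
  apply: lerD; last first.
    apply: le_trans (ler_norm _) _.
    apply: le_trans (abel_bound N_gt0 chiP chi_nonprincipal _ _) _ => [i Yi|].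
      by rewrite gsum_ge0 gsum_le //; lia.
    apply: (@le_trans _ _ (M%:R * (X%:R ^+ 2 / (Y.+1%:R * 2)))).
      by rewrite ler_wpM2l // gsum_main // ltnS.
    apply: (@le_trans _ _ (M%:R * (X%:R ^+ 2 / (Y%:R * 2)))).
      rewrite ler_wpM2l // ler_wpM2l ?exprn_ge0 // lef_pV2 ?posrE ?mulr_gt0 ?ltr0n //.
        by rewrite ler_wpM2r // ler_nat.
      by rewrite /Y !muln_gt0 M0 Z0.
    rewrite XR YR le_eqVlt; apply/orP; left; apply/eqP; field.
    by rewrite !gt_eqF // (lt_le_trans ltr01).
  pose E d := gsum X d - (X%:R ^+ 2 / (d%:R * 2) - X%:R / 2).
  have -> : \sum_(1 <= d < Y.+1) chi d * gsum X d =
      X%:R ^+ 2 / 2 * Lsum Y - X%:R / 2 * \sum_(1 <= d < Y.+1) chi d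
      + \sum_(1 <= d < Y.+1) chi d * E d.
    rewrite /Lsum !mulr_sumr -sumrB -big_split /=; apply: eq_big_nat => d dY.
    by rewrite /E; field; rewrite pnatr_eq0; lia.
  have h1 : - (X%:R / 2 * \sum_(1 <= d < Y.+1) chi d) <= M%:R * Z%:R ^+ 2 / 2.
    rewrite -mulrN XR mulrC mulrA ler_wpM2r ?invr_ge0 // ler_wpM2r ?exprn_ge0 //.
    apply: le_trans (ler_norm _) _; rewrite normrN; exact: real_char_sum_norm.
  have h2 : \sum_(1 <= d < Y.+1) chi d * E d <= Y%:R ^+ 2 / 2.
    apply: (@le_trans _ _ (\sum_(1 <= d < Y.+1) Y%:R / 2)); last first.
      by rewrite sumr_const_nat subn1 -[_ *+ _.-1]mulr_natr expr2 mulrAC.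
    rewrite big_nat_cond [leRHS]big_nat_cond; apply: ler_sum => d; rewrite andbT => dY.
    have /andP[E0 E1] : 0 <= E d <= d%:R / 2 by apply: gsum_bounds; lia.
    have dYR : d%:R <= Y%:R :> R by rewrite ler_nat; lia.
    have := ler_norm (chi d * E d); rewrite normrM (ger0_norm E0).
    have := ler_wpM2r E0 (real_char_norm chiP d); lra.
  by move: h1 h2; rewrite XR -exprM; lra.
(* Of the lower bound Z^3 / 2, the errors take at most Z^3 / 8 twice; the remaining Z^3 / 4 is
   compared with Z^4 / 2 times [Lsum Y]. *)
have LY : 1 / (2 * Z%:R) <= Lsum Y.
  rewrite ler_pdivrMr ?mulr_gt0 //.
  have := le_trans S_lower S_upper; rewrite YR => H.
  have Z3 : 0 < Z%:R ^+ 3 :> R by rewrite exprn_gt0.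
  rewrite -(ler_pM2l Z3); move: H ZM Z3 MR ZR; move: (Z%:R) (M%:R) (Lsum Y) => z m l H ZM Z3 MR ZR.
  have : m * z ^+ 2 / 2 + (4 * m * z) ^+ 2 / 2 <= z ^+ 3 / 8.
    have mW : m * z ^+ 2 <= m ^+ 2 * z ^+ 2.
      by rewrite ler_wpM2r ?exprn_ge0 ?(ltW ZR) //; nra.
    have zW : z ^+ 3 = 100 * (m ^+ 2 * z ^+ 2) by rewrite exprS {1}ZM; ring.
    have W0 : 0 <= m ^+ 2 * z ^+ 2 by rewrite mulr_ge0 ?exprn_even_ge0.
    have -> : (4 * m * z) ^+ 2 = 16 * (m ^+ 2 * z ^+ 2) by ring.
    by rewrite zW; move: mW W0; move: (m * _) (m ^+ 2 * _) => x y; lra.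
  have -> : z ^+ 3 * (l * (2 * z)) = 4 * (z ^+ 4 / 2 * l) by field.
  lra.
(* Beyond Y the partial sums move by at most M / (Y + 1) < 1 / (4 Z), half of the lower bound
   reached at Y. *)
exists (1 / (4 * Z%:R)); first by rewrite divr_gt0 ?mulr_gt0.
exists Y => X' YX'.
have hM : N.*2%:R / Y.+1%:R <= 1 / (4 * Z%:R) :> R.
  rewrite ler_pdivrMr ?ltr0n // mul1r ler_pdivlMl ?mulr_gt0 //.
  by rewrite -!natrM ler_nat /Y /M; lia.
have := Lsum_tail YX'; rewrite ler_norml => /andP[hT _].
have hE : 1 / (2 * Z%:R) = 1 / (4 * Z%:R) + 1 / (4 * Z%:R) :> R by field; rewrite gt_eqF.
move: hM hT hE LY; move: (1 / (4 * _)) (1 / (2 * _)) (_ / Y.+1%:R) => x y u; lra.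
Qed.

End Nonvanishing.

(** * Prime number estimates *)

Section VonMangoldt.
Variable R : realType.

Definition mangoldt (n : nat) : R :=
  if primes n is [:: p] then ln p%:R else 0.

Lemma ln_nat_ge0 n : 0 <= ln n%:R :> R.
Proof. by case: n => [|n]; [rewrite ln0 | rewrite ln_ge0 ?ler1n]. Qed.

Lemma mangoldt_ge0 n : 0 <= mangoldt n.
Proof. by rewrite /mangoldt; case: primes => // p [|//]; apply: ln_nat_ge0. Qed.

Lemma mangoldt_pfactor p j : prime p -> mangoldt (p ^ j.+1) = ln p%:R.
Proof. by move=> pr_p; rewrite /mangoldt primesX // primes_prime. Qed.

Lemma mangoldt_mul p j e : prime p -> (1 < e)%N -> ~~ (p %| e)%N ->
  mangoldt (p ^ j.+1 * e) = 0.
Proof.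
move=> pr_p e1 pNe; rewrite /mangoldt; case E: primes => [//|l [|//]].
have p0 := prime_gt0 pr_p; have e0 := ltnW e1.
have mem q : prime q -> (q %| p ^ j.+1 * e)%N -> q = l.
  move=> pr_q qd; apply/eqP; rewrite -mem_seq1 -E mem_primes pr_q qd.
  by rewrite muln_gt0 expn_gt0 p0 e0.
have pl : p = l by apply: mem; rewrite // dvdn_mulr // expnS dvdn_mulr.
have := mem _ (pdiv_prime e1); rewrite dvdn_mull ?pdiv_dvd // => /(_ isT) el.
by rewrite pl -el pdiv_dvd in pNe.
Qed.

Lemma sum_mangoldt n : (0 < n)%N -> \sum_(d <- divisors n) mangoldt d = ln n%:R.
Proof.
elim/ltn_ind: n => n IH n0; have [n1|n_gt1] := leqP n 1.
  have -> : n = 1%N by lia.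
  by rewrite big_seq1 ln1.
have [p [v [m [pr_p /andP[m0 mn] pNm ->]]]] := pfactor_decomposition n_gt1.
have p0 : 0 < p%:R :> R by rewrite ltr0n prime_gt0.
rewrite sum_divisors_pfactor // natrM lnM ?posrE ?ltr0n ?expn_gt0 ?(prime_gt0 pr_p) //.
rewrite natrX lnXn // addrC -(IH m mn m0) /= big_cons; congr (_ + _).
  by apply: eq_bigr => e _; rewrite expn0 mul1n.
rewrite (eq_big_seq (fun=> ln p%:R)) => [|j]; last first.
  rewrite mem_iota; case: j => // j _.
  rewrite (bigD1_seq 1%N) ?divisors_uniq -?dvdn_divisors ?dvd1n //= muln1 mangoldt_pfactor //.
  rewrite big_seq_cond big1 ?addr0 // => e /andP[]; rewrite -dvdn_divisors // => em e1.
  have e0 := dvdn_gt0 m0 em; rewrite mangoldt_mul //; first by lia.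
  by apply: contra pNm => /dvdn_trans ->.
by rewrite big_const_seq count_predT size_iota iter_addr_0.
Qed.

(** The summation range may exceed n, so that the formulas for n and for 2 n can be subtracted over
    one range. *)
Lemma sum_mangoldt_div n m : (n <= m)%N ->
  \sum_(1 <= d < m.+1) mangoldt d * (n %/ d)%:R = ln n`!%:R.
Proof.
move=> nm; transitivity (\sum_(1 <= d < n.+1) mangoldt d * (n %/ d)%:R).
  rewrite (@big_cat_nat _ _ _ n.+1 1) //= [X in _ + X]big1_seq ?addr0 // => d.
  by rewrite mem_index_iota => /andP[_ /andP[nd _]]; rewrite divn_small ?mulr0.
transitivity (\sum_(1 <= k < n.+1) ln k%:R : R); last first.
  elim: (n) => [|k IH]; first by rewrite big_geq // fact0 ln1.
  by rewrite big_nat_recr //= IH factS mulnC natrM lnM // posrE ltr0n ?fact_gt0.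
rewrite -[RHS](eq_big_nat _ _ (F1 := fun k => \sum_(d <- divisors k) mangoldt d)); last first.
  by move=> k kn; rewrite sum_mangoldt //; lia.
rewrite (sum_divisors_swap (fun d _ => mangoldt d)); apply: eq_bigr => d _.
by rewrite sumr_const_nat subn1 mulr_natr.
Qed.

Definition psi n : R := \sum_(1 <= d < n.+1) mangoldt d.

(** In ln C(2n, n), which is at most 2n ln 2, every Lambda(d) has a nonnegative coefficient, and
    this coefficient is at least 1 for n < d <= 2n. *)
Lemma psi_double n : psi n.*2 <= psi n + n.*2%:R.
Proof.
have ln2 : ln 2 <= 1 :> R by have := @le_ln1Dx R 1; rewrite -[1 + 1]/(2 : R); apply; lra.
have nn : (n <= n.*2)%N by lia.
have fact_pos k : 0 < k`!%:R :> R by rewrite ltr0n fact_gt0.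
have h1 : \sum_(1 <= d < n.*2.+1) mangoldt d * ((n.*2 %/ d)%:R - 2 * (n %/ d)%:R) <= n.*2%:R.
  have -> : \sum_(1 <= d < n.*2.+1) mangoldt d * ((n.*2 %/ d)%:R - 2 * (n %/ d)%:R) =
            ln 'C(n.*2, n)%:R.
    under eq_bigr do rewrite mulrBr mulrCA; rewrite sumrB -mulr_sumr.
    rewrite !sum_mangoldt_div // -(bin_fact nn) -addnn addnK.
    rewrite !natrM !lnM ?posrE ?mulr_gt0 ?fact_pos ?ltr0n ?bin_gt0 ?leq_addr //; lra.
  apply: (@le_trans _ _ (ln (2 ^+ n.*2))).
    rewrite ler_ln ?posrE ?exprn_gt0 ?ltr0n ?bin_gt0 // -natrX ler_nat.
    rewrite -[2%N]/(1 + 1)%N expnDn; under eq_bigr do rewrite !exp1n !muln1.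
    have lt_n : (n < n.*2.+1)%N by lia.
    by rewrite (bigD1 (Ordinal lt_n)) //= leq_addr.
  by rewrite lnXn // -[leLHS]mulr_natr ler_piMl.
rewrite /psi (@big_cat_nat _ _ _ n.+1 1) //= lerD2l (le_trans _ h1) //.
rewrite [leRHS](@big_cat_nat _ _ _ n.+1 1) //= -[leLHS]add0r lerD //.
  apply: sumr_ge0 => d _; rewrite mulr_ge0 ?mangoldt_ge0 // subr_ge0 -natrM ler_nat.
  case: d => [|d]; first by rewrite !divn0.
  by rewrite leq_divRL // -mulnA -mul2n leq_mul2l leq_divM.
rewrite big_nat_cond [leRHS]big_nat_cond; apply: ler_sum => d; rewrite andbT => dn.
rewrite -[leLHS]mulr1 ler_wpM2l ?mangoldt_ge0 // (divn_small (m := n)); last by lia.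
by rewrite mulr0 subr0 ler1n divn_gt0; lia.
Qed.

(** With u = uphalf n, doubling gives psi n <= 6 u + 2 u <= 4 (n + 1), and this is at most 6 n for n
    >= 2. *)
Lemma psi_linear n : psi n <= 6 * n%:R.
Proof.
elim/ltn_ind: n => n IH; have [n1|n_gt1] := leqP n 1.
  have [->|->] : n = 0%N \/ n = 1%N by lia.
    by rewrite /psi big_geq // mulr0.
  by rewrite /psi big_nat1 /mangoldt /= mulr1.
have lt_n : (uphalf n < n)%N by lia.
have : psi n <= psi (uphalf n).*2.
  rewrite /psi [leRHS](@big_cat_nat _ _ _ n.+1 1) //=; last by lia.
  by rewrite lerDl sumr_ge0 // => d _; apply: mangoldt_ge0.
have := IH _ lt_n; have := psi_double (uphalf n).
have : (2 * (uphalf n))%:R <= n%:R + 1 :> R by rewrite -(natrD _ n 1) ler_nat; lia.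
have : 2 <= n%:R :> R by rewrite ler_nat.
by rewrite -mul2n natrM; lra.
Qed.

End VonMangoldt.

(** * Mertens sums twisted by real characters *)

Section Mertens.
Variable R : realType.
Implicit Types (chi psi : nat -> R).

Lemma ln_div_decreasing : exists n0, forall n, (n0 <= n)%N ->
  0 <= ln (n.+1%:R : R) / n.+1%:R <= ln n%:R / n%:R.
Proof.
exists (Num.bound (expR (1 : R))) => n n0n.
have en : expR 1 <= n%:R :> R.
  by rewrite (le_trans (ltW (archi_boundP (expR_ge0 1)))) // ler_nat.
have n0 : 0 < n%:R :> R by apply: lt_le_trans en; apply: expR_gt0.
have ln1 : 1 <= ln n%:R :> R by rewrite -[leLHS]expRK ler_ln ?posrE ?expR_gt0.
rewrite divr_ge0 ?ln_nat_ge0 //= ler_pdivrMr ?ltr0n // mulrAC ler_pdivlMr //.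
have -> : n.+1%:R = n%:R * (1 + n%:R^-1) :> R.
  by rewrite mulrDr mulr1 divff ?gt_eqF // natr1.
have i0 : 0 < n%:R^-1 :> R by rewrite invr_gt0.
rewrite lnM ?posrE ?addr_gt0 //.
have : ln (1 + n%:R^-1) <= n%:R^-1 :> R by apply: le_ln1Dx; lra.
rewrite -(ler_pM2r n0) mulVf ?gt_eqF // => h.
have -> : n%:R * (1 + n%:R^-1) = n%:R + 1 :> R by rewrite mulrDr mulr1 divff ?gt_eqF.
by rewrite mulrDl mulrDr mulr1 lerD2l (le_trans h).
Qed.

(** The sum T of chi(n) ln n / n is bounded by Abel summation. By ln = 1 * Lambda it equals the sum
    of chi(d) Lambda(d) / d times L(X / d). Replacing L(X / d) by L(X) costs at most 2 N psi(X) / X,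
    so L(X) times the wanted sum is bounded, and L(X) stays away from 0. *)
Lemma mertens_char N chi : (0 < N)%N -> real_char N chi -> (exists b, chi b = -1) ->
  exists C : R, forall X, `|\sum_(1 <= n < X.+1) chi n * mangoldt R n / n%:R| <= C.
Proof.
move=> N0 chiP chi_np; have [n0 ln_dec] := ln_div_decreasing.
pose W X := \sum_(1 <= n < X.+1) chi n * mangoldt R n / n%:R.
pose T X : R := \sum_(1 <= n < X.+1) chi n * (ln n%:R / n%:R).
have [CT T_le] : exists C, forall X, `|T X| <= C.
  pose A := \sum_(1 <= n < n0.+1) `|chi n * (ln n%:R / n%:R)|.
  exists (A + N.*2%:R * (ln n0.+1%:R / n0.+1%:R)) => X; rewrite /T.
  have B0 : 0 <= N.*2%:R * (ln n0.+1%:R / n0.+1%:R) :> R.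
    by rewrite mulr_ge0 ?divr_ge0 ?ln_nat_ge0.
  have [Xn|nX] := leqP X n0.
    rewrite (le_trans (ler_norm_sum _ _ _)) // -[leLHS]addr0 lerD //.
    by rewrite /A [leRHS](@big_cat_nat _ _ _ X.+1 1) //= lerDl sumr_ge0.
  rewrite (@big_cat_nat _ _ _ n0.+1 1) //=; last by lia.
  rewrite (le_trans (ler_normD _ _)) // lerD ?ler_norm_sum //.
  apply: (abel_bound N0 chiP chi_np (w := fun n => ln n%:R / n%:R)) => i ni.
  by apply: ln_dec; apply: leq_trans ni.
have TW X : (0 < X)%N -> `|Lsum chi X * W X - T X| <= N.*2%:R * 6.
  move=> X0; have XR : 0 < X%:R :> R by rewrite ltr0n.
  have -> : T X = \sum_(1 <= d < X.+1) chi d * mangoldt R d / d%:R * Lsum chi (X %/ d).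
    pose G d e := chi d * mangoldt R d / d%:R * (chi e / e%:R).
    transitivity (\sum_(1 <= n < X.+1) \sum_(d <- divisors n) G d (n %/ d)%N).
      apply: eq_big_nat => n nX; rewrite -sum_mangoldt; last by lia.
      rewrite mulr_suml mulr_sumr; apply: eq_big_seq => d; rewrite -dvdn_divisors; last by lia.
      move=> dn; have n0' : (0 < n)%N by case/andP: nX.
      have d0 := dvdn_gt0 n0' dn.
      have nd0 : (0 < n %/ d)%N by rewrite (divn_gt0 _ d0) (dvdn_leq n0' dn).
      rewrite /G -{1 2}(divnK dn) (real_charM chiP) natrM; field.
      by rewrite !pnatr_eq0 -!lt0n d0 nd0.
    rewrite sum_divisors_swap; apply: eq_bigr => d _; by rewrite -mulr_sumr.
  rewrite mulr_sumr -sumrB (le_trans (ler_norm_sum _ _ _)) //.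
  apply: (@le_trans _ _ (\sum_(1 <= d < X.+1) mangoldt R d * (N.*2%:R / X%:R))).
    rewrite big_nat_cond [leRHS]big_nat_cond; apply: ler_sum => d; rewrite andbT => dX.
    have dN : (0 < d)%N by case/andP: dX.
    have d0 : 0 < d%:R :> R by rewrite ltr0n.
    rewrite [X in `|X - _|]mulrC -mulrBr normrM.
    apply: (@le_trans _ _ ((mangoldt R d / d%:R) * (N.*2%:R / (X %/ d).+1%:R))).
      rewrite ler_pM //; last by apply: Lsum_tail => //; apply: leq_div.
      rewrite !normrM (ger0_norm (mangoldt_ge0 _ _)) [`|d%:R^-1|]ger0_norm ?invr_ge0 //.
      by rewrite ler_wpM2r ?invr_ge0 // ler_piMl ?mangoldt_ge0 // (real_char_norm chiP).
    rewrite -mulrA ler_wpM2l ?mangoldt_ge0 // mulrCA ler_wpM2l // -invfM.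
    by rewrite lef_pV2 ?posrE ?mulr_gt0 ?ltr0n // -natrM ler_nat mulnC ltnW // ltn_ceil.
  rewrite -mulr_suml mulrA ler_pdivrMr // mulrC -mulrA ler_wpM2l //.
  exact: psi_linear.
have [delta delta0 [Y L_ge]] := Lsum_lower N0 chiP chi_np.
pose A := \sum_(1 <= n < Y.+1) `|chi n * mangoldt R n / n%:R|.
have C0 : 0 <= (CT + N.*2%:R * 6) / delta.
  by rewrite divr_ge0 ?(ltW delta0) // addr_ge0 ?mulr_ge0 // (le_trans _ (T_le 0%N)).
exists (A + (CT + N.*2%:R * 6) / delta) => X; rewrite -/(W X).
have [XY|YX] := leqP X Y.
  rewrite (le_trans (ler_norm_sum _ _ _)) // -[leLHS]addr0 lerD //.
  by rewrite /A [leRHS](@big_cat_nat _ _ _ X.+1 1) //= lerDl sumr_ge0.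
rewrite -[leLHS]add0r lerD ?sumr_ge0 // ler_pdivlMr //.
have LX := L_ge X (ltnW YX).
have X0 : (0 < X)%N by lia.
have := ler_normD (Lsum chi X * W X - T X) (T X); rewrite subrK normrM.
have : `|W X| * delta <= `|Lsum chi X| * `|W X|.
  by rewrite mulrC ler_wpM2r // (le_trans LX) // ler_norm.
have := T_le X; have := TW X X0; lra.
Qed.

(** By ln = 1 * Lambda, the sum of ln n over the n <= X coprime to N is at most X times the sum in
    question. From below, the n = N j + 1 with K <= j < 2 K alone contribute K ln K. With X = 2 N K
    the sum is at least ln K / (2 N). *)
Lemma mertens_principal N : (0 < N)%N -> forall B : R, exists X,
  B <= \sum_(1 <= n < X.+1) (coprime N n)%:R * mangoldt R n / n%:R.
Proof.
move=> N0 B; have NR : 0 < N%:R :> R by rewrite ltr0n.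
pose K := (Num.bound (expR (2 * N%:R * `|B|))).+1.
have K0 : 0 < K%:R :> R by rewrite ltr0n.
have lnK : 2 * N%:R * `|B| <= ln K%:R.
  rewrite -[leLHS]expRK ler_ln ?posrE ?expR_gt0 //.
  by rewrite (le_trans (ltW (archi_boundP (expR_ge0 _)))) // ler_nat.
pose X := (N * K.*2)%N; exists X.
have XR : X%:R = N%:R * (2 * K%:R) :> R by rewrite /X -mul2n !natrM.
have X0 : 0 < X%:R :> R by rewrite XR !mulr_gt0.
pose F n : R := (coprime N n)%:R * ln n%:R.
have F0 n : 0 <= F n by rewrite mulr_ge0 ?ln_nat_ge0.
have lower : K%:R * ln K%:R <= \sum_(1 <= n < X.+1) F n.
  have step k : \sum_(0 <= j < k) F (N * j).+1 <= \sum_(1 <= n < (N * k).+1) F n.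
    elim: k => [|k IH]; first by rewrite muln0 !big_geq.
    rewrite big_nat_recr //= [leRHS](@big_cat_nat _ _ _ (N * k).+1 1) //=; last first.
      by rewrite ltnS leq_mul2l leqnSn orbT.
    rewrite lerD // big_ltn; last by rewrite ltnS ltn_pmul2l.
    by rewrite lerDl sumr_ge0.
  apply: le_trans (step K.*2); rewrite (@big_cat_nat _ _ _ K 0) //=; last by lia.
  rewrite -[leLHS]add0r lerD ?sumr_ge0 //.
  apply: (@le_trans _ _ (\sum_(K <= j < K.*2) ln K%:R)).
    by rewrite sumr_const_nat -addnn addnK mulr_natl.
  rewrite [leLHS]big_nat_cond [leRHS]big_nat_cond; apply: ler_sum => j; rewrite andbT => jK.
  rewrite /F /coprime -addn1 [(N * j)%N]mulnC gcdnMDl gcdn1 mul1r.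
  by rewrite ler_ln ?posrE ?ltr0n ?addn1 // ler_nat; nia.
have upper : \sum_(1 <= n < X.+1) F n <=
    X%:R * \sum_(1 <= n < X.+1) (coprime N n)%:R * mangoldt R n / n%:R.
  pose G d e : R := (coprime N d)%:R * mangoldt R d * (coprime N e)%:R.
  have -> : \sum_(1 <= n < X.+1) F n =
      \sum_(1 <= n < X.+1) \sum_(d <- divisors n) G d (n %/ d)%N.
    apply: eq_big_nat => n nX; rewrite /F -sum_mangoldt; last by lia.
    rewrite mulr_sumr; apply: eq_big_seq => d; rewrite -dvdn_divisors; last by lia.
    by move=> dn; rewrite /G -{1}(divnK dn) coprimeMr -mulnb natrM; ring.
  rewrite sum_divisors_swap mulr_sumr big_nat_cond [leRHS]big_nat_cond.
  apply: ler_sum => d; rewrite andbT => dX; rewrite -mulr_sumr mulrCA.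
  rewrite ler_wpM2l ?mulr_ge0 ?mangoldt_ge0 //.
  have d0 : 0 < d%:R :> R by rewrite ltr0n; lia.
  apply: (@le_trans _ _ (X %/ d)%:R); last by rewrite ler_pdivlMr // -natrM ler_nat leq_divM.
  apply: (@le_trans _ _ (\sum_(1 <= e < (X %/ d).+1) 1)).
    by apply: ler_sum => e _; case: coprime.
  by rewrite sumr_const_nat subn1.
have N2 : 0 < 2 * N%:R :> R by rewrite mulr_gt0.
rewrite (le_trans (ler_norm B)) // -(ler_pM2l N2) (le_trans lnK) //.
rewrite -(ler_pM2l K0) (le_trans (le_trans lower upper)) // XR.
by move: (\sum_(_ <= _ < _) _) => S; rewrite le_eqVlt; apply/orP; left; apply/eqP; ring.
Qed.

End Mertens.

(* Without such a prime, the weights prod_i (1 + c_i(a) c_i(n)) vanish at all  *)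
(* prime powers n coprime to N: at an odd power of l because c_i(n) = c_i(l),  *)
(* at an even one because of the factor with c_i(a) = -1.                     *)
Theorem prime_with_real_characters (R : realType) (N a k : nat) (c : nat -> nat -> R) :
  (0 < N)%N -> (forall i, (i < k)%N -> real_char N (c i)) -> coprime N a ->
  (exists2 i, (i < k)%N & c i a = -1) ->
  exists l, [/\ prime l, coprime N l & forall i, (i < k)%N -> c i l = c i a].
Proof.
move=> N0 cP coNa [i0 i0k ci0]; apply: boolp.contrapT => no_prime.
(* Expanding the product one factor at a time leads to sums twisted by arbitrary products psi of
   characters. Some of these may be principal, hence unbounded above, so a general psi is only
   bounded from below; the term with psi = 1 makes the total unbounded. *)
have key j psi : (j <= k)%N -> real_char N psi ->
    (exists C : R, forall X, - C <= \sum_(1 <= n < X.+1)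
      psi a * psi n * \prod_(0 <= i < j) (1 + c i a * c i n) * mangoldt R n / n%:R) /\
    ((forall n, psi n = (coprime N n)%:R) -> forall B : R, exists X,
      B <= \sum_(1 <= n < X.+1)
        psi a * psi n * \prod_(0 <= i < j) (1 + c i a * c i n) * mangoldt R n / n%:R).
  elim: j psi => [|j IH] psi jk psiP.
    have E X : \sum_(1 <= n < X.+1) psi a * psi n *
        \prod_(0 <= i < 0) (1 + c i a * c i n) * mangoldt R n / n%:R =
        psi a * \sum_(1 <= n < X.+1) psi n * mangoldt R n / n%:R.
      by rewrite mulr_sumr; apply: eq_bigr => n _; rewrite big_geq // mulr1 !mulrA.
    split=> [|psi1 B]; last first.
      have [X BX] := mertens_principal N0 B; exists X.
      rewrite E psi1 coNa mul1r; under eq_bigr do rewrite psi1; exact: BX.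
    have [np|pr] := boolp.EM (exists b, psi b = -1).
      have [C WC] := mertens_char N0 psiP np; exists C => X; rewrite E.
      have := WC X; rewrite ler_norml => /andP[h1 h2].
      by case: (real_char_val psiP a) => ->; lra.
    exists 0 => X; rewrite E oppr0 mulr_ge0 //.
      by case: (real_char_val psiP a) => [->|->|pa] //; case: pr; exists a.
    rewrite sumr_ge0 // => n _; rewrite divr_ge0 // mulr_ge0 ?mangoldt_ge0 //.
    by case: (real_char_val psiP n) => [->|->|pn] //; case: pr; exists n.
  have psicP : real_char N (fun n => psi n * c j n) by apply: real_char_mul => //; apply: cP.
  have [[C1 H1] U1] := IH psi (ltnW jk) psiP; have [[C2 H2] _] := IH _ (ltnW jk) psicP.
  pose S1 psi X := \sum_(1 <= n < X.+1)
    psi a * psi n * \prod_(0 <= i < j) (1 + c i a * c i n) * mangoldt R n / n%:R.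
  have E X : \sum_(1 <= n < X.+1) psi a * psi n *
      \prod_(0 <= i < j.+1) (1 + c i a * c i n) * mangoldt R n / n%:R =
      S1 psi X + S1 (fun n => psi n * c j n) X.
    by rewrite /S1 -big_split; apply: eq_bigr => n _; rewrite big_nat_recr //=; ring.
  split=> [|/U1 U B]; first by exists (C1 + C2) => X; rewrite E opprD lerD ?H1 ?H2.
  have [X HX] := U (B + C2); exists X; rewrite E.
  by have := H2 X; rewrite -/(S1 _ X); move: HX; rewrite -/(S1 _ X); lra.
have [_ /(_ (fun=> erefl)) /(_ 1) [X]] := key k _ (leqnn k) (real_char_coprime R N).
rewrite leNgt => /negP; apply; apply: le_lt_trans (_ : 0 < 1) => //.
rewrite big1_seq // => n /andP[_ nX].
have [cop|ncop] := boolP (coprime N n); last by rewrite mulr0 !mul0r.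
rewrite /mangoldt; case E: (primes n) => [|l [|//]]; try by rewrite mulr0 mul0r.
have lP : l \in primes n by rewrite E mem_head.
have : prime l /\ (l %| n)%N by move: lP; rewrite mem_primes => /and3P[].
case=> pr_l ln.
have n0 : (0 < n)%N by move: nX; rewrite mem_index_iota; lia.
have nE : n = (l ^ logn l n)%N by rewrite {1}(prod_prime_decomp n0) prime_decompE E big_map big_seq1.
suff [i ik ci] : exists2 i, (i < k)%N & 1 + c i a * c i n = 0.
  have -> : \prod_(0 <= i < k) (1 + c i a * c i n) = 0.
    by rewrite (bigD1_seq i) ?mem_index_iota ?iota_uniq //= ci mul0r.
  by rewrite mulr0 !mul0r.
have copl : coprime N l by apply: coprime_dvdr cop.
have unit_val i m : (i < k)%N -> coprime N m -> c i m = 1 \/ c i m = -1.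
  move=> ik com; have := real_char_sqr (cP i ik) m; rewrite com => /eqP.
  by rewrite sqrf_eq1 => /orP[] /eqP; [left | right].
have cX i : (i < k)%N -> c i n = c i l ^+ logn l n.
  by move=> ik; rewrite {1}nE (real_charX (cP i ik)).
case odd_v: (odd (logn l n)); last first.
  exists i0 => //; rewrite ci0 cX //.
  have -> : logn l n = (2 * (logn l n)./2)%N by rewrite mul2n; have := odd_double_half (logn l n); lia.
  by rewrite exprM (real_char_sqr (cP _ i0k)) copl expr1n; ring.
apply: boolp.contrapT => no_i; apply: no_prime; exists l; split=> // i ik.
apply: boolp.contrapT => ne; apply: no_i; exists i => //; rewrite cX //.
rewrite -(odd_double_half (logn l n)) odd_v -mul2n exprD exprM (real_char_sqr (cP _ ik)) copl expr1n.
by case: (unit_val i l) (unit_val i a) ne => // -> [] // -> //; rewrite ?mulr1 ?mulrN1 ?mulN1r; lra.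
Qed.

Lemma is3mod4M m n : odd m -> odd n -> is3mod4 (m * n) = is3mod4 m (+) is3mod4 n.
Proof.
have mod4 k : odd k -> (k %% 4 = 1 \/ k %% 4 = 3)%N by lia.
rewrite /is3mod4 => /mod4 m4 /mod4 n4; rewrite -modnMm.
by case: m4 => ->; case: n4 => ->.
Qed.

Lemma is35mod8M m n : odd m -> odd n -> is35mod8 (m * n) = is35mod8 m (+) is35mod8 n.
Proof.
have mod8 k : odd k -> [\/ k %% 8 = 1, k %% 8 = 3, k %% 8 = 5 | k %% 8 = 7]%N.
  move=> ok; have : [|| k %% 8 == 1, k %% 8 == 3, k %% 8 == 5 | k %% 8 == 7]%N by lia.
  by case/or4P => /eqP; [apply: Or41 | apply: Or42 | apply: Or43 | apply: Or44].
rewrite /is35mod8 => /mod8 m8 /mod8 n8; rewrite -modnMm.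
by case: m8 => ->; case: n8 => ->.
Qed.

(** * The characters (-1/n), (2/n) and (n/p) with a common modulus *)

Section ConcreteCharacters.
Variable R : realType.

Lemma real_char_sign N (b : nat -> bool) : (8 %| N)%N ->
  (forall m n, odd m -> odd n -> b (m * n)%N = b m (+) b n) ->
  (forall m n, m = n %[mod 8] -> b m = b n) ->
  real_char N (fun n => (coprime N n)%:R * (-1) ^+ b n : R).
Proof.
move=> N8 bM bD; have odd_cop n : coprime N n -> odd n.
  move=> co; rewrite -coprime2n; apply: coprime_dvdl co.
  by apply: dvdn_trans N8.
split=> [m n|n|n].
- rewrite coprimeMr; case com: (coprime N m); last by rewrite !mul0r.
  case con: (coprime N n); last by rewrite !mul0r mulr0.
  by rewrite bM ?odd_cop // signr_addb !mul1r.
- congr (_%:R * (-1) ^+ nat_of_bool _); first by rewrite /coprime gcdnDr.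
  by apply: bD; rewrite -(divnK N8) addnC modnMDl.
by rewrite exprMn -natrX -exprM mulnC exprM sqrrN expr1n expr1n mulr1; case: coprime.
Qed.

Lemma real_char_legendre N p : prime p -> odd p -> (p %| N)%N ->
  real_char N (fun n => (coprime N n)%:R * (legendre n%:Z p)%:~R : R).
Proof.
move=> pr_p odd_p pN; split=> [m n|n|n].
- by rewrite coprimeMr -mulnb natrM PoszM legendreM // rmorphM /=; ring.
- congr (_%:R * _%:~R); first by rewrite /coprime gcdnDr.
  apply: legendre_mod => //; rewrite eqz_mod_dvd PoszD addrAC subrr add0r.
  by rewrite dvdzE.
case co: (coprime N n); last by rewrite mul0r expr0n.
have : ~~ (p %| n%:Z)%Z.
  by rewrite dvdzE /= -prime_coprime //; apply: coprime_dvdl co.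
by move=> /legendre_val [->|->]; rewrite mul1r ?rmorphN1 ?sqrrN expr1n.
Qed.

End ConcreteCharacters.

Theorem prime_with_residues (s : seq nat) (a : nat) :
  all (fun r => prime r && odd r) s ->
  coprime (8 * \prod_(r <- s) r) a -> (exists2 r, r \in s & legendre a%:Z r = -1) ->
  exists l, [/\ prime l, odd l, forall r, r \in s -> ~~ (r %| l)%N,
    is3mod4 l = is3mod4 a /\ is35mod8 l = is35mod8 a &
    forall r, r \in s -> legendre l%:Z r = legendre a%:Z r].
Proof.
move=> sP; set N := (8 * _)%N => coNa [r0 r0s ar0].
have rP r : r \in s -> prime r /\ odd r by move=> rs; apply/andP/(allP sP).
have rN r : r \in s -> (r %| N)%N.
  by move=> rs; rewrite dvdn_mull // (big_rem r) //= dvdn_mulr.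
have N0 : (0 < N)%N.
  rewrite muln_gt0 /= big_seq_cond prodn_cond_gt0 // => r.
  by rewrite andbT => /rP[/prime_gt0].
pose c i n : Rdefinitions.R := (coprime N n)%:R *
  match i with 0 => (-1) ^+ is3mod4 n | 1 => (-1) ^+ is35mod8 n
  | i.+2 => (legendre n%:Z (nth 0%N s i))%:~R end.
have cP i : (i < (size s).+2)%N -> real_char N (c i).
  case: i => [|[|i]] ilt.
  - apply: real_char_sign; rewrite ?dvdn_mulr //; first exact: is3mod4M.
    by move=> m n mn; rewrite /is3mod4 -(modn_dvdm m (_ : 4 %| 8)%N) // mn modn_dvdm.
  - apply: real_char_sign; rewrite ?dvdn_mulr //; first exact: is35mod8M.
    by move=> m n mn; rewrite /is35mod8 mn.
  have rs : nth 0%N s i \in s by rewrite mem_nth.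
  by have [pr_r odd_r] := rP _ rs; apply: real_char_legendre => //; apply: rN.
have cNP m i : coprime N m -> c i m = match i with 0 => (-1) ^+ is3mod4 m
    | 1 => (-1) ^+ is35mod8 m | i.+2 => (legendre m%:Z (nth 0%N s i))%:~R end.
  by rewrite /c => ->; rewrite mul1r.
have [|l [pr_l coNl lP]] := prime_with_real_characters N0 cP coNa.
  exists (index r0 s).+2; first by rewrite !ltnS index_mem.
  by rewrite cNP // nth_index // ar0 rmorphN1.
exists l; split=> //.
- rewrite -coprime2n; apply: coprime_dvdl coNl.
  by apply: (@dvdn_trans 8) => //; rewrite dvdn_mulr.
- move=> r rs; have [pr_r _] := rP r rs; rewrite -prime_coprime //.
  by apply: coprime_dvdl coNl; apply: rN.
- have := lP 0%N isT; rewrite !cNP // => /signr_inj ->.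
  by have := lP 1%N isT; rewrite !cNP // => /signr_inj ->.
move=> r rs; have := lP (index r s).+2; rewrite !ltnS index_mem rs => /(_ isT).
by rewrite !cNP // nth_index // => /intr_inj.
Qed.

(** * Legendre's theorem *)

Lemma nat_sqrt_exists n : exists m, (m ^ 2 <= n < m.+1 ^ 2)%N.
Proof.
elim: n => [|n [m IH]]; first by exists 0%N.
have [lt_n|ge_n] := ltnP n.+1 (m.+1 ^ 2).
  by exists m; rewrite lt_n andbT; case/andP: IH => /leqW.
exists m.+1; rewrite ge_n /=; case/andP: IH => _; nia.
Qed.

Lemma box_diff_sqr (i j A n : nat) : (i < A.+1)%N -> (j < A.+1)%N -> (A ^ 2 <= n)%N ->
  (i%:Z - j%:Z) ^+ 2 <= n%:Z.
Proof.
move=> iA jA An; have hA : `|i%:Z - j%:Z| <= A%:Z by lia.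
by rewrite -real_normK ?num_real // (le_trans (_ : _ <= A%:Z ^+ 2)) ?lerXn2r ?nnegrE //.
Qed.

Lemma int_multiple_cases (X Y Z P k : int) : 0 < P -> X <= P -> Y <= P -> Z < P ->
  0 <= X -> 0 <= Y -> 0 <= Z -> X + Y - Z = k * P ->
  [\/ k = 0, k = 1 | k = 2] /\ (k = 2 -> Y = P).
Proof.
move=> P0 XP YP ZP X0 Y0 Z0 E.
have k_gt : -1 < k by rewrite -(ltr_pM2r P0) -E; lia.
have k_le : k <= 2 by rewrite -(ler_pM2r P0) -E; lia.
split=> [|k2]; last by move: E; rewrite k2; lia.
have : (k == 0) || (k == 1) || (k == 2) by lia.
by case/orP => [/orP[]|] /eqP; [apply: Or31 | apply: Or32 | apply: Or33].
Qed.

(** The bound on z is strict, which excludes k = -1, while k = 2 forces equality in the bounds on x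
    and y. *)
Lemma conic_value_cases (a b c : nat) (x y z k : int) :
  (0 < a)%N -> (0 < b)%N -> (0 < c)%N ->
  x ^+ 2 <= (b * c)%N -> y ^+ 2 <= (a * c)%N -> z ^+ 2 <= (a * b).-1 ->
  a%:Z * x ^+ 2 + b%:Z * y ^+ 2 - c%:Z * z ^+ 2 = k * (a * b * c)%N ->
  [\/ k = 0, k = 1 | k = 2] /\ (k = 2 -> y ^+ 2 = (a * c)%N).
Proof.
move=> a0 b0 c0 xle yle zle E; have n0 : 0 < (a * b * c)%N%:Z by rewrite ltz_nat !muln_gt0 a0 b0.
have ax : a%:Z * x ^+ 2 <= (a * b * c)%N by rewrite -mulnA PoszM ler_wpM2l.
have bY : b%:Z * y ^+ 2 <= (a * b * c)%N.
  by rewrite [(a * b)%N]mulnC -mulnA PoszM ler_wpM2l.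
have cz : c%:Z * z ^+ 2 < (a * b * c)%N.
  rewrite [(a * b * c)%N]mulnC PoszM ltr_pM2l //.
  by rewrite (le_lt_trans zle) // ltz_nat ltn_predL muln_gt0 a0.
have ax0 : 0 <= a%:Z * x ^+ 2 by rewrite mulr_ge0 // sqr_ge0.
have by0 : 0 <= b%:Z * y ^+ 2 by rewrite mulr_ge0 // sqr_ge0.
have cz0 : 0 <= c%:Z * z ^+ 2 by rewrite mulr_ge0 // sqr_ge0.
have [k01 bE] := int_multiple_cases n0 ax bY cz ax0 by0 cz0 E.
split=> // /bE {}bE.
apply: (mulfI (_ : b%:Z != 0)); first by rewrite eqz_nat -lt0n.
by rewrite bE -PoszM mulnA [(b * a)%N]mulnC.
Qed.

(* Pigeonhole on the box |x|^2 <= bc, |y|^2 <= ac, |z|^2 < ab gives a small    *)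
(* value of ax^2 + by^2 - cz^2 divisible by abc, hence equal to 0, abc or     *)
(* 2abc.                                                                      *)
Theorem legendre_conic (a b c : nat) (t s r : int) :
  (0 < a)%N -> (0 < b)%N -> (0 < c)%N ->
  coprime a b -> coprime a c -> coprime b c ->
  (c %| t ^+ 2 + a%:Z * b%:Z)%Z -> (a %| s ^+ 2 - b%:Z * c%:Z)%Z ->
  (b %| r ^+ 2 - a%:Z * c%:Z)%Z ->
  exists x y z : int, [|| x != 0, y != 0 | z != 0] /\
    a%:Z * x ^+ 2 + b%:Z * y ^+ 2 = c%:Z * z ^+ 2.
Proof.
move=> a0 b0 c0 ab ac bc tP sP rP.
have [A /andP[A1 A2]] := nat_sqrt_exists (b * c).
have [B /andP[B1 B2]] := nat_sqrt_exists (a * c).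
(* Taking the root of a b - 1 makes the bound z^2 < a b strict, and (C + 1)^2 >= a b still suffices
   for the pigeonhole count. *)
have [C /andP[C1 C2]] := nat_sqrt_exists (a * b).-1.
have modlt (n : nat) (u : int) : (0 < n)%N -> (`|(u %% n%:Z)%Z| < n)%N.
  move=> n0; have nz : n%:Z != 0 by rewrite eqz_nat -lt0n.
  by rewrite -ltz_nat gez0_abs ?modz_ge0 // ltz_pmod.
(* Modulo c, a and b the form splits into two linear factors thanks to the roots t, s and r; [f]
   records one factor for each modulus. *)
pose f (w : 'I_A.+1 * 'I_B.+1 * 'I_C.+1) : 'I_c * 'I_a * 'I_b :=
  (Ordinal (modlt c (a%:Z * w.1.1%:Z - t * w.1.2%:Z) c0),
   Ordinal (modlt a (b%:Z * w.1.2%:Z - s * w.2%:Z) a0),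
   Ordinal (modlt b (a%:Z * w.1.1%:Z - r * w.2%:Z) b0)).
have : ~~ injectiveb f.
  apply/injectiveP => /leq_card; rewrite !card_prod !card_ord leqNgt => /negP; apply.
  rewrite -(ltn_exp2r _ _ (isT : (0 < 2)%N)) !expnMn.
  have -> : (c ^ 2 * a ^ 2 * b ^ 2 = b * c * (a * c) * (a * b))%N by ring.
  have C2' : (a * b <= C.+1 ^ 2)%N by rewrite prednK ?muln_gt0 ?a0 in C2.
  apply: (@leq_trans (A.+1 ^ 2 * (B.+1 ^ 2) * (a * b))); last by rewrite leq_mul2l C2' orbT.
  by rewrite ltn_pmul2r ?muln_gt0 ?a0 // ltn_mul.
case/injectivePn => -[[x1 y1] z1] [[[x2 y2] z2] ne] [/= E1 E2 E3].
have mod_eq (n : nat) (u v : int) : (0 < n)%N -> `|(u %% n%:Z)%Z|%N = `|(v %% n%:Z)%Z|%N ->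
    (n%:Z %| u - v)%Z.
  move=> n0 E; rewrite -eqz_mod_dvd; apply/eqP.
  have nz : n%:Z != 0 by rewrite eqz_nat -lt0n.
  by rewrite -[LHS]gez0_abs ?modz_ge0 // E gez0_abs ?modz_ge0.
pose x : int := x1%:Z - x2%:Z; pose y : int := y1%:Z - y2%:Z; pose z : int := z1%:Z - z2%:Z.
have xyz : [|| x != 0, y != 0 | z != 0].
  apply/negPn; apply: contraNN ne; rewrite !negb_or !negbK => /and3P[hx hy hz].
  move: hx hy hz; rewrite /x /y /z !subr_eq0 !eqz_nat => hx hy hz.
  by rewrite !xpair_eqE -!val_eqE /= hx hy hz.
have cx : (c %| a%:Z * x - t * y)%Z.
  by have := mod_eq _ _ _ c0 E1; congr (_ %| _)%Z; rewrite /x /y; ring.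
have ay : (a %| b%:Z * y - s * z)%Z.
  by have := mod_eq _ _ _ a0 E2; congr (_ %| _)%Z; rewrite /y /z; ring.
have bx : (b %| a%:Z * x - r * z)%Z.
  by have := mod_eq _ _ _ b0 E3; congr (_ %| _)%Z; rewrite /x /z; ring.
have x_le : x ^+ 2 <= (b * c)%N by apply: box_diff_sqr A1 => //.
have y_le : y ^+ 2 <= (a * c)%N by apply: box_diff_sqr B1 => //.
have z_lt : z ^+ 2 <= (a * b).-1 by apply: box_diff_sqr C1 => //.
clearbody x y z; clear E1 E2 E3 ne f modlt mod_eq x1 x2 y1 y2 z1 z2 A1 A2 B1 B2 C1 C2 A B C.
pose F := a%:Z * x ^+ 2 + b%:Z * y ^+ 2 - c%:Z * z ^+ 2.
have cF : (c %| F)%Z.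
  rewrite -(@Gauss_dvdzr _ a) //; last by rewrite coprimezE coprime_sym.
  have -> : a%:Z * F = (a%:Z * x - t * y) * (a%:Z * x + t * y) + (t ^+ 2 + a%:Z * b%:Z) * y ^+ 2
     - c%:Z * (a%:Z * z ^+ 2) by rewrite /F; ring.
  by rewrite rpredB ?rpredD // ?dvdz_mulr ?dvdz_mulr.
have aF : (a %| F)%Z.
  rewrite -(@Gauss_dvdzr _ b) //.
  have -> : b%:Z * F = (b%:Z * y - s * z) * (b%:Z * y + s * z) + (s ^+ 2 - b%:Z * c%:Z) * z ^+ 2
     + a%:Z * (b%:Z * x ^+ 2) by rewrite /F; ring.
  by rewrite !rpredD // ?dvdz_mulr.
have bF : (b %| F)%Z.
  rewrite -(@Gauss_dvdzr _ a) //; last by rewrite coprimezE coprime_sym.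
  have -> : a%:Z * F = (a%:Z * x - r * z) * (a%:Z * x + r * z) + (r ^+ 2 - a%:Z * c%:Z) * z ^+ 2
     + b%:Z * (a%:Z * y ^+ 2) by rewrite /F; ring.
  by rewrite !rpredD // ?dvdz_mulr.
have : ((a * b * c)%N %| F)%Z.
  move: aF bF cF; rewrite !dvdzE !absz_nat => aF bF cF.
  by rewrite Gauss_dvd ?coprimeMl ?ac // Gauss_dvd // aF bF.
case/dvdzP => k FE.
have [k01 xyb] : [\/ k = 0, k = 1 | k = 2] /\ (k = 2 -> y ^+ 2 = (a * c)%N).
  have := conic_value_cases a0 b0 c0 x_le y_le z_lt; rewrite -/F FE; exact.
move: FE; rewrite /F !PoszM => FE; case: k01 => [k0|k1|k2].
- exists x, y, z; split; first exact: xyz.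
  by apply/eqP; rewrite -subr_eq0 FE k0 mul0r.
(* Here a x^2 + b y^2 = c (z^2 + a b). A Brahmagupta identity multiplies the left side by z^2 + a b
   and keeps its shape, so the right side becomes c times a square. *)
- exists (x * z + b%:Z * y), (y * z - a%:Z * x), (z ^+ 2 + a%:Z * b%:Z).
  have zab : 0 < z ^+ 2 + a%:Z * b%:Z.
    by rewrite ltr_wpDl ?sqr_ge0 // -PoszM ltz_nat muln_gt0 a0.
  split; first by rewrite (gt_eqF zab) !orbT.
  have E : a%:Z * x ^+ 2 + b%:Z * y ^+ 2 = c%:Z * (z ^+ 2 + a%:Z * b%:Z).
    by move/eqP: FE; rewrite k1 mul1r subr_eq => /eqP ->; ring.
  transitivity ((a%:Z * x ^+ 2 + b%:Z * y ^+ 2) * (z ^+ 2 + a%:Z * b%:Z)); first by ring.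
  by rewrite E; ring.
(* Now y^2 = a c, and this relation alone yields a solution. *)
exists c%:Z, 0, y; split; first by rewrite eqz_nat (gtn_eqF c0).
by rewrite (xyb k2) PoszM; ring.
Qed.

Lemma dvdz_sqr_coprime (m n : nat) (x : int) : coprime m n ->
  (exists t, (m %| t ^+ 2 - x)%Z) -> (exists t, (n %| t ^+ 2 - x)%Z) ->
  exists t, ((m * n)%N %| t ^+ 2 - x)%Z.
Proof.
move=> comn [t1 h1] [t2 h2]; pose t := zchinese m n t1 t2.
have co : coprimez m n by [].
have ht1 : (m %| t - t1)%Z by rewrite -eqz_mod_dvd; apply/eqP/zchinese_modl.
have ht2 : (n %| t - t2)%Z by rewrite -eqz_mod_dvd; apply/eqP/zchinese_modr.
exists t; rewrite PoszM Gauss_dvdz //; apply/andP; split.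
  have -> : t ^+ 2 - x = (t - t1) * (t + t1) + (t1 ^+ 2 - x) by ring.
  by rewrite rpredD // dvdz_mulr.
have -> : t ^+ 2 - x = (t - t2) * (t + t2) + (t2 ^+ 2 - x) by ring.
by rewrite rpredD // dvdz_mulr.
Qed.

(** * Embeddings into local fields *)

Section LocalEmbedding.
Variables (l : nat) (K : fieldExtType rat).

(* A sequence of maps h k : K -> Q that is multiplicative modulo l^k up to    *)
(* bounded denominators plays the role of an embedding of E into Q_l.         *)
Definition locally_embedded (E : {vspace K}) : Prop :=
  exists h : nat -> K -> rat,
  [/\ forall k, {morph h k : x y / x + y}, forall k, h k 1 = 1,
      forall x, x \in E -> exists2 D : nat, (0 < D)%N &
        forall k, exists u : int, D%:R * h k x = u%:~R
    & forall x y, x \in E -> y \in E -> exists2 D : nat, (0 < D)%N &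
        forall k, exists u : int,
          D%:R * (h k (x * y) - h k x * h k y) = (l ^ k)%:R * u%:~R].

Lemma locally_embedded1 : locally_embedded 1%VS.
Proof.
have fr1 : free [tuple (1 : K)] by rewrite seq1_free oner_neq0.
have hC (c : rat) : coord [tuple (1 : K)] ord0 (c%:A) = c.
  rewrite linearZ /= -[X in coord _ _ X]/([tuple (1 : K)]`_(@ord0 0)).
  by rewrite coord_free // eqxx mulr1.
exists (fun _ => coord [tuple 1] ord0); split=> [k x y|k|x|x y].
- by rewrite linearD.
- by rewrite -[X in coord _ _ X]scale1r hC.
- move=> /vlineP[c ->]; exists `|denq c|%N; first by rewrite absz_gt0.
  move=> k; exists (numq c); rewrite hC mulrC numqE.
  by rewrite pmulrn absz_denq.
move=> /vlineP[c ->] /vlineP[e ->]; exists 1%N => // k; exists 0.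
by rewrite -scalerAl !mul1r scalerA !hC subrr !mulr0.
Qed.

(** [h k] extends to a + b s by sending s to a root [r k] of d modulo l^k, chosen separately for
    each k. The product of b s and b' s creates the extra error (d - r k ^ 2) h(b) h(b'), a multiple
    of l^k once the denominators of h(b) and h(b'), bounded in k, are cleared. *)
Lemma locally_embedded_adjoin (E : {subfield K}) (s : K) (d : int) :
  (forall k, exists r : int, ((l ^ k)%N %| r ^+ 2 - d)%Z) -> s ^+ 2 = d%:~R ->
  locally_embedded E -> locally_embedded <<E; s>>%VS.
Proof.
move=> d_sq s2; have [sE|sNE] := boolP (s \in E); first by have /Fadjoin_idP -> := sE.
case=> h [hD h1 hI hM].
pose r k := xchoose (d_sq k).
have rP k : ((l ^ k)%N %| r k ^+ 2 - d)%Z := xchooseP (d_sq k).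
have dE : (d%:~R : K) \in E by rewrite rpred_int.
have deg2 : adjoin_degree E s = 2%N.
  have n1 : adjoin_degree E s != 1%N by rewrite -adjoin_deg_eq1 in sNE *.
  pose P2 : {poly K} := 'X^2 - (d%:~R)%:P.
  have : (size (minPoly E s) <= size P2)%N.
    rewrite dvdp_leq // -?size_poly_gt0 ?size_XnsubC //.
    by rewrite minPoly_dvdp ?rpredB ?rpredX ?polyOverX ?polyOverC // rootE !hornerE s2 subrr.
  rewrite size_XnsubC // size_minPoly.
  have : (0 < adjoin_degree E s)%N by [].
  by move: n1; case: adjoin_degree => [|[|[|]]].
have polyE a b : a \in E -> b \in E -> Fadjoin_poly E s (a + b * s) = a%:P + b%:P * 'X.
  move=> aE bE; apply: Fadjoin_poly_unique; rewrite ?hornerE //.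
    by rewrite rpredD ?rpredM ?polyOverC ?polyOverX.
  rewrite deg2 (leq_trans (size_polyD _ _)) // geq_max (leq_trans (size_polyC_leq1 _)) //=.
  by rewrite (leq_trans (size_polyMleq _ _)) // size_polyX addn2 /= ltnS size_polyC_leq1.
have decomp x : x \in <<E; s>>%VS -> exists a b, [/\ a \in E, b \in E & x = a + b * s].
  move=> xE; have /polyOverP pE := Fadjoin_polyOver E s x.
  exists (Fadjoin_poly E s x)`_0, (Fadjoin_poly E s x)`_1; split=> //.
  rewrite -{1}(Fadjoin_poly_eq xE) (horner_coef_wide _ (size_Fadjoin_poly E s x)) deg2.
  by rewrite !big_ord_recl big_ord0 expr0 mulr1 addr0 expr1.
pose g k x := h k (Fadjoin_poly E s x)`_0 + (r k)%:~R * h k (Fadjoin_poly E s x)`_1.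
have gE k a b : a \in E -> b \in E -> g k (a + b * s) = h k a + (r k)%:~R * h k b.
  by move=> aE bE; rewrite /g polyE // !coefE !(mulr0, mulr1, addr0, add0r).
have h0 k : h k 0 = 0 by have /eqP := hD k 0 0; rewrite addr0 -subr_eq subrr eq_sym => /eqP.
exists g; split=> [k x y|k|x xE|x y xE yE].
- by rewrite /g linearD /= !coefD !hD; ring.
- have := gE k 1 0; rewrite mul0r addr0 => -> //; first by rewrite h1 h0 mulr0 addr0.
    by rewrite rpred1.
  by rewrite rpred0.
- have [a [b [aE bE ->]]] := decomp x xE.
  have [Da Da0 ha] := hI a aE; have [Db Db0 hb] := hI b bE.
  exists (Da * Db)%N; first by rewrite muln_gt0 Da0.
  move=> k; have [u hu] := ha k; have [v hv] := hb k.
  exists (Db%:Z * u + Da%:Z * r k * v).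
  by rewrite gE // rmorphD !rmorphM /= -hu -hv ?natrM -!pmulrn; ring.
have [a [b [aE bE ->]]] := decomp x xE; have [a' [b' [aE' bE' ->]]] := decomp y yE.
have -> : (a + b * s) * (a' + b' * s) = (a * a' + d%:~R * (b * b')) + (a * b' + b * a') * s.
  by rewrite -s2; ring.
have [D1 D10 H1] := hM a a' aE aE'; have [D2 D20 H2] := hM b b' bE bE'.
have [D3 D30 H3] := hM a b' aE bE'; have [D4 D40 H4] := hM b a' bE aE'.
have [D5 D50 H5] := hI b bE; have [D6 D60 H6] := hI b' bE'.
exists (D1 * D2 * D3 * D4 * D5 * D6)%N; first by rewrite !muln_gt0 D10 D20 D30 D40 D50.
move=> k; have [u1 E1] := H1 k; have [u2 E2] := H2 k; have [u3 E3] := H3 k.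
have [u4 E4] := H4 k; have [u5 E5] := H5 k; have [u6 E6] := H6 k.
have /dvdzP[w rw] := rP k.
have hZ x' (c : int) : h k (c%:~R * x') = c%:~R * h k x'.
  have hn n : h k (n%:R * x') = n%:R * h k x'.
    elim: n => [|n IH]; first by rewrite !mul0r h0.
    by rewrite -!natr1 !mulrDl !mul1r hD IH.
  have hN z : h k (- z) = - h k z by apply/eqP; rewrite -addr_eq0 -hD addNr h0.
  by case: c => n; rewrite ?NegzE ?rmorphN /= ?mulNr ?hN hn.
rewrite !gE ?rpredD ?rpredM // !hD hZ.
pose z := D2%:Z * D3 * D4 * D5 * D6 * u1 + d * D1 * D3 * D4 * D5 * D6 * u2
  + r k * (D1%:Z * D2 * D4 * D5 * D6 * u3 + D1%:Z * D2 * D3 * D5 * D6 * u4)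
  - w * D1 * D2 * D3 * D4 * u5 * u6.
exists z; rewrite /z !(rmorphD, rmorphB, rmorphM, rmorphN) /= -!pmulrn.
have rw' : (r k)%:~R ^+ 2 = d%:~R + w%:~R * (l ^ k)%:R :> rat.
  by rewrite pmulrn -rmorphM -rw rmorphB rmorphXn /= addrC subrK.
transitivity (D2%:R * D3%:R * D4%:R * D5%:R * D6%:R * (D1%:R * (h k (a * a') - h k a * h k a'))
  + d%:~R * D1%:R * D3%:R * D4%:R * D5%:R * D6%:R * (D2%:R * (h k (b * b') - h k b * h k b'))
  + (r k)%:~R * (D1%:R * D2%:R * D4%:R * D5%:R * D6%:R * (D3%:R * (h k (a * b') - h k a * h k b'))
    + D1%:R * D2%:R * D3%:R * D5%:R * D6%:R * (D4%:R * (h k (b * a') - h k b * h k a')))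
  + (d%:~R - (r k)%:~R ^+ 2) * (D1%:R * D2%:R * D3%:R * D4%:R) * (D5%:R * h k b) * (D6%:R * h k b') : rat).
  by rewrite ?natrM; ring.
by rewrite E1 E2 E3 E4 E5 E6 rw'; ring.
Qed.

Lemma locally_embedded_adjoin_seq (ss : seq K) :
  (forall s, s \in ss -> exists2 d : int, s ^+ 2 = d%:~R &
    forall k, exists r : int, ((l ^ k)%N %| r ^+ 2 - d)%Z) ->
  locally_embedded <<1 & ss>>%VS.
Proof.
elim/last_ind: ss => [|ss s IH] sP; first by rewrite adjoin_nil subfield_closed; apply: locally_embedded1.
rewrite adjoin_rcons; have [|d s2 d_sq] := sP s; first by rewrite mem_rcons mem_head.
apply: (locally_embedded_adjoin (E := <<1 & ss>>%AS) d_sq s2); apply: IH => t tss.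
by apply: sP; rewrite mem_rcons inE tss orbT.
Qed.

(** Dividing all variables by l removes l^2 from the value, and e >= 2 means that l^e pays for it at
    each of the m rounds. *)
Lemma anisotropic_descent n (c : 'I_n -> int) (e : nat) : prime l -> (1 < e)%N ->
  (forall a : 'I_n -> int, ((l ^ e)%N %| \sum_i c i * a i ^+ 2)%Z -> forall i, (l %| a i)%Z) ->
  forall (m : nat) (a : 'I_n -> int), ((l ^ (e * m))%N %| \sum_i c i * a i ^+ 2)%Z ->
    forall i, ((l ^ m)%N %| a i)%Z.
Proof.
move=> pr_l e1 aniso; elim=> [|m IH] a div i; first by rewrite expn0 dvd1z.
have l0 := prime_gt0 pr_l.
have la j : (l %| a j)%Z.
  apply: aniso; apply: dvdz_trans div; rewrite dvdzE /= dvdn_exp2l //.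
  by rewrite mulnS leq_addr.
pose b j := (a j %/ l)%Z; have aE j : a j = b j * l%:Z by rewrite divzK.
rewrite aE expnS PoszM mulrC dvdz_mul // IH //.
have E : \sum_j c j * a j ^+ 2 = (l ^ 2)%N%:Z * \sum_j c j * b j ^+ 2.
  by rewrite mulr_sumr; apply: eq_bigr => j _; rewrite aE expnS expn1 PoszM; ring.
move: div; rewrite E mulnS -(subnK e1) addnAC expnD mulnC PoszM.
have nz : (l ^ 2)%N%:Z != 0 by rewrite eqz_nat -lt0n expn_gt0 l0.
rewrite dvdz_mul2l // => {}div; apply: dvdz_trans div.
by rewrite dvdzE /= dvdn_exp2l // leq_addl.
Qed.

(** A zero of the form in K maps to a near-zero modulo l^k, and descent makes every h(v i) highly
    divisible by l. But h(v j) h(1 / v j) is close to 1 when v j is nonzero, which limits that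
    divisibility. *)
Lemma locally_embedded_anisotropic n (c : 'I_n -> int) (e : nat) : prime l -> (1 < e)%N ->
  locally_embedded fullv ->
  (forall a : 'I_n -> int, ((l ^ e)%N %| \sum_i c i * a i ^+ 2)%Z -> forall i, (l %| a i)%Z) ->
  forall v : 'I_n -> K, \sum_i (c i)%:~R * v i ^+ 2 = 0 -> forall i, v i = 0.
Proof.
move=> pr_l e1 [h [hD h1 hI hM]] aniso v v_iso j; apply/eqP/negPn/negP => vj.
have inK (x : K) : x \in fullv := memvf x.
have h0 k : h k 0 = 0 by have /eqP := hD k 0 0; rewrite addr0 -subr_eq subrr eq_sym => /eqP.
have hN k z : h k (- z) = - h k z by apply/eqP; rewrite -addr_eq0 -hD addNr h0.
have hZ k x (u : int) : h k (u%:~R * x) = u%:~R * h k x.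
  have hn m : h k (m%:R * x) = m%:R * h k x.
    by elim: m => [|m IH]; rewrite ?mul0r ?h0 // -!natr1 !mulrDl !mul1r hD IH.
  by case: u => m; rewrite ?NegzE ?rmorphN /= ?mulNr ?hN hn.
have hsum k (F : 'I_n -> K) : h k (\sum_i F i) = \sum_i h k (F i).
  exact: (big_morph _ (hD k) (h0 k)).
have [Df Df0 HD] := fin_all_exists2 (fun i => hI (v i) (inK _)).
have [Ef Ef0 HE] := fin_all_exists2 (fun i => hM (v i) (v i) (inK _) (inK _)).
have [G1 G10 HG1] := hM (v j) (v j)^-1 (inK _) (inK _).
have [G2 G20 HG2] := hI (v j)^-1 (inK _).
pose D := (\prod_i Df i)%N; pose E := (\prod_i Ef i)%N.
have D0 : (0 < D)%N by apply: prodn_gt0.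
have E0 : (0 < E)%N by apply: prodn_gt0.
have DvP k : exists a : 'I_n -> int, forall i, D%:R * h k (v i) = (a i)%:~R.
  apply: (@fin_all_exists _ (fun=> int) (fun i u => D%:R * h k (v i) = u%:~R)) => i.
  have [u hu] := HD i k.
  exists (u * (\prod_(i' | i' != i) Df i')%N%:Z).
  by rewrite /D (bigD1 i) //= natrM mulrAC hu rmorphM.
(* W clears the denominators of h(v j) h(1 / v j) = 1 + O(l^k). The valuation of E at l is below E,
   so k = e W + E leaves l^(e W) dividing the form. Descent then gives l^W | W, absurd since W <
   l^W. *)
pose W := (D * G1 * G2)%N; pose k := (e * W + E)%N.
have W0 : (0 < W)%N by rewrite !muln_gt0 D0 G10.
have [a aP] := DvP k.
have lkE : ((l ^ k)%N %| E%:Z * \sum_i c i * a i ^+ 2)%Z.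
  have [u uP] : exists u : 'I_n -> int, forall i,
      E%:R * (h k (v i * v i) - h k (v i) * h k (v i)) = (l ^ k)%:R * (u i)%:~R.
    apply: (@fin_all_exists _ (fun=> int) (fun i u =>
      E%:R * (h k (v i * v i) - h k (v i) * h k (v i)) = (l ^ k)%:R * u%:~R)) => i.
    have [u hu] := HE i k.
    exists (u * (\prod_(i' | i' != i) Ef i')%N%:Z).
    by rewrite /E (bigD1 i) //= natrM mulrAC hu rmorphM /= mulrA.
  apply/dvdzP; exists (- (D%:Z ^+ 2 * \sum_i c i * u i)).
  apply: (@intr_inj rat); rewrite !(rmorphM, rmorphN, rmorphXn, rmorph_sum) /=.
  have S0 : \sum_i (c i)%:~R * h k (v i * v i) = 0.
    rewrite -[RHS](h0 k) -[in RHS]v_iso hsum; apply: eq_bigr => i _.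
    by rewrite expr2 hZ.
  transitivity (D%:R ^+ 2 * (E%:R * \sum_i (c i)%:~R * h k (v i * v i)
    - \sum_i (c i)%:~R * (E%:R * (h k (v i * v i) - h k (v i) * h k (v i)))) : rat).
    rewrite mulrBr !mulr_sumr -sumrB; apply: eq_bigr => i _.
    by rewrite rmorphM rmorphXn /= -aP -!pmulrn; ring.
  have -> : \sum_i (c i)%:~R * (E%:R * (h k (v i * v i) - h k (v i) * h k (v i))) =
      (l ^ k)%:R * \sum_i (c i * u i)%:~R.
    by rewrite mulr_sumr; apply: eq_bigr => i _; rewrite uP rmorphM /=; ring.
  by rewrite S0 -!pmulrn natrX; ring.
have lW : ((l ^ W)%N %| a j)%Z.
  apply: (anisotropic_descent pr_l e1 aniso).
  move: lkE; set Q := \sum_i _; have [->|Q0] := eqVneq Q 0; first by rewrite dvdz0.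
  rewrite !dvdzE /= abszM /= !pfactor_dvdn ?muln_gt0 ?E0 ?absz_gt0 //.
  rewrite lognM ?absz_gt0 // /k addnC => H.
  have : (logn l E <= E)%N by rewrite ltnW // ltn_logl.
  by move: H; lia.
have [u hu] := HG1 k; have [w hw] := HG2 k.
have /dvdzP[a' aE] := lW.
have : ((l ^ W)%N %| W%:Z)%Z.
  have -> : W%:Z = G1%:Z * a j * w + D%:Z * G2 * (l ^ k)%N * u.
    apply: (@intr_inj rat); rewrite !(rmorphD, rmorphM) /= -!pmulrn -aP -hw.
    rewrite -[D%:R * G2%:R * _ * _]mulrA -hu divff // h1; ring.
  apply: rpredD; first by rewrite dvdz_mulr // dvdz_mull.
  rewrite dvdz_mulr // dvdz_mull // dvdzE /= dvdn_exp2l //.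
  by rewrite (leq_trans _ (leq_addr _ _)) // leq_pmull // ltnW.
rewrite dvdzE /= => /(dvdn_leq W0); rewrite leqNgt ltn_expl //; exact: prime_gt1.
Qed.

End LocalEmbedding.

(** * Hensel lifting of square roots *)

Lemma hensel_odd (p : nat) (d : int) : prime p -> odd p -> ~~ (p %| d)%Z ->
  (exists t, (p %| t ^+ 2 - d)%Z) -> forall k, exists r : int, ((p ^ k)%N %| r ^+ 2 - d)%Z.
Proof.
move=> pr_p odd_p pNd t_ex; elim=> [|[_|k [r /dvdzP[w rw]]]]; first by exists 0; rewrite dvd1z.
  by have [t] := t_ex; exists t; rewrite expn1.
have pN2r : coprimez p (2 * r).
  rewrite coprimezE /= prime_coprime // abszM /= Euclid_dvdM // negb_or.
  rewrite gtnNdvd //=; last by apply: odd_prime_gt2.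
  apply: contra pNd => pr; have -> : d = r * r - w * (p ^ k.+1)%N by rewrite -rw; ring.
  apply: rpredB; first by rewrite dvdz_mulr.
  by rewrite dvdz_mull // expnS PoszM dvdz_mulr.
have /coprimezP[[x y] /= xy] := pN2r.
(* A Newton step: [y] inverts the derivative 2 r modulo p. *)
exists (r - w * y * (p ^ k.+1)%N).
have -> : (r - w * y * (p ^ k.+1)%N) ^+ 2 - d =
  (p ^ k.+1)%N%:Z * (w * (1 - y * (2 * r))) + (w * y) ^+ 2 * ((p ^ k.+1)%N%:Z * (p ^ k.+1)%N%:Z).
  transitivity ((r ^+ 2 - d) - (p ^ k.+1)%N%:Z * (w * y * (2 * r))
    + (w * y) ^+ 2 * ((p ^ k.+1)%N%:Z * (p ^ k.+1)%N%:Z)); first by ring.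
  by rewrite rw; ring.
have -> : 1 - y * (2 * r) = x * p by apply/eqP; rewrite subr_eq xy.
rewrite [(p ^ k.+2)%N]expnSr PoszM; apply: rpredD.
  by rewrite dvdz_mul // mulrA dvdz_mull.
by rewrite dvdz_mull // dvdz_mul // expnS PoszM dvdz_mulr.
Qed.

Lemma hensel_two (d : int) : (8 %| d - 1)%Z ->
  forall k, exists r : int, ((2 ^ k)%N %| r ^+ 2 - d)%Z.
Proof.
move=> d8 k; suff [r _ r2] : exists2 r : int, (2 %| r - 1)%Z & ((2 ^ k.+3)%N %| r ^+ 2 - d)%Z.
  by exists r; apply: dvdz_trans r2; rewrite dvdzE !absz_nat dvdn_exp2l // -addn3 leq_addr.
elim: k => [|k [r r1 /dvdzP[w rw]]].
  exists 1; first by rewrite subrr dvdz0.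
  by rewrite (_ : _ - d = - (d - 1)) ?rpredN //; ring.
have /dvdzP[y ry] := r1; have rE : r = 1 + y * 2 by rewrite -ry; ring.
(* The derivative 2 r turns this correction into r w 2^(k+3), which cancels w 2^(k+3) modulo 2^(k+4)
   because r is odd. *)
exists (r - w * (2 ^ k.+2)%N).
  rewrite rE (_ : _ - 1 = 2 * (y - w * (2 ^ k.+1)%N)) ?dvdz_mulr //.
  by rewrite [(2 ^ k.+2)%N]expnS PoszM; ring.
apply/dvdzP; exists (- w * y + w ^+ 2 * (2 ^ k)%N).
transitivity ((r ^+ 2 - d) - r * w * (2 * (2 ^ k.+2)%N%:Z)
  + w ^+ 2 * ((2 ^ k.+2)%N%:Z * (2 ^ k.+2)%N%:Z)); first by ring.
by rewrite rw rE !expnS !PoszM; ring.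
Qed.

(** * Choice of an auxiliary prime *)

Section JacobiProducts.
Variable s : seq nat.
Hypothesis sP : forall r, r \in s -> prime r /\ odd r.
Local Notation mu := (\prod_(r <- s) r)%N.

Lemma legendre_signed (e k : bool) (x : int) r : prime r -> odd r ->
  legendre ((-1) ^+ e * 2 ^+ k * x) r =
  (-1) ^+ ((e && is3mod4 r) (+) (k && is35mod8 r)) * legendre x r.
Proof.
move=> pr_r odd_r; rewrite !legendreM // signr_addb; congr (_ * _ * _).
  by case: e; rewrite ?expr1 ?expr0 ?legendreN1E ?legendre_one.
by case: k; rewrite ?expr1 ?expr0 ?legendre2E ?legendre_one.
Qed.

Lemma prod_signs (b : nat -> bool) : b 1%N = false ->
  (forall m n, odd m -> odd n -> b (m * n)%N = b m (+) b n) ->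
  odd mu /\ \prod_(r <- s) (-1) ^+ b r = (-1) ^+ b mu :> int.
Proof.
move=> b1 bM; elim: s sP => [|r t IH] tP; first by rewrite !big_nil b1.
have [_ odd_r] := tP r (mem_head _ _).
have [|odd_t E] := IH; first by move=> r' r't; apply: tP; rewrite inE r't orbT.
by rewrite !big_cons oddM odd_r odd_t E bM // signr_addb.
Qed.

Lemma odd_prod_primes : odd mu.
Proof. by have [] := prod_signs (erefl : is3mod4 1 = false) is3mod4M. Qed.

Lemma prod_legendre_signed (e k : bool) (x : int) :
  \prod_(r <- s) legendre ((-1) ^+ e * 2 ^+ k * x) r =
  (-1) ^+ ((e && is3mod4 mu) (+) (k && is35mod8 mu)) * \prod_(r <- s) legendre x r.
Proof.
rewrite (eq_big_seq (fun r => (-1) ^+ (e && is3mod4 r) * (-1) ^+ (k && is35mod8 r) * legendre x r)).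
  rewrite !big_split /= signr_addb; congr (_ * _ * _).
    by case: e; [case: (prod_signs (erefl : is3mod4 1 = false) is3mod4M) | rewrite big1].
  by case: k; [case: (prod_signs (erefl : is35mod8 1 = false) is35mod8M) | rewrite big1].
by move=> r /sP[pr_r odd_r]; rewrite legendre_signed // signr_addb.
Qed.

Lemma prod_legendre_reciprocity l : prime l -> odd l -> l \notin s ->
  \prod_(r <- s) legendre l%:Z r =
  (-1) ^+ (is3mod4 mu && is3mod4 l) * legendre mu%:Z l.
Proof.
move=> pr_l odd_l lNs.
rewrite (eq_big_seq (fun r => (-1) ^+ (is3mod4 l && is3mod4 r) * legendre r%:Z l)).
  rewrite big_split /=; congr (_ * _).
    rewrite andbC; case: (is3mod4 l); last by rewrite big1.
    by case: (prod_signs (erefl : is3mod4 1 = false) is3mod4M).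
  elim: (s) => [|r t IH]; last by rewrite !big_cons PoszM legendreM // IH.
  by rewrite !big_nil legendre_one.
move=> r rs; have [pr_r odd_r] := sP rs; apply: quadratic_reciprocity => //.
by apply: contraNneq lNs => ->.
Qed.

End JacobiProducts.

(* The local solvability condition at 2 in the choice of the auxiliary prime: *)
(* P4, P8, ... are the bits is3mod4 and is35mod8 of p, q, mu and l, the bits e *)
(* and k stand for the factors -1 and 2 of m, and fl for h = q.               *)
Lemma sign_choice (P4 P8 Q4 Q8 U4 U8 e k fl : bool) :
  (if fl then ~~ (P4 && Q4) else [&& P4, Q4 & ~~ [&& ~~ k, ~~ U8 & U4 == e]]) ->
  exists j L4 L8 : bool, [/\ ~~ (j && k),
    (P4 && L4) (+) ((e && P4) (+) (j && P8)) (+) ~~ fl = false &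
    ((e && L4) (+) (k && L8)) (+) (U4 && L4) (+)
    (((e && U4) (+) (j && U8)) (+) U4 (+) (U4 && P4) (+) (~~ ((e && P4) (+) (k && P8)))
      (+) (fl && ((U4 && Q4) (+) ~~ ((e && Q4) (+) (k && Q8))))) = false].
Proof.
move=> H; pose good (j L4 L8 : bool) := [&& ~~ (j && k),
    (P4 && L4) (+) ((e && P4) (+) (j && P8)) (+) ~~ fl == false &
    ((e && L4) (+) (k && L8)) (+) (U4 && L4) (+)
    (((e && U4) (+) (j && U8)) (+) U4 (+) (U4 && P4) (+) (~~ ((e && P4) (+) (k && P8)))
      (+) (fl && ((U4 && Q4) (+) ~~ ((e && Q4) (+) (k && Q8))))) == false].
suff: [|| good false false false, good false false true, good false true false,
  good false true true, good true false false, good true false true,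
  good true true false | good true true true].
  by do ![case/orP]; move=> /and3P[? /eqP ? /eqP ?]; do 3!eexists; split; eassumption.
rewrite /good; clear good; move: H.
by case: fl; case: e; case: k; case: P4; case: Q4; case: U4; case: U8; case: P8; case: Q8.
Qed.

Lemma odd_class_mod8 (b4 b8 : bool) :
  exists2 a : nat, odd a & is3mod4 a = b4 /\ is35mod8 a = b8.
Proof.
by case: b4 b8 => -[]; [exists 3%N | exists 7%N | exists 5%N | exists 1%N].
Qed.

Lemma legendre_surj p (b : bool) : prime p -> odd p ->
  exists a : int, legendre a p = (-1) ^+ b.
Proof.
move=> pr_p odd_p; case: b; first by have [a _ aE] := legendre_nonresidue pr_p odd_p; exists a; rewrite aE.
by exists 1; rewrite legendre_one.
Qed.

Lemma chinese_dvd (m n : nat) (x y : int) : (0 < m)%N -> (0 < n)%N -> coprime m n ->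
  exists a : nat, (m %| a%:Z - x)%Z /\ (n %| a%:Z - y)%Z.
Proof.
move=> m0 n0 co; pose z := zchinese m n x y; pose N := (m * n)%N.
have N0 : N%:Z != 0 by rewrite eqz_nat -lt0n muln_gt0 m0.
have zm : (m %| z - x)%Z by rewrite -eqz_mod_dvd; apply/eqP/zchinese_modl.
have zn : (n %| z - y)%Z by rewrite -eqz_mod_dvd; apply/eqP/zchinese_modr.
have zE : `|(z %% N)%Z|%N = z - (z %/ N)%Z * N :> int.
  by rewrite gez0_abs ?modz_ge0 //; apply/eqP; rewrite eq_sym subr_eq addrC -divz_eq.
exists `|(z %% N)%Z|%N; rewrite zE; split; rewrite addrAC; apply: rpredB => //.
  by rewrite dvdz_mull // PoszM dvdz_mulr.
by rewrite dvdz_mull // PoszM dvdz_mull.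
Qed.

Lemma chinese_dvd4 (n1 n2 n3 n4 : nat) (x1 x2 x3 x4 : int) :
  (0 < n1)%N -> (0 < n2)%N -> (0 < n3)%N -> (0 < n4)%N ->
  coprime n1 n2 -> coprime (n1 * n2) n3 -> coprime (n1 * n2 * n3) n4 ->
  exists a : nat, [/\ (n1 %| a%:Z - x1)%Z, (n2 %| a%:Z - x2)%Z,
    (n3 %| a%:Z - x3)%Z & (n4 %| a%:Z - x4)%Z].
Proof.
move=> p1 p2 p3 p4 c2 c3 c4.
have [b [b1 b2]] := chinese_dvd x1 x2 p1 p2 c2.
have p12 : (0 < n1 * n2)%N by rewrite muln_gt0 p1.
have [c [c12 c3']] := chinese_dvd b%:Z x3 p12 p3 c3.
have p123 : (0 < n1 * n2 * n3)%N by rewrite muln_gt0 p12.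
have [a [a123 a4]] := chinese_dvd c%:Z x4 p123 p4 c4.
have step (n N : nat) (u v w : int) : (n %| N)%N -> (N %| u - v)%Z -> (n %| v - w)%Z -> (n %| u - w)%Z.
  move=> nN uv vw; rewrite -[u](subrK v) -addrA rpredD // (dvdz_trans _ uv) //.
exists a; split=> //.
- apply: (step _ _ _ _ _ _ a123); first by rewrite -mulnA dvdn_mulr.
  by apply: (step _ _ _ _ _ _ c12 b1); rewrite dvdn_mulr.
- apply: (step _ _ _ _ _ _ a123); first by rewrite mulnAC dvdn_mull.
  by apply: (step _ _ _ _ _ _ c12 b2); rewrite dvdn_mull.
by apply: (step _ _ _ _ _ _ a123 c3'); rewrite dvdn_mull.
Qed.

Lemma coprime_prod_primes (s : seq nat) (a : nat) : odd a ->
  (forall r, r \in s -> prime r /\ ~~ (r %| a)%N) -> coprime (8 * \prod_(r <- s) r) a.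
Proof.
move=> odd_a sP; rewrite coprimeMl (@coprimeXl 3 2) ?coprime2n //=.
elim: s sP => [|r t IH] tP; first by rewrite big_nil coprime1n.
have [pr_r rNa] := tP r (mem_head _ _); rewrite big_cons coprimeMl prime_coprime // rNa.
by apply: IH => r' r't; apply: tP; rewrite inE r't orbT.
Qed.

Lemma signed_neq1_mod8 (e k : bool) (mu : nat) : odd mu ->
  ((-1) ^+ e * 2 ^+ k * mu%:Z != 1 %[mod 8])%Z ->
  ~~ [&& ~~ k, ~~ is35mod8 mu & is3mod4 mu == e].
Proof.
move=> odd_mu; apply: contra => /and3P[/negbTE -> h8 h4]; rewrite expr0 mulr1.
move: h8 h4; rewrite /is35mod8 /is3mod4 eqz_mod_dvd.
by case: e; rewrite ?expr1 ?expr0 ?mulN1r ?mul1r dvdzE /=; lia.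
Qed.

Lemma eqm_mod (n a b : nat) : (n %| a%:Z - b%:Z)%Z -> a = b %[mod n].
Proof. by rewrite -eqz_mod_dvd !modz_nat eqz_nat => /eqP. Qed.

Lemma eqm8_odd (m n : nat) : m = n %[mod 8] -> odd m = odd n.
Proof. lia. Qed.

Lemma eqm8_is3mod4 (m n : nat) : m = n %[mod 8] -> is3mod4 m = is3mod4 n.
Proof. by rewrite /is3mod4; lia. Qed.

Lemma eqm8_is35mod8 (m n : nat) : m = n %[mod 8] -> is35mod8 m = is35mod8 n.
Proof. by rewrite /is35mod8 => ->. Qed.

(** The four symbols are local conditions of the two conics at l, at p and at the odd primes of m.
    Those at p and at the primes of m are imposed on the class of l. Those at l are then determined
    by reciprocity, and the bits j, L4 and L8 of [sign_choice] give both the value 1. *)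
Theorem auxiliary_prime (p q : nat) (s : seq nat) (e k fl : bool) :
  let mu := (\prod_(r <- s) r)%N in
  let m : int := (-1) ^+ e * 2 ^+ k * mu%:Z in
  let h : nat := if fl then q else 1%N in
  prime p -> prime q -> odd p -> odd q -> p != q ->
  (forall r, r \in s -> prime r /\ odd r) -> p \notin s -> q \notin s ->
  legendre m p = -1 ->
  (if fl then ~~ (is3mod4 p && is3mod4 q) /\ legendre m q = -1
   else is3mod4 p && is3mod4 q /\ (m != 1 %[mod 8])%Z) ->
  exists (j : bool) (l : nat), ~~ (j && k) /\
    [/\ prime l, odd l, l != p, l != q & l \notin s] /\
    [/\ legendre p l = 1, legendre m l = 1,
      legendre ((-1) ^+ e * 2 ^+ j * l%:Z) p = (-1) ^+ ~~ fl &
      forall r, r \in s -> legendre (- p%:Z * (h%:Z * ((-1) ^+ e * 2 ^+ j * l%:Z))) r = 1].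
Proof.
move=> mu m h pr_p pr_q odd_p odd_q neq_pq sP pNs qNs mp hfl.
have odd_mu : odd mu by apply: odd_prod_primes.
pose up := ~~ ((e && is3mod4 p) (+) (k && is35mod8 p)).
pose uq := ~~ ((e && is3mod4 q) (+) (k && is35mod8 q)).
have sign_eq (b : bool) (x : int) : (-1) ^+ b * x = -1 -> x = (-1) ^+ ~~ b.
  by case: b; rewrite /= ?expr1 ?expr0 ?mulN1r ?mul1r // => /oppr_inj.
have mup : legendre mu%:Z p = (-1) ^+ up.
  by move: mp; rewrite /m legendre_signed // => /sign_eq.
have muq : fl -> legendre mu%:Z q = (-1) ^+ uq.
  move=> flT; move: hfl; rewrite flT => -[_].
  by rewrite /m legendre_signed // => /sign_eq.
have hbits : if fl then ~~ (is3mod4 p && is3mod4 q) else [&& is3mod4 p, is3mod4 q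
    & ~~ [&& ~~ k, ~~ is35mod8 mu & is3mod4 mu == e]].
  by case: (fl) hfl => -[] //; rewrite andbA => -> /(signed_neq1_mod8 odd_mu).
have [j [L4 [L8 [jk Hp Hm]]]] := sign_choice (is35mod8 p) (is35mod8 q) hbits.
have [a8 odd_a8 [a84 a88]] := odd_class_mod8 L4 L8.
(* Agreement of l with A at the primes of mu makes - p h E = A l a square there, where E is the
   signed multiple of l in the conclusion. *)
pose A : int := (-1) ^+ e * 2 ^+ j * (-1 * (p%:Z * h%:Z)).
have [ap app] := legendre_surj ((e && is3mod4 p) (+) (j && is35mod8 p) (+) ~~ fl) pr_p odd_p.
(* No condition of the conclusion involves the symbol of l at q; a nonresidue is prescribed to
   supply the character value -1 that [prime_with_residues] asks for. *)
have [aq aqq] := legendre_surj true pr_q odd_q.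
have p0 := prime_gt0 pr_p; have q0 := prime_gt0 pr_q.
have mu0 : (0 < mu)%N by rewrite odd_gt0.
have co8 n : odd n -> coprime 8 n by move=> on; rewrite (@coprimeXl 3 2) ?coprime2n.
have co_mu r : prime r -> r \notin s -> coprime mu r.
  move=> pr_r; rewrite /mu; elim: (s) sP => [|r' t IH] tP; first by rewrite big_nil coprime1n.
  rewrite inE negb_or => /andP[rr' rt]; have [pr_r' _] := tP r' (mem_head _ _).
  rewrite big_cons coprimeMl prime_coprime // dvdn_prime2 // eq_sym rr' IH // => u ut.
  by apply: tP; rewrite inE ut orbT.
have [a [a_8 a_mu a_p a_q]] : exists a : nat, [/\ (8 %| a%:Z - a8%:Z)%Z, (mu %| a%:Z - A)%Z,
    (p %| a%:Z - ap)%Z & (q %| a%:Z - aq)%Z].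
  apply: chinese_dvd4; rewrite ?co8 //.
    by rewrite coprimeMl co8 ?co_mu.
  by rewrite !coprimeMl co8 ?co_mu // prime_coprime // dvdn_prime2.
have rmu r : r \in s -> (r %| mu)%N by move=> rs; rewrite /mu (big_rem r) //= dvdn_mulr.
have a_r r : r \in s -> legendre a r = legendre A r.
  move=> rs; have [pr_r odd_r] := sP r rs; apply: legendre_mod => //.
  by rewrite eqz_mod_dvd (dvdz_trans _ a_mu) // dvdzE /= rmu.
have a_pE : legendre a p = legendre ap p by apply: legendre_mod; rewrite // eqz_mod_dvd.
have a_qE : legendre a q = legendre aq q by apply: legendre_mod; rewrite // eqz_mod_dvd.
have a8E := eqm_mod a_8.
have odd_a : odd a by rewrite (eqm8_odd a8E).
have ndvd r : legendre a r != 0 -> ~~ (r %| a)%N by rewrite legendre0 dvdzE.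
have A_ndvd r : r \in s -> legendre A r != 0.
  move=> rs; have [pr_r odd_r] := sP r rs.
  have rp : r != p by apply: contraNneq pNs => <-.
  have rq : r != q by apply: contraNneq qNs => <-.
  rewrite /A legendre_signed // mulf_neq0 ?signr_eq0 // legendre0 mulN1r.
  rewrite dvdzE abszN abszM /= Euclid_dvdM // negb_or dvdn_prime2 // rp /=.
  rewrite /h; case: (fl); first by rewrite dvdn_prime2.
  by rewrite dvdn1 neq_ltn prime_gt1 ?orbT.
have [|||l [pr_l odd_l lNs' [l4 l8] l_r]] := @prime_with_residues (p :: q :: s) a.
- by rewrite /= pr_p odd_p pr_q odd_q; apply/allP => r /sP[-> ->].
- apply: coprime_prod_primes => // r; rewrite !inE => /or3P[/eqP ->|/eqP ->|rs].
  + by split=> //; apply: ndvd; rewrite a_pE app signr_eq0.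
  + by split=> //; apply: ndvd; rewrite a_qE aqq signr_eq0.
  by have [pr_r _] := sP r rs; split=> //; apply: ndvd; rewrite a_r ?A_ndvd.
- by exists q; rewrite ?inE ?eqxx ?orbT // a_qE aqq.
have lNr r : prime r -> r \in p :: q :: s -> l != r.
  by move=> pr_r /lNs'; apply: contraNneq => ->; rewrite dvdnn.
have lp : l != p by apply: lNr; rewrite // mem_head.
have lq : l != q by apply: lNr; rewrite // !inE eqxx orbT.
have lNs : l \notin s.
  apply/negP => ls; have := lNr l pr_l; rewrite !inE ls !orbT => /(_ isT).
  by rewrite eqxx.
have lP : legendre l p = (-1) ^+ ((e && is3mod4 p) (+) (j && is35mod8 p) (+) ~~ fl).
  by rewrite l_r ?mem_head // a_pE app.
have lA r : r \in s -> legendre l r = legendre A r.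
  by move=> rs; rewrite l_r ?a_r // !inE rs !orbT.
rewrite (eqm8_is3mod4 a8E) a84 in l4.
rewrite (eqm8_is35mod8 a8E) a88 in l8.
have J1 : \prod_(r <- s) legendre (-1) r = (-1) ^+ is3mod4 mu.
  rewrite (eq_big_seq (fun r => (-1) ^+ is3mod4 r)); last by move=> r /sP[]; apply: legendreN1E.
  by case: (prod_signs sP (erefl : is3mod4 1 = false) is3mod4M).
have Jp : \prod_(r <- s) legendre p%:Z r = (-1) ^+ (is3mod4 mu && is3mod4 p) * (-1) ^+ up.
  by rewrite prod_legendre_reciprocity // -/mu mup.
have Jh : \prod_(r <- s) legendre h%:Z r = (-1) ^+ (fl && ((is3mod4 mu && is3mod4 q) (+) uq)).
  rewrite /h; move: muq; case: (fl) => [/(_ isT) E|_].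
    by rewrite prod_legendre_reciprocity // -/mu E -signr_addb.
  by rewrite big1_seq // => r /andP[_ /sP[pr_r odd_r]]; apply: legendre_one.
exists j, l; split=> //; split=> //; split.
- rewrite quadratic_reciprocity //; last by rewrite eq_sym.
  by rewrite lP l4 -signr_addb; move: Hp; rewrite !addbA => ->.
- rewrite /m legendre_signed // l4 l8.
  have -> : legendre mu l = (-1) ^+ (is3mod4 mu && is3mod4 l) * \prod_(r <- s) legendre l r.
    by rewrite prod_legendre_reciprocity // mulrA -signr_addb addbb mul1r.
  rewrite l4 (eq_big_seq _ lA) prod_legendre_signed //.
  rewrite (eq_big_seq (fun r => legendre (-1) r * (legendre p%:Z r * legendre h%:Z r))); last first.
    by move=> r /sP[pr_r odd_r]; rewrite !legendreM.
  rewrite !big_split /= J1 Jp Jh -!signr_addb.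
  by move: Hm; rewrite -/mu -/up -/uq !addbA => ->.
- by rewrite legendre_signed // lP -signr_addb addKb.
move=> r rs; have [pr_r odd_r] := sP r rs.
have -> : - p%:Z * (h%:Z * ((-1) ^+ e * 2 ^+ j * l%:Z)) = A * l%:Z by rewrite /A; ring.
rewrite legendreM // (lA r rs).
have := legendre_mem r A; rewrite !inE (negPf (A_ndvd r rs)) /=.
by case/orP => /eqP ->.
Qed.

(** * Splitting over a quadratic field *)

(** Thus a factor 2 in m or in the coefficient E adds no condition to Legendre's theorem. *)
Lemma sqr_mod_two (x : int) : exists t : int, (2%N %| t ^+ 2 - x)%Z.
Proof.
exists x; have -> : x ^+ 2 - x = x * (x - 1) by ring.
by rewrite !dvdzE abszM /= !dvdn2 oddM; have := oddb true; lia.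
Qed.

(** A negative coefficient moves to the other side of the equation, which permutes the roles of the
    coefficients in [legendre_conic]. The sign hypothesis is solvability over the reals. *)
Theorem legendre_conic_signed (x y : int) (p : nat) :
  x != 0 -> y != 0 -> (0 < p)%N -> (0 < x) || (0 < y) ->
  coprime `|x| `|y| -> coprime `|x| p -> coprime `|y| p ->
  (exists t : int, (`|x|%N %| t ^+ 2 - y * p%:Z)%Z) ->
  (exists t : int, (`|y|%N %| t ^+ 2 - x * p%:Z)%Z) ->
  (exists t : int, (p %| t ^+ 2 - - (x * y))%Z) ->
  exists X Y Z : int, [|| X != 0, Y != 0 | Z != 0] /\ x * X ^+ 2 + y * Y ^+ 2 = p%:Z * Z ^+ 2.
Proof.
wlog x0 : x y / 0 < x => [W x0 y0 p0 xy cxy cxp cyp hx hy hp|].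
  case/orP: (xy) => [/W|] H; first exact: H.
  have [||||||||||Y [X [Z [nz E]]]] // := W y x H; rewrite ?H //.
  - by rewrite coprime_sym.
  - by rewrite mulrC.
  by exists X, Y, Z; rewrite orbCA in nz; split; rewrite // addrC.
move=> _ y0 p0 _ cxy cxp cyp [tx hx] [ty hy] [tp hp].
have ax : `|x|%N%:Z = x by rewrite gez0_abs // ltW.
have ax0 : (0 < `|x|)%N by rewrite absz_gt0 gt_eqF.
have ay0 : (0 < `|y|)%N by rewrite absz_gt0.
case: (ltP 0 y) => [y_gt0|y_le0].
  have ay : `|y|%N%:Z = y by rewrite gez0_abs // ltW.
  have [|||X [Y [Z]]] := @legendre_conic `|x| `|y| p tp tx ty ax0 ay0 p0 cxy cxp cyp.
  - by rewrite ax ay; rewrite opprK in hp.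
  - by rewrite ay.
  - by rewrite ax.
  by rewrite ax ay => H; exists X, Y, Z.
have ay : `|y|%N%:Z = - y by rewrite lez0_abs.
have [||||||X [Y [Z]]] := @legendre_conic p `|y| `|x| tx tp ty p0 ay0 ax0; rewrite 1?coprime_sym //.
- by rewrite ay mulrN mulrC; rewrite ax in hx *.
- by rewrite ay ax mulNr mulrC.
- by rewrite ax mulrC.
rewrite ax ay => -[nz E]; exists Z, Y, X; split.
  by move: nz; case: (X != 0); case: (Y != 0); case: (Z != 0).
by rewrite -E; ring.
Qed.

Section Splitting.
Variables (K : fieldExtType rat).

Definition norm_isotropic (p q : nat) : Prop := exists x y z : K,
  [|| x != 0, y != 0 | z != 0] /\ x ^+ 2 = p%:R * y ^+ 2 + q%:R * z ^+ 2.

Lemma intr_K_eq0 (n : int) : (n%:~R == 0 :> K) = (n == 0).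
Proof.
have -> : n%:~R = (n%:~R : rat)%:A :> K by rewrite scaler_int.
by rewrite scaler_eq0 oner_eq0 orbF intr_eq0.
Qed.

Lemma norm_isotropic_sym p q : norm_isotropic p q -> norm_isotropic q p.
Proof.
move=> [x [y [z [nz E]]]]; exists x, z, y; rewrite addrC; split=> //.
by move: nz; case: (x != 0); case: (y != 0); case: (z != 0).
Qed.

(* Over K both v and w are norms from K(sqrt p), the latter because m is a     *)
(* square, and therefore so is q = v w / c^2.                                 *)
Lemma norm_isotropic_mul (p q c : nat) (w v : int) (m : int) (s : K) (x y z X Y Z : int) :
  s ^+ 2 = m%:~R -> m != 0 -> c != 0%N -> v * w = q%:Z * c%:Z ^+ 2 ->
  [|| x != 0, y != 0 | z != 0] -> x ^+ 2 - p%:Z * y ^+ 2 = v * z ^+ 2 ->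
  [|| X != 0, Y != 0 | Z != 0] -> m * X ^+ 2 - w * Y ^+ 2 = p%:Z * Z ^+ 2 ->
  norm_isotropic p q.
Proof.
move=> s2 m0 c0 vw nz1 E1 nz2 E2.
have s0 : s != 0.
  by apply/eqP => s0; move/eqP: s2; rewrite s0 expr0n eq_sym intr_K_eq0 (negPf m0).
have F1 : x%:~R ^+ 2 - p%:R * y%:~R ^+ 2 = v%:~R * z%:~R ^+ 2 :> K.
  by have := congr1 (fun n : int => n%:~R : K) E1; rewrite !(rmorphB, rmorphM, rmorphXn).
have F2 : (s * X%:~R) ^+ 2 - p%:R * Z%:~R ^+ 2 = w%:~R * Y%:~R ^+ 2.
  have := congr1 (fun n : int => n%:~R : K) E2; rewrite !(rmorphB, rmorphM, rmorphXn) /=.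
  by rewrite -s2 -pmulrn => /(canRL (subrK _)) H; rewrite exprMn H addrC addKr.
have F3 : v%:~R * w%:~R = q%:R * c%:R ^+ 2 :> K.
  by have := congr1 (fun n : int => n%:~R : K) vw; rewrite !(rmorphM, rmorphXn).
(* With z = 0 or Y = 0 one conic alone shows that p is a square in K. *)
have [z0|z0] := eqVneq z 0.
  exists x%:~R, y%:~R, 0; rewrite !intr_K_eq0; move: nz1; rewrite z0 eqxx !orbF => nz1; split=> //.
    by rewrite orbA nz1.
  by move/eqP: F1; rewrite z0 expr0n /= !mulr0 addr0 subr_eq0 => /eqP.
have [Y0|Y0] := eqVneq Y 0.
  exists (s * X%:~R), Z%:~R, 0; rewrite mulf_eq0 (negPf s0) !intr_K_eq0.
  split; first by move: nz2; rewrite Y0 eqxx; case: (X == 0); case: (Z == 0).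
  by move/eqP: F2; rewrite Y0 expr0n /= !mulr0 addr0 subr_eq0 => /eqP.
(* Coordinates of (x + y sqrt p)(s X + Z sqrt p), whose norm is q (c z Y)^2. *)
exists (x%:~R * (s * X%:~R) + p%:R * (y%:~R * Z%:~R)), (x%:~R * Z%:~R + y%:~R * (s * X%:~R)),
  (c%:R * z%:~R * Y%:~R); split.
  have c0K : c%:R != 0 :> K by rewrite pmulrn intr_K_eq0.
  by rewrite !mulf_eq0 !intr_K_eq0 !negb_or c0K z0 Y0 !orbT.
apply/eqP; rewrite -subr_eq0; apply/eqP.
transitivity ((x%:~R ^+ 2 - p%:R * y%:~R ^+ 2) * ((s * X%:~R) ^+ 2 - p%:R * Z%:~R ^+ 2)
  - q%:R * c%:R ^+ 2 * (z%:~R * Y%:~R) ^+ 2); first by ring.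
by rewrite F1 F2 -F3; ring.
Qed.

Lemma norm_isotropic_rational (p q : nat) : prime p -> prime q -> odd p -> odd q -> p != q ->
  legendre p q = 1 -> legendre q p = 1 -> norm_isotropic p q.
Proof.
move=> pr_p pr_q odd_p odd_q neq_pq pq qp.
have cpq : coprime p q by rewrite prime_coprime // dvdn_prime2.
have [tp hp] := legendre1P qp; have [tq hq] := legendre1P pq.
have [|||||||||x [y [z [nz E]]]] := @legendre_conic p q 1 0 tp tq.
- exact: prime_gt0. 
- exact: prime_gt0.
- by [].
- by [].
- by rewrite coprimen1.
- by rewrite coprimen1.
- by rewrite dvd1z.
- by rewrite mulr1.
- by rewrite mulr1.
exists z%:~R, x%:~R, y%:~R; rewrite !intr_K_eq0; split.
  by move: nz; case: (x != 0); case: (y != 0); case: (z != 0).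
have := congr1 (fun n : int => n%:~R : K) E.
by rewrite !(rmorphD, rmorphM, rmorphXn) /= mul1r => ->.
Qed.

End Splitting.

Lemma abs_signed (e k : bool) (n : nat) :
  absz ((-1) ^+ e * 2 ^+ k * n%:Z)%R = (2 ^ k * n)%N.
Proof. by rewrite !abszM !abszX exp1n mul1n. Qed.

Lemma sqr_mod_prod_primes (s : seq nat) (x : int) : uniq s -> (forall r, r \in s -> prime r) ->
  (forall r, r \in s -> exists t : int, (r %| t ^+ 2 - x)%Z) ->
  exists t : int, ((\prod_(r <- s) r)%N %| t ^+ 2 - x)%Z.
Proof.
elim: s => [_ _ _|r s IH /= /andP[rs us] sP hs]; first by exists 0; rewrite big_nil dvd1z.
have pr_r := sP r (mem_head _ _); rewrite big_cons; apply: dvdz_sqr_coprime.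
- rewrite prime_coprime // Euclid_dvd_prod // big_has; apply/negP => /hasP[r' r's].
  rewrite dvdn_prime2 //; last by apply: sP; rewrite inE r's orbT.
  by move=> /eqP rr'; rewrite rr' r's in rs.
- by apply: hs; rewrite mem_head.
by apply: IH => // r' r's; [apply: sP | apply: hs]; rewrite inE r's orbT.
Qed.

Lemma sqr_mod_pow2 (j : bool) (n : nat) (x : int) : odd n ->
  (exists t : int, (n %| t ^+ 2 - x)%Z) -> exists t : int, ((2 ^ j * n)%N %| t ^+ 2 - x)%Z.
Proof.
move=> odd_n hn; apply: dvdz_sqr_coprime => //; first by case: j; rewrite ?coprime1n ?coprime2n.
by case: j; [apply: sqr_mod_two | exists 0; rewrite dvd1z].
Qed.

(** The condition at q decides which conic receives the factor q. If (p/q) = 1, it is x^2 - p y^2 =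
    q E z^2, which needs p to be a square modulo q. If (p/q) = -1, it is m X^2 - q E Y^2 = p Z^2,
    which needs m p to be one, and m is a nonresidue there. *)
Theorem norm_isotropic_squarefree (K : fieldExtType rat) (p q : nat) (s : seq nat)
    (e k fl : bool) (sq : K) :
  let m : int := (-1) ^+ e * 2 ^+ k * (\prod_(r <- s) r)%N%:Z in
  prime p -> prime q -> odd p -> odd q -> p != q ->
  uniq s -> (forall r, r \in s -> prime r /\ odd r) -> p \notin s -> q \notin s ->
  legendre m p = -1 -> legendre q p = -1 -> legendre p q = (-1) ^+ fl ->
  (if fl then ~~ (is3mod4 p && is3mod4 q) /\ legendre m q = -1
   else is3mod4 p && is3mod4 q /\ (m != 1 %[mod 8])%Z) ->
  sq ^+ 2 = m%:~R -> norm_isotropic K p q.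
Proof.
move=> m pr_p pr_q odd_p odd_q neq_pq us sP pNs qNs mp qp pq hfl sqm.
have [j [l [jk [[pr_l odd_l lp lq lNs] [pl ml ep wr]]]]] :=
  auxiliary_prime pr_p pr_q odd_p odd_q neq_pq sP pNs qNs mp hfl.
move: ep wr; set h : nat := if fl then q else 1%N; set E : int := _ * l%:Z => ep wr.
pose h' : nat := if fl then 1%N else q; pose c := (2 ^ j * l)%N.
set mu := (\prod_(r <- s) r)%N in m sqm mp ml hfl *.
have absE : `|E|%N = c by apply: abs_signed.
have absm : `|m|%N = (2 ^ k * mu)%N by apply: abs_signed.
have hh' : (h * h' = q)%N by rewrite /h /h'; case: (fl); rewrite ?mul1n ?muln1.
have odd_mu : odd mu by apply: odd_prod_primes.
have c0 : c != 0%N by rewrite -lt0n /c muln_gt0 expn_gt0 (prime_gt0 pr_l).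
have EE : E * E = c%:Z ^+ 2.
  have c2 : (2 ^ j)%N = 2 ^+ j :> int by case: (j).
  by rewrite -expr2 /E /c PoszM c2 !exprMn sqrr_sign mul1r.
have primes_mu r : prime r -> r \notin s -> coprime mu r.
  move=> pr_r rs; rewrite coprime_sym prime_coprime // Euclid_dvd_prod // big_has.
  apply/hasPn => r' r's; have [pr_r' _] := sP r' r's; rewrite dvdn_prime2 //.
  by apply: contraNneq rs => ->.
have odd_h : odd h by rewrite /h; case: (fl).
have odd_h' : odd h' by rewrite /h'; case: (fl).
have co2 (b : bool) n : odd n -> coprime (2 ^ b) n by move=> on; rewrite coprimeXl ?coprime2n.
have co_mu_h : coprime mu h by rewrite /h; case: (fl); rewrite ?coprimen1 ?primes_mu.
have co_l_h : coprime l h.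
  by rewrite /h; case: (fl); rewrite ?coprimen1 // prime_coprime // dvdn_prime2.
have co_l_h' : coprime l h'.
  by rewrite /h'; case: (fl); rewrite ?coprimen1 // prime_coprime // dvdn_prime2.
have co_qp : coprime q p by rewrite prime_coprime // dvdn_prime2 // eq_sym.
have co_h_p : coprime h p by rewrite /h; case: (fl); rewrite ?coprime1n.
have co_h'_p : coprime h' p by rewrite /h'; case: (fl); rewrite ?coprime1n.
have co_c_p : coprime c p by rewrite coprimeMl co2 //= prime_coprime // dvdn_prime2.
have co_c_h : coprime c h by rewrite coprimeMl co2.
have co_c_h' : coprime c h' by rewrite coprimeMl co2.
have co_m_p : coprime `|m| p by rewrite absm coprimeMl co2 // primes_mu.
have co_m_h : coprime `|m| h by rewrite absm coprimeMl co2.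
have co_m_c : coprime `|m| c.
  have co_kj : coprime (2 ^ k) (2 ^ j).
    by move: jk; case: (j); case: (k); rewrite //= ?coprimen1 ?coprime1n.
  by rewrite absm coprimeMl !coprimeMr co_kj (co2 _ l) // (primes_mu l) // andbT coprime_sym co2.
have m0 : m != 0 by rewrite -absz_eq0 absm -lt0n muln_gt0 expn_gt0 (odd_gt0 odd_mu).
have E0 : E != 0 by rewrite -absz_eq0 absE.
have h0 : h%:Z != 0 by rewrite eqz_nat -lt0n odd_gt0.
have h'0 : h'%:Z != 0 by rewrite eqz_nat -lt0n odd_gt0.
have p0 := prime_gt0 pr_p.
have sq_c x : legendre x l = 1 -> exists t : int, (c %| t ^+ 2 - x)%Z.
  by move=> /legendre1P; apply: sqr_mod_pow2.
have sgnE : 0 < (-1) ^+ e * m /\ 0 < (-1) ^+ e * E.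
  have pos (b : bool) (n : nat) : (0 < n)%N -> 0 < (-1) ^+ e * ((-1) ^+ e * 2 ^+ b * n%:Z).
    by move=> n0; rewrite !mulrA -signr_addb addbb expr0 mul1r mulr_gt0 ?exprn_gt0.
  by split; apply: pos; rewrite odd_gt0.
have hEh' : legendre h' p * legendre E p = 1.
  rewrite ep /h'; case: (fl) => /=; rewrite ?legendre_one // qp.
  by [].
have [||||||||||x [y [z [nz1 E1]]]] := @legendre_conic_signed 1 (- (h'%:Z * E)) p.
- by [].
- by rewrite oppr_eq0 mulf_neq0.
- by [].
- by [].
- by rewrite coprime1n.
- by rewrite coprime1n.
- by rewrite abszN abszM absE absz_nat coprimeMl co_h'_p.
- by exists 0; rewrite dvd1z.
- rewrite abszN abszM absE absz_nat mul1r; apply: dvdz_sqr_coprime; first by rewrite coprime_sym.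
    rewrite /h'; case: (fl) pq; first by exists 0; rewrite dvd1z.
    by move=> /legendre1P.
  exact: sq_c.
- by rewrite mul1r opprK; apply: legendre1P; rewrite legendreM.
have [||||||||||X [Y [Z [nz2 E2]]]] := @legendre_conic_signed m (- (h%:Z * E)) p.
- by [].
- by rewrite oppr_eq0 mulf_neq0.
- by [].
(* E was given the sign of m, so one of m and - h E is positive. *)
- have [] := sgnE; rewrite oppr_gt0 pmulr_rlt0; last by rewrite ltz_nat odd_gt0.
  by case: (e); rewrite ?expr1 ?expr0 ?mulN1r ?mul1r ?oppr_gt0 => h1 h2; rewrite ?h1 ?h2 ?orbT.
- by rewrite abszN abszM absE absz_nat coprimeMr co_m_h.
- by [].
- by rewrite abszN abszM absE absz_nat coprimeMl co_h_p.
- rewrite absm; apply: sqr_mod_pow2 => //; apply: sqr_mod_prod_primes => // [r /sP[]|r rs] //.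
  have /legendre1P[t ht] := wr r rs; exists t; congr (_ %| _ - _)%Z: ht; ring.
- rewrite abszN abszM absE absz_nat; apply: dvdz_sqr_coprime; first by rewrite coprime_sym.
    rewrite /h; move: hfl pq; case: (fl) => [[_ mq] pq|_ _]; last by exists 0; rewrite dvd1z.
    by apply: legendre1P; rewrite legendreM // mq pq.
  by apply: sq_c; rewrite legendreM // ml pl.
- rewrite mulrN opprK; apply: legendre1P.
  rewrite (legendreM pr_p odd_p m) (legendreM pr_p odd_p h%:Z) mp ep /h.
  by case: (fl) => /=; rewrite ?qp ?legendre_one.
apply: (@norm_isotropic_mul K p q c (h%:Z * E) (h'%:Z * E) m sq x z y X Y Z) => //.
- by rewrite mulrACA EE -hh' PoszM [h'%:Z * _]mulrC.
- by move: nz1; rewrite [(y != 0) || _]orbC.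
- by move: E1; rewrite mul1r mulNr => /(canRL (subrK _)) ->; ring.
- by rewrite -mulNr.
Qed.

Lemma square_part (n : nat) : (0 < n)%N ->
  exists g m, n = (g ^ 2 * m)%N /\ forall p, prime p -> ~~ (p ^ 2 %| m)%N.
Proof.
elim/ltn_ind: n => n IH n0.
have [/hasP[p pn pp]|/hasPn sqf] := boolP (has (fun p => p ^ 2 %| n)%N (primes n)).
  have pr_p : prime p by move: pn; rewrite mem_primes => /and3P[].
  have m0 : (0 < n %/ p ^ 2)%N by rewrite divn_gt0 ?expn_gt0 ?(prime_gt0 pr_p) // (dvdn_leq n0 pp).
  have lt_m : (n %/ p ^ 2 < n)%N by rewrite ltn_Pdiv // -{1}(expn0 p) ltn_exp2l // prime_gt1.
  have [g [m [E sqf]]] := IH _ lt_m m0; exists (p * g)%N, m; split=> //.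
  by rewrite expnMn -mulnA -E mulnC divnK.
exists 1%N, n; split=> [|p pr_p]; first by rewrite mul1n.
apply/negP => pp; have pn : p \in primes n.
  by rewrite mem_primes pr_p n0 (dvdn_trans _ pp) // dvdn_exp.
by have := sqf p pn; rewrite pp.
Qed.

Lemma squarefree_odd_primes (m : nat) : (0 < m)%N -> (forall p, prime p -> ~~ (p ^ 2 %| m)%N) ->
  exists (k : bool) (s : seq nat),
    [/\ m = (2 ^ k * \prod_(r <- s) r)%N, uniq s & forall r, r \in s -> prime r /\ odd r].
Proof.
move=> m0 sqf; exists (2%N \in primes m), [seq r <- primes m | r != 2%N]; split.
- have mE : m = (\prod_(r <- primes m) r)%N.
    rewrite {1}(prod_prime_decomp m0) prime_decompE big_map.
    apply: eq_big_seq => p /=; rewrite mem_primes => /and3P[pr_p _ pm].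
    have : (0 < logn p m)%N by rewrite logn_gt0 mem_primes pr_p m0.
    have := sqf p pr_p; rewrite pfactor_dvdn // -ltnNge.
    by case: (logn p m) => [|[|]] // _ _; rewrite expn1.
  have [m2|m2] := boolP (2%N \in primes m).
    by rewrite big_filter {1}mE (bigD1_seq 2%N) ?primes_uniq.
  rewrite (all_filterP _); first by rewrite expn0 mul1n.
  by apply/allP => r rm; apply: contraNneq m2 => <-.
- by rewrite filter_uniq // primes_uniq.
move=> r; rewrite mem_filter mem_primes => /and3P[r2 pr_r _]; split=> //.
by case: (even_prime pr_r) => // /eqP; rewrite (negPf r2).
Qed.

(** A product d i * d j need not be squarefree. The symbols at p and q pass to the squarefree part,
    but a class modulo 8 does not when g is even, hence the quantified condition at 2. *)
Theorem norm_isotropic_int (K : fieldExtType rat) (p q : nat) (z : int) (sz : K) (fl : bool) :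
  prime p -> prime q -> odd p -> odd q -> p != q ->
  z != 0 -> sz ^+ 2 = z%:~R -> ~~ (p %| z)%Z -> ~~ (q %| z)%Z ->
  legendre z p = -1 -> legendre q p = -1 -> legendre p q = (-1) ^+ fl ->
  (if fl then ~~ (is3mod4 p && is3mod4 q) /\ legendre z q = -1
   else is3mod4 p && is3mod4 q /\
     forall g m : int, z = g ^+ 2 * m -> (m != 1 %[mod 8])%Z) ->
  norm_isotropic K p q.
Proof.
move=> pr_p pr_q odd_p odd_q neq_pq z0 sz2 pNz qNz zp qp pq hfl.
have absz0 : (0 < `|z|)%N by rewrite absz_gt0.
have [g [m [zE sqf]]] := square_part absz0.
have [g0 m0] : g != 0%N /\ (0 < m)%N.
  by move: absz0; rewrite zE muln_gt0 expn_gt0 orbF lt0n => /andP[].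
have [k [s [mE us sP]]] := squarefree_odd_primes m0 sqf.
pose e := z < 0; pose m' : int := (-1) ^+ e * 2 ^+ k * (\prod_(r <- s) r)%N%:Z.
have m'E : m' = (-1) ^+ e * m%:Z.
  have k2 : (2 ^ k)%N = 2 ^+ k :> int by case: (k).
  by rewrite /m' mE PoszM k2 mulrA.
have zm : z = g%:Z ^+ 2 * m'.
  by rewrite [LHS]intEsign zE m'E mulrCA -/e; congr (_ * _).
have legz r : prime r -> odd r -> ~~ (r %| z)%Z -> legendre z r = legendre m' r.
  move=> pr_r odd_r rNz; have : ~~ (r %| g%:Z)%Z.
    by apply: contra rNz => rg; rewrite zm expr2 -mulrA dvdz_mulr.
  by rewrite zm expr2 !legendreM // => /legendre_val[] ->; rewrite ?mulrNN !mul1r.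
have notin_s r : prime r -> ~~ (r %| z)%Z -> r \notin s.
  move=> pr_r; apply: contra => rs; rewrite zm dvdz_mull // /m' dvdz_mull // dvdzE /=.
  by rewrite (big_rem r) //= dvdn_mulr.
have gK : g%:R != 0 :> K by rewrite pmulrn intr_K_eq0.
apply: (@norm_isotropic_squarefree K p q s e k fl (sz / g%:R)) => //.
- exact: notin_s.
- exact: notin_s.
- by rewrite -legz.
- move: hfl; case: (fl) => -[h1 h2]; first by rewrite -legz.
  by split=> //; apply: h2 zm.
by rewrite expr_div_n sz2 zm rmorphM rmorphXn /= -pmulrn mulrAC divff ?mul1r // expf_neq0.
Qed.

(** * Quaternion algebras over multiquadratic fields *)

Section Quaternions.
Variables (K : fieldExtType rat) (p q : nat).
Local Notation H := (quaternion (p%:R : K) (q%:R : K)).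
Local Notation Q := (@Quaternion K p%:R q%:R).

Lemma isotropic_not_division : norm_isotropic K p q -> ~ is_division_algebra H.
Proof.
move=> [x [y [z [nz E]]]] div; pose u : H := Q x y z 0; pose v : H := Q x (- y) (- z) 0.
have uv : u * v = 0 by congr Quaternion => /=; rewrite -?expr2 ?E; ring.
have u0 : u != 0.
  apply/eqP => -[x0 y0 z0]; by rewrite x0 y0 z0 eqxx in nz.
have [w [_ wu]] := div u u0.
have : v = 0 by rewrite -[v]mul1r -wu -mulrA uv mulr0.
move=> [x0 /eqP y0 /eqP z0]; move: nz; rewrite x0 eqxx.
by move: y0 z0; rewrite !oppr_eq0 => /eqP -> /eqP ->; rewrite eqxx.
Qed.

Lemma anisotropic_division :
  (forall x y z t : K, x ^+ 2 - p%:R * y ^+ 2 - q%:R * z ^+ 2 + p%:R * q%:R * t ^+ 2 = 0 ->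
    [/\ x = 0, y = 0, z = 0 & t = 0]) -> is_division_algebra H.
Proof.
move=> aniso [x y z t] u0.
pose N := x ^+ 2 - p%:R * y ^+ 2 - q%:R * z ^+ 2 + p%:R * q%:R * t ^+ 2.
have N0 : N != 0.
  by apply: contraNneq u0 => /aniso[-> -> -> ->].
exists (Q (x / N) (- y / N) (- z / N) (- t / N)).
by split; congr Quaternion => /=; rewrite /N in N0 *; field.
Qed.

Lemma local_division (l e : nat) : prime l -> (1 < e)%N -> locally_embedded l (fullv : {vspace K}) ->
  (forall x y z t : int,
    ((l ^ e)%N %| x ^+ 2 - p%:Z * y ^+ 2 - q%:Z * z ^+ 2 + p%:Z * q%:Z * t ^+ 2)%Z ->
    [/\ (l %| x)%Z, (l %| y)%Z, (l %| z)%Z & (l %| t)%Z]) -> is_division_algebra H.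
Proof.
move=> pr_l e1 emb aniso; apply: anisotropic_division => x y z t E.
pose c (i : 'I_4) : int := [:: 1; - p%:Z; - q%:Z; p%:Z * q%:Z]`_i.
pose v (i : 'I_4) : K := [:: x; y; z; t]`_i.
have v0 : forall i, v i = 0.
  apply: (locally_embedded_anisotropic (c := c) pr_l e1 emb); last first.
    rewrite !big_ord_recl big_ord0 /c /v /= addr0 -[RHS]E !rmorphN rmorphM /= -!pmulrn; ring.
  move=> a; rewrite !big_ord_recl big_ord0 /c /= addr0 => h i.
  have [|h0 h1 h2 h3] := aniso (a ord0) (a (lift ord0 ord0)) (a (lift ord0 (lift ord0 ord0)))
    (a (lift ord0 (lift ord0 (lift ord0 ord0)))).
    by congr (_ %| _)%Z: h; ring.
  case: i => -[|[|[|[|//]]]] lt_i.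
  - by congr (_ %| a _)%Z: h0; apply: val_inj.
  - by congr (_ %| a _)%Z: h1; apply: val_inj.
  - by congr (_ %| a _)%Z: h2; apply: val_inj.
  by congr (_ %| a _)%Z: h3; apply: val_inj.
by split; [exact: (v0 (@Ordinal 4 0 isT)) | exact: (v0 (@Ordinal 4 1 isT))
  | exact: (v0 (@Ordinal 4 2 isT)) | exact: (v0 (@Ordinal 4 3 isT))].
Qed.

End Quaternions.

(** * Anisotropy of the norm form modulo p^2 and modulo 8 *)

Lemma nonresidue_anisotropic (p : nat) (q x z : int) : prime p -> odd p -> legendre q p = -1 ->
  (p %| x ^+ 2 - q * z ^+ 2)%Z -> (p %| x)%Z /\ (p %| z)%Z.
Proof.
move=> pr_p odd_p qp; rewrite -eqz_mod_dvd => /(legendre_mod pr_p odd_p).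
rewrite !legendreM // qp -!legendre0.
have := legendre_mem p x; have := legendre_mem p z; rewrite !inE.
by case/or3P => /eqP ->; case/or3P => /eqP ->.
Qed.

(** Modulo p the form is x^2 - q z^2. Once p divides x and z, division by -p leaves y^2 - q t^2
    modulo p. *)
Lemma anisotropic_odd (p q : nat) (x y z t : int) : prime p -> odd p -> legendre q p = -1 ->
  ((p ^ 2)%N %| x ^+ 2 - p%:Z * y ^+ 2 - q%:Z * z ^+ 2 + p%:Z * q%:Z * t ^+ 2)%Z ->
  [/\ (p %| x)%Z, (p %| y)%Z, (p %| z)%Z & (p %| t)%Z].
Proof.
move=> pr_p odd_p qp /dvdzP[w]; rewrite -mulnn PoszM => E.
have [px pz] : (p %| x)%Z /\ (p %| z)%Z.
  apply: (nonresidue_anisotropic pr_p odd_p qp); apply/dvdzP.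
  by exists (w * p + y ^+ 2 - q%:Z * t ^+ 2); move: E; lia.
have /dvdzP[x' xE] := px; have /dvdzP[z' zE] := pz.
have p0 : p%:Z != 0 by rewrite eqz_nat -lt0n prime_gt0.
suff [py pt] : (p %| y)%Z /\ (p %| t)%Z by [].
apply: (nonresidue_anisotropic pr_p odd_p qp); apply/dvdzP.
exists (x' ^+ 2 - q%:Z * z' ^+ 2 - w); apply: (mulfI p0).
move: E; rewrite xE zE => E.
transitivity ((x' * p) ^+ 2 - q%:Z * (z' * p) ^+ 2 - w * (p%:Z * p%:Z)); last by ring.
by rewrite -E; ring.
Qed.

Lemma sqr_mod8 (x : int) : (exists2 a, x = 2 * a & exists b, x ^+ 2 = 4 * b) \/
  exists b, x ^+ 2 = 8 * b + 1.
Proof.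
pose a := (x %/ 2)%Z; have xE := divz_eq x 2; rewrite -/a in xE.
have : ((x %% 2)%Z == 0) || ((x %% 2)%Z == 1) by lia.
case/orP => /eqP r; rewrite r in xE.
  by left; exists a; [rewrite xE; ring | exists (a ^+ 2); rewrite xE; ring].
right; have [b ab] : exists b, a * (a + 1) = 2 * b.
  have aE := divz_eq a 2.
  have : ((a %% 2)%Z == 0) || ((a %% 2)%Z == 1) by lia.
  case/orP => /eqP s; rewrite s in aE; rewrite aE.
    by exists ((a %/ 2)%Z * ((a %/ 2)%Z * 2 + 1)); ring.
  by exists (((a %/ 2)%Z * 2 + 1) * ((a %/ 2)%Z + 1)); ring.
exists b; rewrite xE.
transitivity (4 * (a * (a + 1)) + 1); first by ring.
by rewrite ab; ring.
Qed.

(** Modulo 4 the form is x^2 + y^2 + z^2 + t^2, so the variables are all even or all odd. If all are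
    odd, its value modulo 8 is (p - 1)(q - 1), which is 4; this is why the modulus is 8. *)
Lemma anisotropic_two (p q : nat) (x y z t : int) : is3mod4 p -> is3mod4 q ->
  ((2 ^ 3)%N %| x ^+ 2 - p%:Z * y ^+ 2 - q%:Z * z ^+ 2 + p%:Z * q%:Z * t ^+ 2)%Z ->
  [/\ (2 %| x)%Z, (2 %| y)%Z, (2 %| z)%Z & (2 %| t)%Z].
Proof.
move=> p3 q3 /dvdzP[w] E.
have [P pE] : exists P : int, p%:Z = 4 * P + 3.
  by exists (p %/ 4)%N%:Z; move: p3; rewrite /is3mod4; lia.
have [U qE] : exists U : int, q%:Z = 4 * U + 3.
  by exists (q %/ 4)%N%:Z; move: q3; rewrite /is3mod4; lia.
rewrite pE qE {p q p3 q3 pE qE} in E.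
have ev (u a : int) : u = 2 * a -> (2 %| u)%Z by move=> ->; rewrite dvdz_mulr.
have E' : exists w' : int, x ^+ 2 + y ^+ 2 + z ^+ 2 + t ^+ 2 = 4 * w'.
  exists (2 * w + (P + 1) * y ^+ 2 + (U + 1) * z ^+ 2 - (4 * P * U + 3 * P + 3 * U + 2) * t ^+ 2).
  have -> : x ^+ 2 = w * (2 ^ 3)%N%:Z + (4 * P + 3) * y ^+ 2 + (4 * U + 3) * z ^+ 2
     - (4 * P + 3) * (4 * U + 3) * t ^+ 2 by rewrite -E; ring.
  by rewrite (_ : (2 ^ 3)%N = 8 :> int) //; ring.
have [w' {}E'] := E'.
case: (sqr_mod8 x) => [[x' hx [xb xE]]|[xb xE]]; case: (sqr_mod8 y) => [[y' hy [yb yE]]|[yb yE]];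
case: (sqr_mod8 z) => [[z' hz [zb zE]]|[zb zE]]; case: (sqr_mod8 t) => [[t' ht [tb tE]]|[tb tE]];
rewrite xE yE zE tE in E'; try (exfalso; clear - E'; lia).
  by split; [exact: ev hx | exact: ev hy | exact: ev hz | exact: ev ht].
exfalso; rewrite xE yE zE tE in E.
have : 4 * (2 * (w - xb + (4 * P + 3) * yb + (4 * U + 3) * zb - (4 * P + 3) * (4 * U + 3) * tb
    - 2 * P * U - P - U) - 1) = 0.
  have := E; rewrite (_ : (2 ^ 3)%N = 8 :> int) // => /eqP.
  by rewrite -subr_eq0 => /eqP H; rewrite -[RHS]oppr0 -H; ring.
by move: (w - xb + _ + _ - _ - _ - P - U) => X; clear; lia.
Qed.

Lemma eqm4_is3mod4 (r : nat) : odd r ->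
  ((r %% 4)%N = 1%N <-> ~~ is3mod4 r) /\ ((r %% 4)%N = 3%N <-> is3mod4 r).
Proof. by rewrite /is3mod4 => odd_r; split; split; lia. Qed.

Lemma legendre_quad_disc (d : int) p : prime p -> odd p -> legendre (quad_disc d) p = legendre d p.
Proof.
move=> pr_p odd_p; rewrite /quad_disc; case: ifP => // _.
rewrite -[4]/(2 * 2 : int) !legendreM // legendre2E //.
by case: is35mod8; rewrite ?expr1 ?mulrNN mul1r.
Qed.

Lemma squarefree_eq (d g m : int) : squarefree d -> d = g ^+ 2 * m -> d = m.
Proof.
move=> sqf dE; have : g \is a GRing.unit by apply: sqf; rewrite dE dvdz_mulr.
rewrite -[_ \is a _]/((g == 1) || (g == -1)) dE.
by case/orP => /eqP ->; rewrite ?sqrrN expr1n mul1r.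
Qed.

(* The square class of d1 d2 in Q_2 is that of d2 when d1 is a 2-adic square. *)
Lemma squarefree_mul_mod8 (d1 d2 g m : int) : squarefree d2 -> (d1 == 1 %[mod 8])%Z ->
  (d2 != 1 %[mod 8])%Z -> d1 * d2 = g ^+ 2 * m -> (m != 1 %[mod 8])%Z.
Proof.
move=> sqf d1E d2E E; apply: contra d2E => mE; rewrite !eqz_mod_dvd in d1E mE *.
have /dvdzP[a aE] := d1E; have /dvdzP[b bE] := mE.
have {aE}aE : d1 = a * 8 + 1 by rewrite -aE subrK.
have {bE}bE : m = b * 8 + 1 by rewrite -bE subrK.
move: E; rewrite aE bE; case: (sqr_mod8 g) => [[g' _ [c ->]]|[c ->]] E.
  have : (2 : int) \is a GRing.unit.
    by apply: sqf; apply/dvdzP; exists (c * (b * 8 + 1) - 2 * a * d2); move: E; lia.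
  by [].
by apply/dvdzP; exists (8 * c * b + c + b - a * d2); move: E; lia.
Qed.

Section Multiquadratic.
Variables (n : nat) (d : 'I_n -> int) (K : fieldExtType rat).
Hypotheses (d_sqfree : forall i, squarefree (d i)) (defK : is_multiquadratic d K).

Lemma squarefree_neq0 (x : int) : squarefree x -> x != 0.
Proof. by move=> sqf; apply/eqP => x0; have := sqf 2; rewrite x0 dvdz0 => /(_ isT). Qed.

Lemma multiquadratic_embedded l :
  (forall i k, exists r : int, ((l ^ k)%N %| r ^+ 2 - d i)%Z) ->
  locally_embedded l (fullv : {vspace K}).
Proof.
move=> d_sq; have [s s2 <-] := defK; apply: locally_embedded_adjoin_seq => _ /mapP[i _ ->].
by exists (d i).
Qed.

Lemma multiquadratic_division_odd p q : prime p -> odd p ->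
  (forall i, legendre (quad_disc (d i)) p = 1) -> legendre q%:Z p = -1 ->
  is_division_algebra (quaternion (p%:R : K) (q%:R : K)).
Proof.
move=> pr_p odd_p dp qp; apply: (@local_division K p q p 2) => //.
  apply: multiquadratic_embedded => i; have di := dp i; rewrite legendre_quad_disc // in di.
  by apply: hensel_odd => //; [rewrite -legendre0 di | apply: legendre1P].
by move=> x y z t; apply: anisotropic_odd.
Qed.

Lemma multiquadratic_division_odd_sym p q : prime q -> odd q ->
  (forall i, legendre (quad_disc (d i)) q = 1) -> legendre p%:Z q = -1 ->
  is_division_algebra (quaternion (p%:R : K) (q%:R : K)).
Proof.
move=> pr_q odd_q dq pq; apply: (@local_division K p q q 2) => //.
  apply: multiquadratic_embedded => i; have di := dq i; rewrite legendre_quad_disc // in di.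
  by apply: hensel_odd => //; [rewrite -legendre0 di | apply: legendre1P].
move=> x y z t H; have [|h1 h2 h3 h4] := @anisotropic_odd q p x z y t pr_q odd_q pq; last by split.
by congr (_ %| _)%Z: H; ring.
Qed.

Lemma multiquadratic_division_two p q : is3mod4 p -> is3mod4 q ->
  (forall i, (d i = 1 %[mod 8])%Z) ->
  is_division_algebra (quaternion (p%:R : K) (q%:R : K)).
Proof.
move=> p3 q3 d8; apply: (@local_division K p q 2 3) => //.
  apply: multiquadratic_embedded => i; apply: hensel_two.
  by rewrite -eqz_mod_dvd; apply/eqP/d8.
by move=> x y z t; apply: anisotropic_two.
Qed.

(** d i is a nonsquare at p, and d j at the other ramified prime. If neither is a nonsquare at both,
    each is a square where the other is not, and the product d i * d j is a nonsquare at both. *)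
Lemma multiquadratic_isotropic p q (fl : bool) (i j : 'I_n) :
  prime p -> prime q -> odd p -> odd q -> p != q ->
  (forall i, ~~ (p %| d i)%Z) -> (forall i, ~~ (q %| d i)%Z) ->
  legendre q p = -1 -> legendre p q = (-1) ^+ fl ->
  (if fl then ~~ (is3mod4 p && is3mod4 q) else is3mod4 p && is3mod4 q) ->
  legendre (d i) p = -1 ->
  (if fl then legendre (d j) q = -1 : Prop else (d j != 1 %[mod 8])%Z : Prop) ->
  norm_isotropic K p q.
Proof.
move=> pr_p pr_q odd_p odd_q neq_pq pNd qNd qp pq hpq ip jq.
have [s s2 _] := defK.
have single k : legendre (d k) p = -1 ->
    (if fl then legendre (d k) q = -1 : Prop else (d k != 1 %[mod 8])%Z : Prop) ->
    norm_isotropic K p q.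
  move=> kp kq; apply: (@norm_isotropic_int K p q (d k) (s k) fl) => //.
    exact: squarefree_neq0.
  move: hpq kq; case: (fl) => // h1 h2; split=> // g m dE.
  by rewrite -(squarefree_eq (@d_sqfree k) dE).
have [jp|jp] := eqVneq (legendre (d j) p) (-1); first exact: (single j).
have {}jp : legendre (d j) p = 1 by case: (legendre_val (pNd j)) jp => // ->.
have [iq|iq] := boolP (if fl then legendre (d i) q == -1 else (d i != 1 %[mod 8])%Z).
  by apply: (single i) => //; move: iq; case: (fl) => // /eqP.
apply: (@norm_isotropic_int K p q (d i * d j) (s i * s j) fl) => //.
- by rewrite mulf_neq0 ?squarefree_neq0.
- by rewrite exprMn !s2 rmorphM.
- by rewrite -legendre0 legendreM // ip jp.
- by rewrite -legendre0 legendreM // mulf_neq0 ?legendre0.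
- by rewrite legendreM // ip jp.
move: hpq iq jq; case: (fl) => hpq iq jq; split=> //.
  rewrite legendreM // jq; case: (legendre_val (qNd i)) iq => -> //.
by move=> g m; apply: squarefree_mul_mod8 => //; rewrite -[_ == _]negbK.
Qed.

End Multiquadratic.

Theorem theorem5p8 (n : nat) (d : 'I_n -> int) (p q : nat)
    (K : fieldExtType rat)
    (n_ge2 : (2 <= n)%N)
    (d_inj : injective d)
    (d_sqfree : forall i, squarefree (d i))
    (d_neq1 : forall i, d i != 1)
    (p_prime : prime p) (q_prime : prime q)
    (p_odd : odd p) (q_odd : odd q) (p_neq_q : p != q)
    (p_ndiv : forall i, ~~ (p %| d i)%Z)
    (q_ndiv : forall i, ~~ (q %| d i)%Z)
    (defK : is_multiquadratic d K) :
  is_division_algebra (quaternion (p%:R : K) (q%:R : K)) <->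
  [\/ [/\ odd p /\ odd q /\ p != q,
          legendre p q = - 1,
          p = 1 %[mod 4] \/ q = 1 %[mod 4]
        & (forall i, legendre (quad_disc (d i)) p = 1) \/
          (forall i, legendre (quad_disc (d i)) q = 1)],
      [/\ q = 2%N,
          p = 3 %[mod 8] \/ p = 5 %[mod 8]
        & (forall i, legendre (quad_disc (d i)) p = 1) \/
          (forall i, (d i = 1 %[mod 8])%Z)]
    | [/\ odd p /\ odd q,
          p = 3 %[mod 4] /\ q = 3 %[mod 4]
        & (legendre q p <> 1 /\
            ((forall i, legendre (quad_disc (d i)) p = 1) \/
             (forall i, (d i = 1 %[mod 8])%Z))) \/
          (legendre p q <> 1 /\
            ((forall i, legendre (quad_disc (d i)) q = 1) \/
             (forall i, (d i = 1 %[mod 8])%Z)))]].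
Proof.
have q_neq_p : q != p by rewrite eq_sym.
have qr := quadratic_reciprocity p_prime q_prime p_odd q_odd p_neq_q.
have pNq : ~~ (p %| q%:Z)%Z by rewrite dvdzE /= dvdn_prime2.
have qNp : ~~ (q %| p%:Z)%Z by rewrite dvdzE /= dvdn_prime2.
have mod4 r : odd r -> (r = 1 %[mod 4] <-> ~~ is3mod4 r) /\ (r = 3 %[mod 4] <-> is3mod4 r).
  by move=> odd_r; exact: eqm4_is3mod4.
have [p1 p3] := mod4 p p_odd; have [q1 q3] := mod4 q q_odd.
have nonresidue (l : nat) : prime l -> odd l -> (forall i, ~~ (l %| d i)%Z) ->
    (forall i, legendre (quad_disc (d i)) l = 1) \/ exists i, legendre (d i) l = -1.
  move=> pr_l odd_l lNd; have [/forallP H|] := boolP [forall i, legendre (d i) l == 1].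
    by left=> i; rewrite legendre_quad_disc //; apply/eqP.
  rewrite negb_forall => /existsP[i ne]; right; exists i.
  by case: (legendre_val (lNd i)) ne => ->.
have nonsquare2 : (forall i, (d i = 1 %[mod 8])%Z) \/ exists i, (d i != 1 %[mod 8])%Z.
  have [/forallP H|] := boolP [forall i, (d i == 1 %[mod 8])%Z].
    by left=> i; apply/eqP/H.
  by rewrite negb_forall => /existsP[i ne]; right; exists i.
have nonresidue_p := nonresidue p p_prime p_odd p_ndiv.
have nonresidue_q := nonresidue q q_prime q_odd q_ndiv.
split=> [div|].
  have no_iso : ~ norm_isotropic K p q by move=> /isotropic_not_division; apply.
  have no_iso' : ~ norm_isotropic K q p by move=> /norm_isotropic_sym.
  have [h3|h3] := boolP (is3mod4 p && is3mod4 q).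
    have /andP[hp3 hq3] := h3; apply: Or33; split=> //; first by split; [apply/p3 | apply/q3].
    rewrite h3 expr1 mulN1r in qr.
    (* Exactly one of the two symbols is -1, so the algebra over Q ramifies at 2 and at one of p and
       q; if that is q, the roles of p and q are exchanged. *)
    case: (legendre_val pNq) => qp; rewrite qp in qr *; rewrite qr.
      right; split=> //; case: nonresidue_q => [|[i iq]]; first by left.
      case: nonsquare2 => [|[j j8]]; first by right.
      case: no_iso'; apply: (@multiquadratic_isotropic n d K _ defK q p false i j) => //.
      by rewrite andbC.
    left; split=> //; case: nonresidue_p => [|[i ip]]; first by left.
    case: nonsquare2 => [|[j j8]]; first by right.
    by case: no_iso; apply: (@multiquadratic_isotropic n d K _ defK p q false i j).
  (* Now the two symbols agree: with value 1 the algebra already splits over Q, with value -1 it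
     ramifies at p and q. *)
  rewrite (negPf h3) expr0 mul1r in qr.
  case: (legendre_val pNq) => qp; rewrite qp in qr.
    by case: no_iso; apply: norm_isotropic_rational.
  apply: Or31; split=> //.
    by move: h3; rewrite negb_and => /orP[/p1|/q1]; [left | right].
  case: nonresidue_p => [|[i ip]]; first by left.
  case: nonresidue_q => [|[j jq]]; first by right.
  by case: no_iso; apply: (@multiquadratic_isotropic n d K _ defK p q true i j).
case=> [[_ pq h1 hd]|[q2]|[_ [/p3 hp3 /q3 hq3] hd]]; last 2 first.
- by rewrite q2 in q_odd.
- rewrite hp3 hq3 expr1 mulN1r in qr.
  case: hd => -[ne [hd|hd]].
  + apply: (multiquadratic_division_odd defK) => //.
    by case: (legendre_val pNq).
  + exact: (multiquadratic_division_two defK).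
  + apply: (multiquadratic_division_odd_sym defK) => //.
    by case: (legendre_val qNp).
  exact: (multiquadratic_division_two defK).
have qp : legendre q p = -1.
  have h3 : is3mod4 p && is3mod4 q = false by case: h1 => [/p1|/q1] /negbTE ->; rewrite ?andbF.
  by rewrite h3 expr0 mul1r pq in qr.
case: hd => hd; first exact: (multiquadratic_division_odd defK).
exact: (multiquadratic_division_odd_sym defK).
Qed.
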